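(* Let $G$ be a countable group, let $G \curvearrowright (X,\mu)$ and $G \curvearrowright (Z,\eta)$ be p.m.p. actions with $G \curvearrowright (Z,\eta)$ aperiodic, and let $\lambda$ be a joining of these two actions (on $X \times Z$). Let $\theta = (\mathrm{Stab}\circ\pi^Z)_*(\lambda)$ be the stabilizer type of $G \curvearrowright (Z,\eta)$, where $\pi^Z : X \times Z \to Z$ is the projection. Assume that $G \curvearrowright (Y,\nu)$ is a p.m.p. action which has stabilizer type $\theta$ and is weakly contained in all p.m.p. actions of $G$ of stabilizer type $\theta$. Then the joinings $G \curvearrowright (X \times Z, \lambda)$ and $G \curvearrowright (X \times Z \times Y, \lambda\times_\theta\nu)$ are weakly equivalent as joinings with $G \curvearrowright (X,\mu)$ (where $X \times Z \times Y = X \times (Z \times Y)$ is regarded as a joining of $X$ with $Z \times Y$).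
   Context: Conventions: all probability spaces are standard; null sets are ignored; p.m.p. means probability-measure-preserving. An action is aperiodic if almost every orbit is infinite. A joining of $\mu$ with $\eta$ is a $G$-invariant (for the diagonal action) Borel probability measure on $X \times Z$ with marginals $\mu$ and $\eta$. Subsets of factors of a product are identified with their pre-images under the coordinate projections. Stabilizer type: $\mathrm{Sub}(G)$ is the space of subgroups of $G$ with base of open sets $\{H : H \cap T = F\}$, $F \subseteq T \subseteq G$ finite. The stabilizer type of $G \curvearrowright (Z,\eta)$ is the push-forward $\mathrm{Stab}_*(\eta)$ of $\eta$ under $z \mapsto \mathrm{Stab}(z)$. Here $\lambda\times_\theta\nu = \int_{\mathrm{Sub}(G)} \lambda_H \times \nu_H\, d\theta(H)$ is the relatively independent joining, where $\lambda = \int \lambda_H\, d\theta(H)$ is the disintegration with respect to $\mathrm{Stab}\circ\pi^Z : X \times Z \to \mathrm{Sub}(G)$ and $\nu = \int \nu_H\, d\theta(H)$ is the disintegration with respect to $\mathrm{Stab} : Y \to \mathrm{Sub}(G)$. Weak containment of actions: $G \curvearrowright (Z,\eta)$ weakly contains $G \curvearrowright (Y,\nu)$ if for every finite ordered partition $\{C_1,\dots,C_n\}$ of $Y$, every finite $T \subseteq G$ and every $\epsilon > 0$ there is an ordered partition $\{D_1,\dots,D_n\}$ of $Z$ with $\sum_{f \in \{1,\dots,n\}^T} \big|\eta(\bigcap_{t \in T} t^{-1}\cdot D_{f(t)}) - \nu(\bigcap_{t \in T} t^{-1}\cdot C_{f(t)})\big| < \epsilon$. Weak containment of joinings: for joinings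 $\lambda_1$ on $X \times Y_1$ and $\lambda_2$ on $X \times Y_2$ of $\mu$ with p.m.p. actions of $G$ on $Y_1$, $Y_2$, $G \curvearrowright (X \times Y_1,\lambda_1)$ weakly contains $G \curvearrowright (X \times Y_2,\lambda_2)$ as joinings with $G \curvearrowright (X,\mu)$ if for every finite ordered partition $\{A_1,\dots,A_m\}$ of $X$, every finite ordered partition $\{C_1,\dots,C_n\}$ of $Y_2$, every finite $T \subseteq G$ and every $\epsilon > 0$ there is an ordered partition $\{D_1,\dots,D_n\}$ of $Y_1$ with $$\sum_{i=1}^m \sum_{f \in \{1,\dots,n\}^T} \Big| \lambda_1\Big(A_i \cap \bigcap_{t \in T} t^{-1}\cdot D_{f(t)}\Big) - \lambda_2\Big(A_i \cap \bigcap_{t \in T} t^{-1}\cdot C_{f(t)}\Big)\Big| < \epsilon.$$ They are weakly equivalent as joinings with $G \curvearrowright (X,\mu)$ if each weakly contains the other as joinings with $G \curvearrowright (X,\mu)$. *)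

(* Defs.v *)
From HB Require Import structures.
From mathcomp Require Import all_boot all_order all_algebra.
From mathcomp Require Import finmap all_classical all_reals all_analysis.
From mathcomp Require Import measurable_realfun.

Set Implicit Arguments.
Unset Strict Implicit.
Unset Printing Implicit Defensive.
Import Order.TTheory GRing.Theory Num.Theory.
Local Open Scope classical_set_scope.
Local Open Scope ring_scope.

#[short(type="completeMetricType")]
HB.structure Definition CompleteMetric (R : numDomainType) :=
  {T of Metric R T & Complete T}.

Definition separable (T : topologicalType) : Prop :=
  exists2 D : set T, countable D & dense D.

(* The measurable space T carries the Borel sets of a Polish topology,
   presented as a separable complete metric space P in bijection with T. *)
Definition standard_borel (R : realType) d (T : measurableType d) : Prop :=
  exists (P : completeMetricType R) (f : T -> P),
    [/\ separable P, bijective f &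
      forall B : set P, <<s @open P >> B <-> measurable (f @^-1` B)].

Record subgroup (G : groupType) := Subgroup {
  subgroup_set :> set G;
  subgroup1 : subgroup_set 1%g;
  subgroupM : forall x y,
    subgroup_set x -> subgroup_set y -> subgroup_set (x * y)%g;
  subgroupV : forall x, subgroup_set x -> subgroup_set x^-1%g }.

Section subgroup_space.
Variable G : groupType.

Let triv : set G := [set 1%g].
Let triv1 : triv 1%g. Proof. by []. Qed.
Let trivM x y : triv x -> triv y -> triv (x * y)%g.
Proof. by rewrite /triv /= => -> ->; rewrite mul1g. Qed.
Let trivV x : triv x -> triv x^-1%g.
Proof. by rewrite /triv /= => ->; rewrite invg1. Qed.

Definition trivial_subgroup : subgroup G := Subgroup triv1 trivM trivV.

HB.instance Definition _ := gen_eqMixin (subgroup G).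
HB.instance Definition _ := gen_choiceMixin (subgroup G).
HB.instance Definition _ := isPointed.Build (subgroup G) trivial_subgroup.

(* An index is a pair (T, F) of finite sets with F `<=` T `<=` G. *)
Let base_idx : set (set G * set G) :=
  [set i | finite_set i.1 /\ i.2 `<=` i.1].
Let base (i : set G * set G) : set (subgroup G) :=
  [set H | (H : set G) `&` i.1 = i.2].

Let base_cover : \bigcup_(i in base_idx) base i = setT.
Proof.
apply/seteqP; split => // H _; exists (set0, set0); first by split.
by rewrite /base /= setI0.
Qed.

Let base_join i j H : base_idx i -> base_idx j -> base i H -> base j H ->
  exists k, [/\ base_idx k, base k H & base k `<=` base i `&` base j].
Proof.
move=> [fi si] [fj sj] Hi Hj.
exists (i.1 `|` j.1, (H : set G) `&` (i.1 `|` j.1)); split => //.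
  by split; [rewrite finite_setU|exact: subIsetr].
move=> K; rewrite /base /= => KH; split.
  rewrite -Hi; have <- := setIidr (@subsetUl _ i.1 j.1).
  by rewrite 2!setIA KH.
rewrite -Hj; have <- := setIidr (@subsetUr _ i.1 j.1).
by rewrite 2!setIA KH.
Qed.

HB.instance Definition _ :=
  isBaseTopological.Build (subgroup G) base_cover base_join.

End subgroup_space.

(* The measurable space of subgroups, for the Borel sets of the topology above. *)
Notation SubGrp G := (g_sigma_algebraType (@open (subgroup G))).

Record borel_action (G : groupType) d (X : measurableType d) := BorelAction {
  act :> G -> X -> X;
  act1 : forall x, act 1%g x = x;
  actM : forall g h x, act (g * h)%g x = act g (act h x);
  measurable_act : forall g, measurable_fun [set: X] (act g) }.

Section diagonal_action.
Context (G : groupType) d1 d2 (X : measurableType d1) (Y : measurableType d2).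
Variables (aX : borel_action G X) (aY : borel_action G Y).

Let dact g (p : X * Y) : X * Y := (aX g p.1, aY g p.2).
Let dact1 p : dact 1%g p = p.
Proof. by rewrite /dact !act1 -surjective_pairing. Qed.
Let dactM g h p : dact (g * h)%g p = dact g (dact h p).
Proof. by rewrite /dact !actM. Qed.
Let measurable_dact g : measurable_fun setT (dact g).
Proof.
apply/measurable_fun_pairP; split.
  exact: measurableT_comp (measurable_act aX g) measurable_fst.
exact: measurableT_comp (measurable_act aY g) measurable_snd.
Qed.

Definition diag_action : borel_action G (X * Y)%type :=
  BorelAction dact1 dactM measurable_dact.

End diagonal_action.

Section stabilizer.
Context (G : groupType) d (X : measurableType d) (a : borel_action G X) (x : X).

Let s : set G := [set g | a g x = x].
Let s1 : s 1%g. Proof. exact: act1. Qed.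
Let sM g h : s g -> s h -> s (g * h)%g.
Proof. by rewrite /s /= => gx hx; rewrite actM hx. Qed.
Let sV g : s g -> s g^-1%g.
Proof. by rewrite /s /= => gx; rewrite -[in LHS]gx -actM mulVg act1. Qed.

Definition stab : SubGrp G := Subgroup s1 sM sV.

End stabilizer.

Section actions.
Context (G : groupType) (R : realType).

Definition invariant d (X : measurableType d) (a : borel_action G X)
    (mu : probability X R) : Prop :=
  forall g A, measurable A -> mu (a g @^-1` A) = mu A.

Definition pmp_action d (X : measurableType d) (a : borel_action G X)
    (mu : probability X R) : Prop :=
  standard_borel R X /\ invariant a mu.

Definition aperiodic d (X : measurableType d) (a : borel_action G X)
    (mu : probability X R) : Prop :=
  {ae mu, forall x, infinite_set (range (a ^~ x))}.

(* Q = f_* P; the values off the sigma-algebra are irrelevant. *)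
Definition is_pushforward d d' (T : measurableType d) (T' : measurableType d')
    (f : T -> T') (P : probability T R) (Q : probability T' R) : Prop :=
  forall A, measurable A -> Q A = pushforward P f A.

Definition stabilizer_type d (X : measurableType d) (a : borel_action G X)
    (mu : probability X R) (theta : probability (SubGrp G) R) : Prop :=
  is_pushforward (stab a) mu theta.

Definition joining d1 d2 (X : measurableType d1) (Z : measurableType d2)
    (aX : borel_action G X) (mu : probability X R)
    (aZ : borel_action G Z) (eta : probability Z R)
    (lambda : probability (X * Z)%type R) : Prop :=
  [/\ invariant (diag_action aX aZ) lambda,
      is_pushforward fst lambda mu & is_pushforward snd lambda eta].

(* Pieces may be empty. *)
Definition ordered_partition d (X : measurableType d) (n : nat)
    (C : 'I_n -> set X) : Prop :=
  [/\ forall i, measurable (C i), trivIset setT C & \bigcup_i C i = setT].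

(* \bigcap_{t \in T} t^{-1} . C_{f(t)} *)
Definition cell d (X : measurableType d) (a : borel_action G X)
    (T : {fset G}) (n : nat) (C : 'I_n -> set X) (f : {ffun T -> 'I_n}) :
    set X :=
  \bigcap_(t in [set: T]) (a (fsval t)^-1%g @` C (f t)).

(* (Z, eta) weakly contains (Y, nu). *)
Definition weakly_contains d1 d2
    (Z : measurableType d1) (aZ : borel_action G Z) (eta : probability Z R)
    (Y : measurableType d2) (aY : borel_action G Y) (nu : probability Y R) :
    Prop :=
  forall (n : nat) (C : 'I_n -> set Y) (T : {fset G}) (eps : R),
    ordered_partition C -> 0 < eps ->
    exists2 D : 'I_n -> set Z, ordered_partition D &
      (\sum_(f : {ffun T -> 'I_n})
         `| eta (cell aZ D f) - nu (cell aY C f) | < eps%:E)%E.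

Section joinings.
Context d0 (X : measurableType d0) (aX : borel_action G X)
  (mu : probability X R).

Definition joining_over d (Y : measurableType d) (aY : borel_action G Y)
    (lambda : probability (X * Y)%type R) : Prop :=
  exists nu : probability Y R, joining aX mu aY nu lambda.

(* (X * Y1, lambda1) weakly contains (X * Y2, lambda2) as joinings with
   (X, mu); the relation is between joinings of (X, mu), which the first two
   clauses record. A subset of a factor is pulled back to the product. *)
Definition joining_weakly_contains d1 d2
    (Y1 : measurableType d1) (aY1 : borel_action G Y1)
    (lambda1 : probability (X * Y1)%type R)
    (Y2 : measurableType d2) (aY2 : borel_action G Y2)
    (lambda2 : probability (X * Y2)%type R) : Prop :=
  [/\ joining_over aY1 lambda1, joining_over aY2 lambda2 &
    forall (m n : nat) (A : 'I_m -> set X) (C : 'I_n -> set Y2)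
           (T : {fset G}) (eps : R),
      ordered_partition A -> ordered_partition C -> 0 < eps ->
      exists2 D : 'I_n -> set Y1, ordered_partition D &
        (\sum_(i < m) \sum_(f : {ffun T -> 'I_n})
           `| lambda1 ((fst @^-1` A i) `&` (snd @^-1` cell aY1 D f))
              - lambda2 ((fst @^-1` A i) `&` (snd @^-1` cell aY2 C f)) |
         < eps%:E)%E].

Definition joining_weakly_equivalent d1 d2
    (Y1 : measurableType d1) (aY1 : borel_action G Y1)
    (lambda1 : probability (X * Y1)%type R)
    (Y2 : measurableType d2) (aY2 : borel_action G Y2)
    (lambda2 : probability (X * Y2)%type R) : Prop :=
  joining_weakly_contains aY1 lambda1 aY2 lambda2 /\
  joining_weakly_contains aY2 lambda2 aY1 lambda1.

End joinings.
End actions.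

(* k is a disintegration of P with respect to f, theta being f_* P. *)
Definition disintegration (R : realType) d d'
    (W : measurableType d) (S : measurableType d') (f : W -> S)
    (P : probability W R) (theta : probability S R)
    (k : R.-pker S ~> W) : Prop :=
  (forall A, measurable A -> P A = \int[theta]_s k s A)%E /\
  {ae theta, forall s, k s (f @^-1` [set s]) = 1%E}.

Section relatively_independent_joining.
Context (R : realType) d0 d1 d2 d3 (S : measurableType d0)
  (X : measurableType d1) (Z : measurableType d2) (Y : measurableType d3).
Variables (theta : probability S R) (k : R.-pker S ~> (X * Z)%type)
  (l : R.-pker S ~> Y).
Local Open Scope ereal_scope.

Let assoc (p : (X * Z) * Y) : X * (Z * Y) := (p.1.1, (p.1.2, p.2)).

(* \int k_s \x l_s d theta(s), carried to X * (Z * Y). *)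
Definition rel_indep_joining (A : set (X * (Z * Y))) : \bar R :=
  \int[theta]_s (k s \x l s) (assoc @^-1` A).

Let measurable_assoc : measurable_fun setT assoc.
Proof.
by apply/measurable_fun_pairP; split; [|apply/measurable_fun_pairP; split];
  rewrite ?/comp /=; do ?apply: measurableT_comp.
Qed.

Let massoc A : measurable A -> measurable (assoc @^-1` A).
Proof. by move=> mA; rewrite -[X in measurable X]setTI; exact: measurable_assoc. Qed.

Let l1 (p : S * (X * Z)) : {measure set Y -> \bar R} := l p.1.
Let measurable_l1 U : measurable U ->
  measurable_fun [set: S * (X * Z)] (l1 ^~ U : _ -> \bar R).
Proof.
move=> mU.
exact: measurableT_comp (measurable_kernel l _ mU) measurable_fst.
Qed.
HB.instance Definition _ := isKernel.Build _ _ _ _ R l1 measurable_l1.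
Let l1_prob p : l1 p setT = 1. Proof. exact: prob_kernel. Qed.
HB.instance Definition _ := Kernel_isProbability.Build _ _ _ _ R l1 l1_prob.

Let measurable_prod B : measurable B ->
  measurable_fun setT (fun s => (k s \x l s) B).
Proof.
move=> mB.
pose h (q : S * (X * Z)) := l q.1 (xsection B q.2).
apply: (@measurable_fun_integral_finite_kernel _ _ _ _ _ h k) => //.
pose c (q : (S * (X * Z)) * Y) : (X * Z) * Y := (q.1.2, q.2).
have mc : measurable_fun setT c.
  apply/measurable_fun_pairP; split; last exact: measurable_snd.
  exact: (measurableT_comp measurable_snd measurable_fst).
have mB' : c @^-1` B \in measurable.
  by rewrite inE -[X in measurable X]setTI; exact: mc.
rewrite [X in measurable_fun _ X](_ : _ =
    (fun q => l1 q (xsection (c @^-1` B) q))).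
  exact: measurable_fun_xsection_finite_kernel mB'.
apply/funext => q; rewrite /h /l1; congr (l q.1 _).
Qed.

Let l' s : set Y -> \bar R := l s.
HB.instance Definition _ s := Measure.on (l' s).
Let l'_prob s : l' s setT = 1. Proof. exact: prob_kernel. Qed.
HB.instance Definition _ s :=
  Measure_isProbability.Build _ _ R (l' s) (l'_prob s).
Let prodm s : {measure set (X * Z * Y) -> \bar R} := k s \x l' s.

Let rij0 : rel_indep_joining set0 = 0.
Proof.
apply: integral0_eq => s _; rewrite preimage_set0; exact: (measure0 (prodm s)).
Qed.

Let rij_ge0 A : 0 <= rel_indep_joining A.
Proof. by apply: integral_ge0 => s _; exact: (measure_ge0 (prodm s)). Qed.

Let rij_sigma_additive : semi_sigma_additive rel_indep_joining.
Proof.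
move=> F mF tF mUF.
rewrite [X in _ --> X](_ : _ = \sum_(n <oo) rel_indep_joining (F n)).
  by apply/cvg_closeP; split; [exact: is_cvg_nneseries|rewrite closeE].
have m0 n s : [set: S] s -> 0 <= (k s \x l s) (assoc @^-1` F n).
  by move=> _; exact: (measure_ge0 (prodm s)).
have mk n := measurable_prod (massoc (mF n)).
rewrite -integral_nneseries//.
apply: eq_integral => s _; apply/esym/cvg_lim => //=; rewrite preimage_bigcup.
have tF' : trivIset setT (fun n => assoc @^-1` F n).
  by move=> i j _ _ [p [/= Fi Fj]]; apply: tF => //; exists (assoc p).
have mF' n : measurable (assoc @^-1` F n) by exact: massoc.
exact: (@measure_sigma_additive _ _ _ (prodm s) _ mF' tF').
Qed.

HB.instance Definition _ := isMeasure.Build _ _ R rel_indep_joining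
  rij0 rij_ge0 rij_sigma_additive.

Let rij_setT : rel_indep_joining setT = 1.
Proof.
rewrite /rel_indep_joining (eq_integral (cst 1)).
  by rewrite integral_cst// mul1e; exact: probability_setT.
move=> s _; rewrite preimage_setT -setXTT.
rewrite (product_measure1E (k s) (l' s))//=.
by rewrite /l' !prob_kernel mule1.
Qed.

HB.instance Definition _ :=
  Measure_isProbability.Build _ _ R rel_indep_joining rij_setT.

End relatively_independent_joining.

(* Main.v *)
From HB Require Import structures.
Require Import Defs.
From mathcomp Require Import all_boot all_order all_algebra.
From mathcomp Require Import finmap all_classical all_reals all_analysis.
From mathcomp Require Import measurable_realfun.
From mathcomp Require Import ring lra.

(** The joining with X * Z is a factor of the one with X * Z * Y, so only one
    direction needs work.  A partition of Z * Y is nearly measurable with respect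
    to a partition b of Z and a partition q of Y.  Let alpha be the partition of
    X * Z given by the one of X and the T-translates of b.  By the disintegrations,
    the law under [rel_indep_joining] of alpha together with the translates of q is
    found by integrating over Y, with the weights u_i(H) = lambda_H(alpha = i) read
    at H = Stab(y).  Hence it is enough to copy into Z, independently of alpha given
    the stabilizer, the joint law of the translates of q and of the stabilizer.

    Colour the orbits of Z by independent fair bits: z is sent to the element
    g |-> (bit of the point g z) of {0,1}^G.  As orbits are infinite, this map
    preserves stabilizers almost surely, so its law omega is an action of type
    theta and by minimality weakly contains Y; since the stabilizer types agree,
    the weak containment can be made to respect the stabilizers too.  Finally a
    random colouring of the atoms of a fine partition of Z replaces the
    independent bits: a second moment estimate, based on eta having no atoms,
    shows that some such colouring has, jointly with alpha, nearly the law
    prescribed by omega (the argument of Abert and Weiss). *)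

Set Implicit Arguments.
Unset Strict Implicit.
Unset Printing Implicit Defensive.
Import Order.TTheory GRing.Theory Num.Theory.
Local Open Scope classical_set_scope.
Local Open Scope ring_scope.

(** * Finite labels and their laws *)

(** The pivot is that both sides see Z only through stabilizers. Whether [g z = h z] holds depends
    on Stab(z) alone, so the chance that the random colours of an orbit show a given finite pattern
    is a function of Stab(z). Hence alpha and the colours are independent given the stabilizer, just
    as alpha and Y are under [rel_indep_joining]. This is also why omega forgets z: a partition of
    {0,1}^G depends on the colours only, whereas a partition of Z times the bits could correlate
    with alpha.

    Two obstacles remain. Plain weak containment says nothing about stabilizers; the events
    [g x = x] are guessed from a partition, with an error that is one-sided and therefore controlled
    by the equal probabilities of these events in the two actions. And the partition of {0,1}^G that
    minimality supplies is arbitrary; it is first replaced by one that reads finitely many bits, so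
    that only finitely many colours per point have to be imitated in Z. The imitation colours
    finitely many atoms of Z; its variance is small because two independent points of Z rarely share
    an atom, its bias because distinct points of one orbit rarely do. *)

Section labels.
Context d (T : measurableType d).

(** Partitions are handled as measurable maps to finite types: joining two of them is pairing,
    coarsening is composition, and the law is a vector indexed by the type. *)
Definition label (I : finType) (f : T -> I) : Prop :=
  forall i, measurable (f @^-1` [set i]).

Lemma label_preimage (I : finType) (f : T -> I) (S : set I) :
  label f -> measurable (f @^-1` S).
Proof.
move=> mf; rewrite (_ : f @^-1` S = \bigcup_(i in S) (f @^-1` [set i])).
  by apply: fin_bigcup_measurable => // i _; exact: mf.
by apply/seteqP; split => [x Sx|x [i Si /= xi]]; [exists (f x)|rewrite /= xi].
Qed.

Lemma label_comp (I J : finType) (phi : I -> J) (f : T -> I) :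
  label f -> label (phi \o f).
Proof. by move=> mf j; exact: (label_preimage (phi @^-1` [set j]) mf). Qed.

Lemma label_pair (I J : finType) (f : T -> I) (g : T -> J) :
  label f -> label g -> label (fun x => (f x, g x)).
Proof.
move=> mf mg [i j].
rewrite (_ : _ @^-1` _ = f @^-1` [set i] `&` g @^-1` [set j]).
  exact: measurableI.
by apply/seteqP; split => x /= [-> ->].
Qed.

Lemma label_ffun (K I : finType) (f : K -> T -> I) :
  (forall k, label (f k)) -> label (fun x => [ffun k => f k x]).
Proof.
move=> mf h.
rewrite (_ : _ @^-1` _ = \bigcap_(k in [set: K]) (f k @^-1` [set h k])).
  by apply: fin_bigcap_measurable => // k _; exact: mf.
apply/seteqP; split => x /=; first by move=> <- k _ /=; rewrite ffunE.
by move=> H; apply/ffunP => k; rewrite ffunE; exact: (H k).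
Qed.

Lemma label_neq (I : finType) (f g : T -> I) :
  label f -> label g -> measurable [set x | f x != g x].
Proof.
move=> mf mg.
exact: (@label_preimage _ (fun x => (f x, g x)) [set p | p.1 != p.2]
  (label_pair mf mg)).
Qed.

Lemma label_bool (A : set T) : measurable A -> label (fun x => `[< A x >]).
Proof.
move=> mA [].
  by rewrite (_ : _ @^-1` _ = A)//; apply/seteqP; split => x /asboolP.
rewrite (_ : _ @^-1` _ = ~` A); first exact: measurableC.
by apply/seteqP; split => x /=; [move/negbT/asboolPn|move/asboolPn/negbTE].
Qed.

End labels.

Lemma label_measurable d d' (T : measurableType d) (T' : measurableType d')
    (I : finType) (f : T' -> I) (g : T -> T') :
  measurable_fun setT g -> label f -> label (f \o g).
Proof.
by move=> mg mf i; rewrite -[X in measurable X]setTI; exact: (mg measurableT _ (mf i)).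
Qed.

Section laws.
Context (R : realType).

Lemma sum_delta (I : finType) (a : I) : \sum_i (a == i)%:R = 1 :> R.
Proof.
rewrite (bigD1 a) //= eqxx big1 ?addr0// => i /negbTE.
by rewrite eq_sym => ->.
Qed.

Definition pr d (T : measurableType d) (P : probability T R) (A : set T) : R :=
  fine (P A).

Definition law d (T : measurableType d) (P : probability T R) (I : finType)
  (f : T -> I) (i : I) : R := pr P (f @^-1` [set i]).

(** The l1 distance, twice the total variation; left without the factor 1/2 to match the sums in the
    definitions of weak containment. *)
Definition ldist (I : finType) (p q : I -> R) : R := \sum_i `|p i - q i|.

Section pr.
Context d (T : measurableType d) (P : probability T R).

Lemma prE A : measurable A -> (pr P A)%:E = P A.
Proof. by move=> mA; rewrite /pr fineK// fin_num_measure. Qed.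

Lemma pr_ge0 A : 0 <= pr P A.
Proof. exact: fine_ge0. Qed.

Lemma pr_le A B : measurable A -> measurable B -> A `<=` B -> pr P A <= pr P B.
Proof.
by move=> mA mB AB; rewrite -lee_fin !prE//; apply: le_measure; rewrite ?inE.
Qed.

Lemma prT : pr P setT = 1.
Proof. by rewrite /pr probability_setT. Qed.

Lemma pr0 : pr P set0 = 0.
Proof. by rewrite /pr measure0. Qed.

Lemma pr_le1 A : measurable A -> pr P A <= 1.
Proof. by move=> mA; rewrite -prT; exact: pr_le. Qed.

Lemma prU A B : measurable A -> measurable B -> A `&` B = set0 ->
  pr P (A `|` B) = pr P A + pr P B.
Proof.
move=> mA mB AB; apply: EFin_inj; rewrite EFinD !prE//; last exact: measurableU.
exact: measureU.
Qed.

Lemma pr_law (I : finType) (f : T -> I) (S : pred I) A :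
  measurable A -> label f ->
  pr P (A `&` [set x | S (f x)]) =
  \sum_(i | S i) pr P (A `&` f @^-1` [set i]).
Proof.
move=> mA mf; rewrite -big_enum /= (_ : [set x | S (f x)] =
    [set x | f x \in enum S]); last first.
  by apply: eq_set => x; rewrite mem_enum.
elim: (enum S) (enum_uniq S) => [|i s IH] /= => [_|/andP[si us]].
  rewrite big_nil (_ : [set _ | _] = set0) ?setI0 ?pr0//.
  by apply/seteqP; split.
rewrite big_cons -IH// -prU.
- congr (pr P _); rewrite -setIUr; congr (_ `&` _).
  apply/seteqP; split => x /=; rewrite in_cons.
    by case/orP => [/eqP|]; [left|right].
  by case => [->|->]; rewrite ?eqxx ?orbT.
- by apply: measurableI => //; exact: mf.
- by apply: measurableI => //; exact: (label_preimage [set i | i \in s] mf).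
- apply/seteqP; split => // x /= [[_ ->] [_]].
  by rewrite (negbTE si).
Qed.

Lemma pr_sum (I : finType) (f : T -> I) A : measurable A -> label f ->
  pr P A = \sum_i pr P (A `&` f @^-1` [set i]).
Proof.
move=> mA mf; rewrite -(pr_law predT)//.
by rewrite (_ : [set x | _] = setT) ?setIT//; apply/seteqP; split.
Qed.

Lemma law_ge0 (I : finType) (f : T -> I) i : 0 <= law P f i.
Proof. exact: pr_ge0. Qed.

Lemma law_sum (I : finType) (f : T -> I) : label f -> \sum_i law P f i = 1.
Proof.
move=> mf; rewrite -prT (pr_sum _ mf)//.
by apply: eq_bigr => i _; rewrite setTI.
Qed.

Lemma pr_label (I : finType) (f : T -> I) (S : pred I) : label f ->
  pr P [set x | S (f x)] = \sum_(i | S i) law P f i.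
Proof.
move=> mf; rewrite -[X in pr P X]setTI pr_law//.
by apply: eq_bigr => i _; rewrite setTI.
Qed.

Lemma law_comp (I J : finType) (phi : I -> J) (f : T -> I) j : label f ->
  law P (phi \o f) j = \sum_(i | phi i == j) law P f i.
Proof.
move=> mf; rewrite -(pr_label (fun i => phi i == j))//; congr (pr P _).
by apply/seteqP; split => x /= /eqP.
Qed.

(** The coupling inequality: in the joint law of [(f, g)] a diagonal pair cancels, and an
    off-diagonal pair [(a, b)] is counted at the two points [a] and [b], whence the factor 2. *)
Lemma ldist_neq (I : finType) (f g : T -> I) : label f -> label g ->
  ldist (law P f) (law P g) <= 2 * pr P [set x | f x != g x].
Proof.
move=> mf mg; pose h x := (f x, g x); have mh := label_pair mf mg.
rewrite (pr_label (fun p => p.1 != p.2) mh).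
have -> : law P f = law P (fst \o h) by [].
have -> : law P g = law P (snd \o h) by [].
apply: (@le_trans _ _ (\sum_i \sum_(p : I * I | p.1 != p.2)
    ((p.1 == i)%:R + (p.2 == i)%:R) * law P h p)).
  apply: ler_sum => i _; rewrite !law_comp//.
  rewrite big_mkcond [X in _ - X]big_mkcond -sumrB [leRHS]big_mkcond /=.
  apply: le_trans (ler_norm_sum _ _ _) _; apply: ler_sum => -[a b] _ /=.
  have := law_ge0 h (a, b); move: (law P h (a, b)) => l l0.
  have [->|ab] /= := eqVneq a b; first by rewrite subrr normr0.
  have [ai|ai] := eqVneq a i; have [bi|bi] := eqVneq b i;
    rewrite ?subrr ?subr0 ?sub0r ?normr0 ?normrN ?(ger0_norm l0) /=; nra.
rewrite exchange_big mulr_sumr /=; apply: ler_sum => -[a b] _ /=.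
rewrite -mulr_suml big_split /= !sum_delta.
by rewrite (_ : 1 + 1 = 2)//.
Qed.

Lemma prU_le A B : measurable A -> measurable B ->
  pr P (A `|` B) <= pr P A + pr P B.
Proof.
move=> mA mB; rewrite -[A `|` B](setDUK (@subsetUl _ A B)).
rewrite prU//; last 2 first.
- by apply: measurableD => //; exact: measurableU.
- by apply/seteqP; split => // x [? []].
rewrite lerD2l; apply: pr_le => //.
  by apply: measurableD => //; exact: measurableU.
by move=> x [[|]].
Qed.

Lemma pr_bigU_le (I : Type) (s : seq I) (F : I -> set T) :
  (forall i, measurable (F i)) ->
  pr P (\big[setU/set0]_(i <- s) F i) <= \sum_(i <- s) pr P (F i).
Proof.
move=> mF; elim: s => [|i s IH]; first by rewrite !big_nil pr0.
rewrite !big_cons; apply: le_trans (prU_le _ _) _ => //.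
  by apply: bigsetU_measurable.
by rewrite lerD2l.
Qed.

Lemma pr_exists_le (I : finType) (F : I -> set T) :
  (forall i, measurable (F i)) ->
  pr P [set x | exists i, F i x] <= \sum_i pr P (F i).
Proof.
move=> mF; apply: le_trans (pr_bigU_le _ mF).
rewrite (_ : [set x | _] = \big[setU/set0]_i F i)//.
apply/seteqP; split => x /=.
  by move=> [i Fi]; rewrite (bigD1 i)//=; left.
by rewrite -bigcup_pred => -[i _ Fi]; exists i.
Qed.

End pr.

Lemma ldist_triangle (I : finType) (q p r : I -> R) :
  ldist p r <= ldist p q + ldist q r.
Proof.
rewrite /ldist -big_split /=; apply: ler_sum => i _.
by rewrite (le_trans _ (ler_normD _ _))// addrA subrK.
Qed.

Lemma ldist_sym (I : finType) (p q : I -> R) : ldist p q = ldist q p.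
Proof. by apply: eq_bigr => i _; rewrite distrC. Qed.

(** Coarsening is a contraction, by the triangle inequality inside each fibre of [phi]. *)
Lemma ldist_comp d d' (T : measurableType d) (T' : measurableType d')
    (P : probability T R) (Q : probability T' R) (I J : finType)
    (phi : I -> J) (f : T -> I) (g : T' -> I) : label f -> label g ->
  ldist (law P (phi \o f)) (law Q (phi \o g)) <= ldist (law P f) (law Q g).
Proof.
move=> mf mg.
apply: (@le_trans _ _
    (\sum_j \sum_(i | phi i == j) `|law P f i - law Q g i|)).
  apply: ler_sum => j _; rewrite !law_comp// -sumrB.
  exact: ler_norm_sum.
by rewrite /ldist [leRHS](partition_big phi predT).
Qed.

Lemma law_pre d d' (T : measurableType d) (T' : measurableType d')
    (P : probability T R) (Q : probability T' R) (h : T -> T') (I : finType)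
    (f : T' -> I) : is_pushforward h P Q -> label f ->
  law P (f \o h) = law Q f.
Proof.
by move=> PQ mf; apply/funext => i; rewrite /law /pr PQ//; exact: mf.
Qed.

End laws.

(** * Approximation in measure by a generating class of sets or labels *)

Section approximation.
Context (R : realType) d (T : measurableType d) (P : probability T R).

Let sd (A B : set T) := (A `\` B) `|` (B `\` A).

Let msd A B : measurable A -> measurable B -> measurable (sd A B).
Proof. by move=> mA mB; apply: measurableU; exact: measurableD. Qed.

(** The sets that [G] approximates form a sigma-algebra: a countable union is cut to a finite one by
    continuity from above, and the finitely many pieces are approximated separately. *)
Lemma approx_algebra (G : set (set T)) : G set0 -> setC_closed G ->
  setU_closed G -> measurable = <<s G >> ->
  forall C eps, measurable C -> 0 < eps ->
  exists2 A, G A & pr P ((C `\` A) `|` (A `\` C)) < eps.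
Proof.
move=> G0 GC GU mG C eps mC; move: eps.
have Gm : G `<=` measurable by rewrite mG; exact: sub_sigma_algebra.
pose H := [set C | measurable C /\
  forall eps, 0 < eps -> exists2 A, G A & pr P (sd C A) < eps].
suff : <<s G >> `<=` H by rewrite -mG => /(_ _ mC)[].
apply: smallest_sub; last first.
  move=> A GA; split; first exact: Gm.
  by move=> e e0; exists A => //; rewrite /sd setDv setU0 pr0.
split => [|A [mA HA]|F HF].
- split=> // e e0; exists set0 => //; by rewrite /sd setDv setU0 pr0.
- rewrite setTD; split; first exact: measurableC.
  move=> e /HA[B GB AB]; exists (~` B); first exact: GC.
  by rewrite /sd !setDE !setCK setUC ![~` _ `&` _]setIC -!setDE.
have mF n : measurable (F n) by case: (HF n).
split; first exact: bigcupT_measurable.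
move=> e e0.
pose U n := \big[setU/set0]_(i < n) F i.
have mU n : measurable (U n) by apply: bigsetU_measurable.
have mFF := bigcupT_measurable _ mF.
have [n Hn] : exists n, pr P (\bigcup_k F k `\` U n) < e / 2.
  have : (P \o (fun n => \bigcup_k F k `\` U n)) x @[x --> \oo]
      --> P (\bigcap_n (\bigcup_k F k `\` U n)).
    apply: nonincreasing_cvg_mu.
    - by rewrite -ge0_fin_numE// fin_num_measure//; exact: measurableD.
    - by move=> n; exact: measurableD.
    - by apply: bigcapT_measurable => n; exact: measurableD.
    - move=> m n mn; apply/subsetPset; apply: setDS.
      exact: subset_bigsetU.
  rewrite (_ : \bigcap_n _ = set0); last first.
    apply/seteqP; split => // x /= H0.
    have [[k _ Fk] _] := H0 0 I; have [_] := H0 k.+1 I; apply.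
    by rewrite /U big_ord_recr /=; right.
  rewrite measure0 => /fine_cvgP[_] /cvgrPdist_lt /(_ (e / 2)).
  rewrite divr_gt0// => /(_ isT)[n _ /(_ n (leqnn n))] /=.
  rewrite sub0r normrN ger0_norm ?fine_ge0// => Hn; by exists n.
(* [n.+1] instead of [n] makes sense for [n = 0], and the [n] errors still add up to at most
   [e / 2]. *)
have /choice[B HB] : forall k, exists B,
    G B /\ pr P (sd (F k) B) < e / 2 / n.+1%:R.
  move=> k; have [_ /(_ (e / 2 / n.+1%:R))[]] := HF k.
    by rewrite !divr_gt0.
  by move=> B GB HB; exists B.
exists (\big[setU/set0]_(i < n) B i).
  by elim/big_ind : _ => // i _; case: (HB i).
have mB k : measurable (B k) by apply: Gm; case: (HB k).
apply: (@le_lt_trans _ _ (pr P (\bigcup_k F k `\` U n) +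
    \sum_(i < n) pr P (sd (F i) (B i)))).
  apply: le_trans (lerD (lexx _) (pr_bigU_le _ _ _)); last by move=> i; exact: msd.
  apply: le_trans (prU_le _ _ _).
  + apply: pr_le.
    * by apply: measurableU; apply: measurableD => //; exact: bigsetU_measurable.
    * by apply: measurableU; [exact: measurableD|apply: bigsetU_measurable => i _; exact: msd].
    * move=> x [[[k _ Fk] nB]|[]].
        have [Ux|nUx] := pselect (U n x); [right|left]; last by split => //; exists k.
        move: Ux nB; rewrite /U -!bigcup_pred => -[i _ Fi] nB.
        by exists i => //; left; split => // Bi; apply: nB; exists i.
      rewrite -!bigcup_pred => -[i _ Bi] nF; right; exists i => //; right.
      by split => // Fi; apply: nF; exists i.
  + exact: measurableD.
  + by apply: bigsetU_measurable => i _; exact: msd.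
rewrite [ltRHS]splitr; apply: ltr_leD => //.
apply: (@le_trans _ _ (\sum_(i < n) (e / 2 / n.+1%:R))).
  by apply: ler_sum => i _; apply/ltW; case: (HB i).
rewrite sumr_const card_ord -[leLHS]mulr_natr mulrAC ler_pdivrMr//.
by rewrite ler_pM2l ?divr_gt0// ler_nat.
Qed.

(** [L] is an abstract class so that the result serves both for functions of finitely many bits and
    for rectangles in a product. Each fibre of [c] is approximated, and the labels used are paired
    into one. *)
Lemma approx_label (L : forall J : finType, (T -> J) -> Prop) :
  (exists J f, L J f) ->
  (forall J f, L J f -> label f) ->
  (forall J K f g, L J f -> L K g -> L (J * K)%type (fun x => (f x, g x))) ->
  measurable = <<s [set A | exists (J : finType) (f : T -> J) (S : pred J), L J f /\ A = f @^-1` S] >> ->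
  forall (I : finType) (c : T -> I) eps, label c -> 0 < eps ->
  exists (J : finType) (f : T -> J) (phi : J -> I),
    L J f /\ pr P [set x | c x != phi (f x)] < eps.
Proof.
move=> [J0 [f0 L0]] Llab Lpair mL I c eps mc e0.
set G := [set A | _] in mL.
have GC : setC_closed G.
  move=> A [J [f [S [Lf ->]]]]; exists J, f, [pred j | ~~ S j]; split => //.
  by apply/seteqP; split => x /= /negP.
have G0 : G set0.
  by exists J0, f0, pred0; split => //; apply/seteqP; split.
have GU : setU_closed G.
  move=> A B [J [f [S [Lf ->]]]] [K [g [S' [Lg ->]]]].
  exists (J * K)%type, (fun x => (f x, g x)), [pred p | S p.1 || S' p.2].
  split; first exact: Lpair.
  by apply/seteqP; split => x /= /orP.
pose e := eps / #|I|.+1%:R.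
have e_gt0 : 0 < e by rewrite divr_gt0.
have /choice[A HA] : forall i : I, exists B,
    G B /\ pr P (sd (c @^-1` [set i]) B) < e.
  by move=> i; have [B GB HB] := approx_algebra G0 GC GU mL (mc i) e_gt0; exists B.
have [J [h [S [Lh AS]]]] : exists (J : finType) (h : T -> J) (S : I -> pred J), L J h /\
    forall i, i \in enum I -> A i = h @^-1` (S i).
  elim: (enum I) => [|i s [J [h [S [Lh AS]]]]].
    by exists J0, f0, (fun=> pred0).
  have [[K [g [S' [Lg Ai]]]] _] := HA i.
  exists (J * K)%type, (fun x => (h x, g x)),
    (fun k => if k == i then [pred p | S' p.2] else [pred p | S k p.1]).
  split; first exact: Lpair.
  move=> k; rewrite in_cons; case: eqVneq => [->//|_ /= ks].
  by rewrite AS.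
(* Where all fibres are approximated correctly, [c x] is the only candidate [i]. The value [c point]
   is a default that keeps the map total elsewhere. *)
exists J, h, (fun j => odflt (c point) [pick i | S i j]); split => //.
have mA i : measurable (A i).
  have [[K [g [S' [Lg ->]]]] _] := HA i.
  exact: label_preimage (Llab _ _ Lg).
apply: (@le_lt_trans _ _ (\sum_i pr P (sd (c @^-1` [set i]) (A i)))).
  apply: le_trans (pr_exists_le _ _); last by move=> i; exact: msd.
  apply: pr_le.
  - apply: label_neq => //.
    exact: (label_comp (fun j => odflt (c point) [pick i | S i j]) (Llab _ _ Lh)).
  - rewrite (_ : [set x | _] = \bigcup_(i in [set: I]) sd (c @^-1` [set i]) (A i)).
      by apply: fin_bigcup_measurable => // i _; exact: msd.
    by apply/seteqP; split => x [i]; [exists i|move=> _; exists i].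
  move=> x /= /negP cx; apply: contrapT => /forallNP nsd; apply/cx/eqP.
  have SE i : S i (h x) = (c x == i).
    have := nsd i; rewrite /sd AS ?mem_enum// /=.
    by case: eqVneq => [cxi|/eqP cxi]; case: (boolP (S i (h x))) => // HS; case; [left|right].
  case: pickP => [i|/(_ (c x))]; rewrite SE ?eqxx//.
  by move=> /eqP ->.
apply: (@le_lt_trans _ _ (\sum_(i : I) e)).
  by apply: ler_sum => i _; apply/ltW; case: (HA i).
rewrite sumr_const -[ltLHS]mulr_natr /e mulrAC ltr_pdivrMr//.
by rewrite ltr_pM2l// ltr_nat.
Qed.

End approximation.

(** * Spaces generated by countably many bits *)

Section countable_index.
Context d (T : measurableType d) (G : Type) (e : G -> nat).
Hypothesis inj_e : injective e.

Lemma measurable_exists (A : G -> set T) : (forall g, measurable (A g)) ->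
  measurable [set x | exists g, A g x].
Proof.
move=> mA; rewrite (_ : [set x | _] =
    \bigcup_n [set x | exists2 g, e g = n & A g x]); last first.
  by apply/seteqP; split => x /= => [[g Ag]|[n _ [g _ Ag]]]; [exists (e g) => //; exists g|exists g].
apply: bigcupT_measurable => n.
have [[g eg]|H] := pselect (exists g, e g = n).
  rewrite (_ : [set x | _] = A g)//; apply/seteqP; split => x /=.
    by move=> [g' eg' Ag']; rewrite (inj_e (etrans eg (esym eg'))).
  by move=> Ag; exists g.
rewrite (_ : [set x | _] = set0)//; apply/seteqP; split => // x /= [g eg _].
by apply: H; exists g.
Qed.

Lemma measurable_forall (A : G -> set T) : (forall g, measurable (A g)) ->
  measurable [set x | forall g, A g x].
Proof.
move=> mA; rewrite (_ : [set x | _] = ~` [set x | exists g, ~ A g x]).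
  by apply: measurableC; apply: measurable_exists => g; exact: measurableC.
apply/seteqP; split => x /=; first by move=> H [g]; apply.
by move=> /forallNP H g; have /contrapT := H g.
Qed.

End countable_index.

Lemma measurable_iff d (T : measurableType d) (A B : set T) :
  measurable A -> measurable B -> measurable [set x | A x <-> B x].
Proof.
move=> mA mB.
rewrite (_ : [set x | _] = (A `&` B) `|` (~` A `&` ~` B)); last first.
  apply/seteqP; split => x /=; have := pselect (A x); tauto.
by apply: measurableU; apply: measurableI => //; exact: measurableC.
Qed.

Lemma measurable_prop d (T : measurableType d) (Q : Prop) :
  measurable [set _ : T | Q].
Proof.
have [HQ|HQ] := pselect Q.
  by rewrite (_ : [set _ | _] = setT)//; apply/seteqP; split.
by rewrite (_ : [set _ | _] = set0)//; apply/seteqP; split.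
Qed.

(* [m x g] says that the [g]-th bit of [x] is set. *)
Section cylinders.
Context (T : pointedType) (G : Type) (e : G -> nat) (m : T -> G -> Prop).
Hypothesis inj_e : injective e.

Let gen : set (set T) := [set A | exists g, A = [set x | m x g]].

(** For each [n] there are finitely many patterns of the bits with code below [n], so such a set is
    a countable union of cylinders. *)
Lemma cylinder_open (O : set T) :
  (forall x, O x -> exists n, forall y,
    (forall g, (e g < n)%N -> (m x g <-> m y g)) -> O y) ->
  <<s gen >> O.
Proof.
pose U : measurableType _ := g_sigma_algebraType gen.
(* Patterns are indexed by codes; a code outside the range of [e] imposes no condition. *)
pose C n (s : {ffun 'I_n -> bool}) : set U :=
  [set x | forall k : 'I_n, forall g, e g = k -> (m x g <-> s k)].
have mC n s : measurable (C n s).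
  pose D (k : 'I_n) : set U := [set x | forall g, e g = k -> (m x g <-> s k)].
  rewrite (_ : C n s = \bigcap_(k in [set: 'I_n]) D k); last first.
    by apply/seteqP; split => x /= H; [move=> k _; exact: H|move=> k; exact: (H k)].
  apply: fin_bigcap_measurable => // k _.
  apply: (@measurable_forall _ U _ e inj_e
    (fun g => [set x | e g = k -> (m x g <-> s k)])) => g.
  have [eg|neg] := pselect (e g = k); last first.
    by rewrite (_ : [set x | _] = setT)//; apply/seteqP; split => // x _ /=.
  rewrite (_ : [set x | _] = [set x | m x g <-> s k]); last first.
    by apply/seteqP; split => x /=; tauto.
  apply: (@measurable_iff _ U [set x | m x g] [set _ | s k]).
    by apply: sub_sigma_algebra; exists g.
  exact: measurable_prop.
move=> HO; rewrite (_ : O = \bigcup_n \bigcup_(s in [set s | C n s `<=` O]) C n s).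
  apply: (@bigcupT_measurable _ U) => n.
  by apply: (@fin_bigcup_measurable _ U) => // s _; exact: mC.
apply/seteqP; split => x; last by move=> [n _ [s sO]]; exact: sO.
move=> /HO[n Hn]; exists n => //.
pose s := [ffun k : 'I_n => `[< exists2 g, e g = k & m x g >]].
have Cx : C n s x.
  move=> k g eg; rewrite ffunE; split.
    by move=> mx; apply/asboolP; exists g.
  by move=> /asboolP[g' eg' mg]; rewrite (inj_e (etrans eg (esym eg'))).
exists s => // y Cy; apply: Hn => g eg.
have := Cx (Ordinal eg) g erefl; have := Cy (Ordinal eg) g erefl; tauto.
Qed.

End cylinders.

(** The common form of Sub(G) and {0,1}^G as measurable spaces; approximation by windows and
    uniqueness of measures are proved once for both. *)
Definition cylinder_generated d (T : measurableType d) (G : Type)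
    (m : T -> G -> Prop) : Prop :=
  measurable = <<s [set A | exists g, A = [set x | m x g]] >>.

Section cylinder_generated.
Context d (T : measurableType d) (G : choiceType) (m : T -> G -> Prop).
Hypothesis gen_m : cylinder_generated m.

Definition window (F : {fset G}) (x : T) : {ffun F -> bool} :=
  [ffun g => `[< m x (val g) >]].

Lemma measurable_bit g : measurable [set x | m x g].
Proof. by rewrite gen_m; apply: sub_sigma_algebra; exists g. Qed.

Lemma label_window F : label (window F).
Proof. by apply: label_ffun => g; apply: label_bool; exact: measurable_bit. Qed.

Lemma measurable_fun_cylinder d' (S : measurableType d') (h : S -> T) :
  (forall g, measurable [set x | m (h x) g]) -> measurable_fun setT h.
Proof.
move=> mh; apply: (measurability _ gen_m) => _ [_ [g ->] <-].
by rewrite setTI; exact: mh.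
Qed.

Lemma window_approx (R : realType) (P : probability T R) (I : finType)
    (c : T -> I) (eps : R) : label c -> 0 < eps ->
  exists (F : {fset G}) (phi : {ffun F -> bool} -> I),
    pr P [set x | c x != phi (window F x)] < eps.
Proof.
move=> mc e0.
pose L (J : finType) (f : T -> J) := exists (F : {fset G}) phi,
  f = phi \o window F.
have [||||J [f [phi [[F [psi ->]] H]]]] := @approx_label _ _ _ P L _ _ _ _ I c eps mc e0.
- by exists unit, (fun=> tt), fset0, (fun=> tt).
- by move=> J f [F [phi ->]]; apply: label_comp; exact: label_window.
- move=> J K f g [F [phi ->]] [F' [psi ->]].
  exists (F `|` F')%fset.
  exists (fun s => (phi [ffun k => s (fincl (fsubsetUl F F') k)],
                    psi [ffun k => s (fincl (fsubsetUr F F') k)])).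
  apply/funext => x /=; congr (phi _, psi _); apply/ffunP => k; by rewrite !ffunE.
- apply/seteqP; split.
    rewrite gen_m; apply: smallest_sub; first exact: smallest_sigma_algebra.
    move=> _ [g ->]; apply: sub_sigma_algebra.
    exists _, (window [fset g]%fset), (fun s : {ffun [fset g]%fset -> bool} => s [` fset11 g]%fset).
    split; first by exists [fset g]%fset, id.
    by apply/seteqP; split => x; rewrite /window /= ffunE => /asboolP.
  apply: smallest_sub; first exact: sigma_algebra_measurable.
  move=> _ [J [f [S [[F [phi ->]] ->]]]].
  by apply: label_preimage; apply: label_comp; exact: label_window.
by exists F, (phi \o psi).
Qed.

(** Preimages under windows form a generating pi-system, two windows being restrictions of the
    window over the union of their index sets. *)
Lemma cylinder_unique (R : realType) (P Q : probability T R) :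
  (forall F, law P (window F) =1 law Q (window F)) ->
  forall E, measurable E -> P E = Q E.
Proof.
move=> PQ; pose C := [set A | exists (F : {fset G}) (S : pred {ffun F -> bool}),
  A = window F @^-1` S].
have mC A : C A -> measurable A.
  by move=> [F [S ->]]; apply: label_preimage; exact: label_window.
apply: (measure_unique C (fun=> setT)).
- apply/seteqP; split; last first.
    by apply: smallest_sub; [exact: sigma_algebra_measurable|exact: mC].
  rewrite gen_m; apply: smallest_sub; first exact: smallest_sigma_algebra.
  move=> _ [g ->]; apply: sub_sigma_algebra.
  exists [fset g]%fset, (fun s : {ffun [fset g]%fset -> bool} => s [` fset11 g]%fset).
  by apply/seteqP; split => x; rewrite /window /= ffunE => /asboolP.
- move=> _ _ [F [S ->]] [F' [S' ->]]; exists (F `|` F')%fset.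
  exists (fun s => S [ffun k => s (fincl (fsubsetUl F F') k)] &&
                   S' [ffun k => s (fincl (fsubsetUr F F') k)]).
  have E (F0 : {fset G}) (sub : (F0 `<=` F `|` F')%fset) x :
      [ffun k => window (F `|` F')%fset x (fincl sub k)] = window F0 x.
    by apply/ffunP => k; rewrite !ffunE.
  by apply/seteqP; split => x /=; rewrite !E => /andP.
- by move=> n; exists fset0, predT; apply/seteqP; split.
- by rewrite bigcup_const//; exists 0%N.
- move=> _ [F [S ->]]; have mS : measurable (window F @^-1` S).
    by apply: mC; exists F, S.
  rewrite -[LHS](prE P mS) -[RHS](prE Q mS).
  rewrite !(pr_label _ S (@label_window F)).
  by congr EFin; apply: eq_bigr => s _; exact: PQ.
- by move=> n; rewrite -ge0_fin_numE// fin_num_measure.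
Qed.

End cylinder_generated.

(** * Stabilizers *)

Definition separating (T : Type) (U : nat -> set T) : Prop :=
  forall x y, (forall n, U n x <-> U n y) -> x = y.

(** Balls around a dense sequence separate points. A separating sequence makes coincidence sets such
    as [g x = x] measurable, and its finite stages give ever finer partitions. *)
Lemma standard_borel_separating (R : realType) d (T : measurableType d) :
  standard_borel R T ->
  exists U : nat -> set T, (forall n, measurable (U n)) /\ separating U.
Proof.
move=> [P [f [[D cD dD] /bij_inj inj_f fB]]].
have [g gD] : exists g : nat -> P, D `<=` range g.
  have [x0 Dx0] : D !=set0.
    have fT : [set: P] !=set0 by exists (f point).
    by have [x [_ Dx]] := dD _ fT openT; exists x.
  have /countable_injP[h inj_h] := cD.
  exists (fun n => if pselect (exists2 x, D x & h x = n) is left E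
    then projT1 (cid2 E) else x0).
  move=> x Dx; exists (h x) => //; case: pselect; last by case; exists x.
  by move=> E; case: cid2 => y Dy /= /inj_h; apply; rewrite inE.
pose V (nk : nat * nat) : set P := interior (ball (g nk.1) nk.2.+1%:R^-1).
pose U (n : nat) : set T :=
  if @choice.unpickle (nat * nat)%type n is Some nk then f @^-1` V nk else set0.
exists U; split.
  move=> n; rewrite /U; case: choice.unpickle => // nk; apply/fB.
  by apply: sub_sigma_algebra; exact: open_interior.
move=> x y xy; apply: inj_f; apply: contrapT => /eqP fxy.
pose r := mdist (f x) (f y).
have r0 : 0 < r by rewrite /r mdist_gt0.
have [k kr] : exists k : nat, k.+1%:R^-1 < r / 2.
  have [k] := ltr_add_invr (divr_gt0 r0 (ltr0n R 2)).
  by rewrite add0r => H; exists k.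
(* Half the radius: [f x] then lies in the interior of the ball around [z], and a point [f y] of
   that ball is within 3/2 of the radius of [f x], less than [r] by the choice of [k]. *)
pose eps := (k.+1%:R^-1 : R) / 2.
have eps0 : 0 < eps by rewrite divr_gt0.
have [z [Bz Dz]] : (interior (ball (f x) eps) `&` D) !=set0.
  apply: dD; last exact: open_interior.
  by exists (f x); apply: nbhsx_ballx.
have [i _ gi] := gD _ Dz.
have Uxy := xy (choice.pickle (i, k)); rewrite /U choice.pickleK /V /= gi in Uxy.
have /Uxy /interior_subset yz : interior (ball z k.+1%:R^-1) (f x).
  apply: filterS (nbhsx_ballx (f x) _ eps0) => w xw.
  rewrite (splitr k.+1%:R^-1); apply: ball_triangle xw.
  by apply: ball_sym; exact: interior_subset.
have xz := interior_subset Bz.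
have : ball (f x) (eps + k.+1%:R^-1) (f y) by apply: ball_triangle xz yz.
rewrite ballEmdist /= -/r /eps => rk.
have : k.+1%:R^-1 / 2 + k.+1%:R^-1 < r.
  have : 0 < k.+1%:R^-1 :> R by [].
  move: kr; set a := k.+1%:R^-1; lra.
by move=> /(lt_trans rk); rewrite ltxx.
Qed.

Section equalizer.
Context d (T : measurableType d) (U : nat -> set T).
Hypotheses (mU : forall n, measurable (U n)) (sepU : separating U).

Lemma measurable_equalizer d' (S : measurableType d') (f g : S -> T) :
  measurable_fun setT f -> measurable_fun setT g ->
  measurable [set x | f x = g x].
Proof.
move=> mf mg.
rewrite (_ : [set x | _] = [set x | forall n, U n (f x) <-> U n (g x)]).
  apply: (@measurable_forall _ _ _ id) => // n; apply: measurable_iff.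
    by rewrite -[X in measurable X]setTI; exact: mf.
  by rewrite -[X in measurable X]setTI; exact: mg.
by apply/seteqP; split => x /=; [move=> ->|exact: sepU].
Qed.

End equalizer.

Section subgroups.
Context (G : groupType) (e : G -> nat).
Hypothesis inj_e : injective e.

Lemma subgroup_cylinder :
  cylinder_generated (fun (H : SubGrp G) g => subgroup_set H g).
Proof.
apply/seteqP; split.
  apply: smallest_sub; first exact: smallest_sigma_algebra.
  move=> O oO; apply: (cylinder_open inj_e) => H.
  move: oO => [D' sD' <-] [[T F] D'TF HTF].
  have [/= fT FT] := sD' _ D'TF.
  have [n Hn] : exists n, forall g, T g -> (e g < n)%N.
    have /finite_fsetP[s ->] := fT.
    exists (\max_(g <- s) e g).+1%N => g /= gs.
    by rewrite ltnS; apply: leq_bigmax_seq.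
  exists n => K HK; exists (T, F) => //=; rewrite /mkset /= -[RHS]HTF /=.
  apply/seteqP; split => g /= [Kg Tg]; split => //; exact/(HK g (Hn _ Tg)).
apply: smallest_sub; first exact: smallest_sigma_algebra.
move=> _ [g ->]; apply: sub_sigma_algebra.
exists [set ([set g], [set g])] => [_ ->|] /=; first by split.
rewrite bigcup_set1; apply/seteqP; split => H /=.
  by move=> H1; have : [set g] g by []; rewrite -{1}H1 => -[].
by move=> Hg; apply/seteqP; split => h /= => [[]//|->].
Qed.

Lemma subgroup_ext (H K : subgroup G) : (forall g, subgroup_set H g <-> subgroup_set K g) -> H = K.
Proof.
case: H K => [H H1 HM HV] [K K1 KM KV] /= HK.
have E : H = K by apply/seteqP; split => g /HK.
by move: H1 HM HV; rewrite E => *; congr Subgroup; exact: Prop_irrelevance.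
Qed.

Lemma measurable_subgroup1 (H : SubGrp G) : measurable [set H].
Proof.
rewrite (_ : [set H] =
    [set K : SubGrp G | forall g, subgroup_set K g <-> subgroup_set H g]).
  apply: (measurable_forall inj_e) => g.
  apply: measurable_iff; first exact: (measurable_bit subgroup_cylinder).
  exact: measurable_prop.
apply/seteqP; split => K /=; first by move=> ->.
exact: subgroup_ext.
Qed.

Section conj.
Variables (g : G) (H : subgroup G).
Let s : set G := [set x | subgroup_set H (g^-1 * x * g)%g].
Let s1 : s 1%g. Proof. by rewrite /s /= mulg1 mulVg; exact: subgroup1. Qed.
Let sM x y : s x -> s y -> s (x * y)%g.
Proof.
rewrite /s /= => xs ys; have := subgroupM xs ys.
by rewrite !mulgA mulgK.
Qed.
Let sV x : s x -> s x^-1%g.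
Proof. by rewrite /s /= => /subgroupV; rewrite !invgM invgK mulgA. Qed.
Definition conj_subgroup : subgroup G := Subgroup s1 sM sV.
End conj.

Lemma measurable_conj g :
  measurable_fun setT (conj_subgroup g : SubGrp G -> SubGrp G).
Proof.
apply: (measurable_fun_cylinder subgroup_cylinder) => x.
exact: (measurable_bit subgroup_cylinder).
Qed.

Context d (T : measurableType d) (a : borel_action G T).

Lemma actK g : cancel (a g) (a g^-1%g).
Proof. by move=> x; rewrite -actM mulVg act1. Qed.

Lemma actVK g : cancel (a g^-1%g) (a g).
Proof. by move=> x; rewrite -actM mulgV act1. Qed.

Lemma stab_act g x : stab a (a g x) = conj_subgroup g (stab a x).
Proof.
apply: subgroup_ext => h; rewrite /stab /conj_subgroup /= -!actM; split => H.
  by rewrite -mulgA actM H actK.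
by rewrite -[in RHS]H -actM !mulgA mulgV mul1g.
Qed.

Lemma measurable_act_preimage g A : measurable A -> measurable (a g @^-1` A).
Proof.
by move=> mA; rewrite -[X in measurable X]setTI; exact: measurable_act.
Qed.

Lemma measurable_stab (U : nat -> set T) : (forall n, measurable (U n)) ->
  separating U -> measurable_fun setT (stab a).
Proof.
move=> mU sepU; apply: (measurable_fun_cylinder subgroup_cylinder) => g.
apply: (measurable_equalizer mU sepU) => //; exact: measurable_act.
Qed.

End subgroups.

(** * Disintegrations and relatively independent joinings *)

Lemma pker_le1 (R : realType) d d' (S : measurableType d)
    (W : measurableType d') (k : R.-pker S ~> W) s A :
  measurable A -> (k s A <= 1)%E.
Proof.
move=> mA; rewrite -(@prob_kernel _ _ _ _ _ k s).
by apply: (@le_measure _ _ _ (k s)); rewrite ?inE.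
Qed.

Lemma pker_fin_num (R : realType) d d' (S : measurableType d)
    (W : measurableType d') (k : R.-pker S ~> W) s A :
  measurable A -> (k s A \is a fin_num)%E.
Proof.
by move=> mA; rewrite ge0_fin_numE// (le_lt_trans (pker_le1 k s mA))// ltry.
Qed.

Section disintegration.
Local Open Scope ereal_scope.
Context (R : realType) d d' (W : measurableType d) (S : measurableType d').
Variables (f : W -> S) (P : probability W R) (theta : probability S R)
  (k : R.-pker S ~> W).
Hypotheses (mf : measurable_fun setT f) (m1 : forall s : S, measurable [set s]).
Hypothesis dis : disintegration f P theta k.

Let mpre (B : set S) : measurable B -> measurable (f @^-1` B).
Proof. by move=> mB; rewrite -[X in measurable X]setTI; exact: mf. Qed.

Lemma disintegration_indic A B : measurable A -> measurable B ->
  \int[theta]_s ((\1_B s)%:E * k s A) = P (A `&` f @^-1` B).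
Proof.
move=> mA mB; have [PE kf1] := dis.
have mAB : measurable (A `&` f @^-1` B) by apply: measurableI => //; exact: mpre.
rewrite PE//; apply: ae_eq_integral => //.
- apply: emeasurable_funM; last exact: (measurable_kernel k A mA).
  by apply/measurable_EFinP; exact: measurable_indic.
- exact: (measurable_kernel k _ mAB).
apply: filterS kf1 => s ks _.
have k0 : k s (~` (f @^-1` [set s])) = 0.
  have mF := mpre (m1 s).
  have key (x : \bar R) : 1 = 1 + x -> x = 0.
    case: x => [r| |] // [] /eqP.
    by rewrite -[eqbLHS]addr0 (inj_eq (addrI _)) => /eqP <-.
  apply: key; rewrite -[X in _ = X + _]ks -[LHS](@prob_kernel _ _ _ _ _ k s).
  rewrite -(setUv (f @^-1` [set s])).
  exact: (measureU (k s) mF (measurableC mF) (setICr _)).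
rewrite indicE; case: (boolP (s \in B)); rewrite ?inE ?notin_setE /= => Bs.
  have kA : k s A = k s (A `\` f @^-1` B) + k s (A `&` f @^-1` B) :=
    measureDI (k s) mA (mpre mB).
  rewrite mul1e kA (_ : k s (A `\` _) = 0) ?add0e//.
  apply: (@subset_measure0 _ _ _ (k s) _ _ _ _ _ k0).
  + by apply: measurableD => //; exact: mpre.
  + by apply: measurableC; exact: mpre.
  + by move=> w [_ /= nB] fw; apply: nB; rewrite fw.
rewrite mul0e; apply/esym/(@subset_measure0 _ _ _ (k s) _ _ _ _ _ k0) => //.
  by apply: measurableC; exact: mpre.
by move=> w [_ /= Bw] fw; apply: Bs; rewrite -fw.
Qed.

Import HBNNSimple.

Let nnsfunE d0 (T : measurableType d0) (g : {nnsfun T >-> R}) x : (g x)%:E =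
  \sum_(y \in range g) y%:E * (\1_(g @^-1` [set y]) x)%:E.
Proof. by rewrite fsumEFin //= fimfunE. Qed.

Let disintegration_nnsfun A (g : {nnsfun S >-> R}) : measurable A ->
  \int[theta]_s ((g s)%:E * k s A) = \int[P]_(w in A) (g (f w))%:E.
Proof.
move=> mA; have mk := measurable_kernel k A mA.
have mI y : measurable_fun setT (fun s => (\1_(g @^-1` [set y]) s : R)%:E).
  by apply/measurable_EFinP; exact: measurable_indic.
transitivity (\int[theta]_s \sum_(y \in range g)
    (y%:E * (\1_(g @^-1` [set y]) s)%:E * k s A)).
  apply: eq_integral => s _; rewrite nnsfunE ge0_mule_fsuml// => y.
  exact: nnfun_muleindic_ge0.
rewrite ge0_integral_fsum//; last 2 first.
- by move=> y; apply: emeasurable_funM => //; exact: measurable_funeM.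
- by move=> y s _; apply: mule_ge0 => //; exact: nnfun_muleindic_ge0.
transitivity (\int[P]_(w in A) \sum_(y \in range g)
    (y%:E * (\1_(g @^-1` [set y]) (f w))%:E)); last first.
  by apply: eq_integral => w _; rewrite nnsfunE.
have mIf y : measurable_fun A (fun w => (\1_(g @^-1` [set y]) (f w) : R)%:E).
  exact: (measurable_funTS (measurableT_comp (mI y) mf)).
rewrite [RHS]ge0_integral_fsum//; last 2 first.
- by move=> y; apply: measurable_funeM.
- by move=> y s _; exact: nnfun_muleindic_ge0.
apply: eq_fsbigr => y; rewrite inE => -[z _ <-].
under eq_integral do rewrite -muleA.
rewrite [RHS]ge0_integralZl ?lee_fin// [LHS]ge0_integralZl ?lee_fin//; last exact: emeasurable_funM.
rewrite disintegration_indic//; congr (_ * _).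
rewrite (_ : (fun w => _) = (fun w => (\1_(f @^-1` (g @^-1` [set g z])) w)%:E))//.
by rewrite integral_indic// 1?setIC//; exact: mpre.
Qed.

(** A weight that depends on the base point only can be moved inside the disintegrated measure;
    indicators extend through simple functions and monotone convergence. Every passage between
    Sub(G) and the spaces above it uses this. *)
Lemma disintegration_integral A (h : S -> \bar R) : measurable A ->
  measurable_fun setT h -> (forall s, 0 <= h s) ->
  \int[theta]_s (h s * k s A) = \int[P]_(w in A) h (f w).
Proof.
move=> mA mh h0; have mk := measurable_kernel k A mA.
pose g := nnsfun_approx measurableT mh.
have gh s : lim ((g n s)%:E @[n --> \oo]) = h s.
  by apply/cvg_lim => //; exact: cvg_nnsfun_approx.
have mg n : measurable_fun setT (fun s => (g n s)%:E) by exact/measurable_EFinP.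
have nd s : {homo (fun n => (g n s)%:E) : n m / (n <= m)%N >-> n <= m}.
  by move=> n m nm; rewrite lee_fin; exact/lefP/nd_nnsfun_approx.
transitivity (limn (fun n => \int[theta]_s ((g n s)%:E * k s A))).
  rewrite -monotone_convergence//; last 3 first.
  - by move=> n; exact: emeasurable_funM.
  - by move=> n s _; rewrite mule_ge0// lee_fin.
  - by move=> s _ n m nm; rewrite lee_wpmul2r//; exact: nd.
  apply: eq_integral => s _; rewrite -gh; apply/esym/cvg_lim => //.
  apply: cvgeZr; first exact: pker_fin_num.
  by apply: ereal_nondecreasing_is_cvgn; exact: nd.
transitivity (limn (fun n => \int[P]_(w in A) (g n (f w))%:E)).
  by apply: congr_lim; apply/funext => n; exact: disintegration_nnsfun.
rewrite -monotone_convergence//.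
- by apply: eq_integral => w _; rewrite gh.
- by move=> n; exact: (measurable_funTS (measurableT_comp (mg n) mf)).
- by move=> n w _; rewrite lee_fin.
Qed.

End disintegration.

Lemma exists_pushforward (R : realType) d d' (T : measurableType d)
    (T' : measurableType d') (f : T -> T') (P : probability T R) :
  measurable_fun setT f -> exists Q : probability T' R, is_pushforward f P Q.
Proof.
move=> mf; pose F : {mfun T >-> T'} := mfun_Sub (mem_set mf).
exists (distribution P F) => A mA.
by rewrite /distribution /pushforward.
Qed.

Lemma measure_prod_unique (R : realType) d1 d2 (X : measurableType d1)
    (Y : measurableType d2) (P Q : probability (X * Y)%type R) :
  (forall A B, measurable A -> measurable B -> P (A `*` B) = Q (A `*` B)) ->
  forall E, measurable E -> P E = Q E.
Proof.
move=> PQ E mE.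
pose C : set (set (X * Y)) :=
  [set A `*` B | A in measurable & B in measurable].
apply: (measure_unique C (fun=> setT)) => //.
- exact: measurable_prod_measurableType.
- move=> _ _ [A mA [B mB <-]] [A' mA' [B' mB' <-]].
  rewrite -setXI; exists (A `&` A'); first exact: measurableI.
  by exists (B `&` B') => //; exact: measurableI.
- by move=> n; exists setT => //; exists setT => //; rewrite setXTT.
- by rewrite bigcup_const//; exists 0%N.
- by move=> _ [A mA [B mB <-]]; exact: PQ.
- by move=> n; rewrite -ge0_fin_numE// fin_num_measure.
Qed.

Section relatively_independent_joining.
Context (R : realType) d0 d1 d2 d3 (S : measurableType d0)
  (X : measurableType d1) (Z : measurableType d2) (Y : measurableType d3).
Variables (theta : probability S R) (k : R.-pker S ~> (X * Z)%type)
  (l : R.-pker S ~> Y).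
Let l' s : set Y -> \bar R := l s.
HB.instance Definition _ s := Measure.on (l' s).
Let l'_prob s : l' s setT = 1%E. Proof. exact: prob_kernel. Qed.
HB.instance Definition _ s :=
  Measure_isProbability.Build _ _ R (l' s) (l'_prob s).

Lemma rel_indep_joining_rect A C : measurable A -> measurable C ->
  (rel_indep_joining theta k l [set p | A (p.1, p.2.1) /\ C p.2.2] =
   \int[theta]_s (k s A * l s C))%E.
Proof.
move=> mA mC; apply: eq_integral => s _.
rewrite (_ : _ @^-1` _ = A `*` C).
  exact: (product_measure1E (k s) (l' s)).
by apply/seteqP; split => -[[x z] y].
Qed.

End relatively_independent_joining.

Lemma integral_is_pushforward (R : realType) d d' (T : measurableType d)
    (T' : measurableType d') (f : T -> T') (P : probability T R)
    (Q : probability T' R) (D : set T') (h : T' -> \bar R) :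
  is_pushforward f P Q -> measurable_fun setT f -> measurable D ->
  measurable_fun D h -> (forall y, (0 <= h y)%E) ->
  (\int[Q]_(y in D) h y = \int[P]_(x in f @^-1` D) h (f x))%E.
Proof.
move=> PQ mf mD mh h0.
rewrite -[RHS](ge0_integral_pushforward mf P mD mh)//.
by apply: eq_measure_integral => A mA _; exact: PQ.
Qed.

Lemma conj_subgroupK (G : groupType) g (H : subgroup G) :
  conj_subgroup g^-1 (conj_subgroup g H) = H.
Proof.
by apply: subgroup_ext => x; rewrite /= invgK !mulgA mulVg mul1g mulgVK.
Qed.

Section rij.
Context (R : realType) (G : groupType) (e : G -> nat) (inj_e : injective e).
Context d1 d2 d3 (X : measurableType d1) (Z : measurableType d2)
  (Y : measurableType d3).
Variables (aX : borel_action G X) (aZ : borel_action G Z)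
  (aY : borel_action G Y).
Variables (lambda : probability (X * Z)%type R) (nu : probability Y R)
  (theta : probability (SubGrp G) R).
Variables (k : R.-pker (SubGrp G) ~> (X * Z)%type)
  (l : R.-pker (SubGrp G) ~> Y).
Hypotheses (mstabZ : measurable_fun setT (stab aZ))
  (mstabY : measurable_fun setT (stab aY)).
Hypotheses (inv_lambda : Defs.invariant (diag_action aX aZ) lambda)
  (inv_nu : Defs.invariant aY nu).
Hypotheses (typeY : stabilizer_type aY nu theta)
  (dis_k : disintegration (stab aZ \o snd) lambda theta k)
  (dis_l : disintegration (stab aY) nu theta l).
Local Open Scope ereal_scope.
Local Notation xi := (rel_indep_joining theta k l).
Local Notation rect A C := [set p : X * (Z * Y) | A (p.1, p.2.1) /\ C p.2.2].

Let m1 := measurable_subgroup1 inj_e.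
Let mstab2 : measurable_fun setT (stab aZ \o snd : X * Z -> SubGrp G) :=
  measurableT_comp mstabZ measurable_snd.

(** Read over [lambda], the joining leaves [l] at Stab(z) as integrand; read over [nu], it leaves
    [k] at Stab(y). Invariance plays the two readings against each other. *)
Lemma rel_indep_joining_integral_left A C : measurable A -> measurable C ->
  xi (rect A C) = \int[lambda]_(p in A) l (stab aZ p.2) C.
Proof.
move=> mA mC; rewrite rel_indep_joining_rect//.
rewrite -(disintegration_integral mstab2 m1 dis_k mA (measurable_kernel l C mC))//.
by apply: eq_integral => s _; rewrite muleC.
Qed.

Lemma rel_indep_joining_integral_right A C : measurable A -> measurable C ->
  xi (rect A C) = \int[nu]_(y in C) k (stab aY y) A.
Proof.
move=> mA mC; rewrite rel_indep_joining_rect//.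
exact: (disintegration_integral mstabY m1 dis_l mC (measurable_kernel k A mA)).
Qed.

Let conj_theta g : is_pushforward (conj_subgroup g : SubGrp G -> SubGrp G)
  theta theta.
Proof.
move=> A mA; rewrite /pushforward !typeY//; last first.
  by rewrite -[X in measurable X]setTI; exact: (measurable_conj inj_e g).
rewrite /pushforward -(inv_nu g); last first.
  by rewrite -[X in measurable X]setTI; exact: mstabY.
by congr (nu _); apply/seteqP; split => y /=; rewrite stab_act.
Qed.

(** Equivariance of the kernels under conjugation is not among the hypotheses. It is circumvented by
    translating one factor at a time: the Y factor by invariance of [nu], then the stabilizer by
    conjugation invariance of [theta], then the X, Z factor by invariance of [lambda]. *)
Lemma rel_indep_joining_rect_invariant g A C : measurable A -> measurable C ->
  xi (rect (diag_action aX aZ g @^-1` A) (aY g @^-1` C)) = xi (rect A C).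
Proof.
move=> mA mC; set A' := _ @^-1` A; set C' := _ @^-1` C.
have mA' : measurable A' by exact: measurable_act_preimage.
have mC' : measurable C' by exact: measurable_act_preimage.
have mkA : measurable_fun setT (fun s : SubGrp G => k (conj_subgroup g^-1 s) A').
  exact: (measurableT_comp (measurable_kernel k A' mA') (measurable_conj inj_e _)).
have mlC : measurable_fun setT (fun s : SubGrp G => l (conj_subgroup g s) C).
  exact: (measurableT_comp (measurable_kernel l C mC) (measurable_conj inj_e _)).
rewrite rel_indep_joining_integral_right//.
(* Undoing the conjugation turns the integrand into a function of [aY g y], ready for a change of
   variables. *)
transitivity (\int[nu]_(y in C') k (conj_subgroup g^-1 (stab aY (aY g y))) A').
  by apply: eq_integral => y _; rewrite stab_act conj_subgroupK.
rewrite -(integral_is_pushforward (f := aY g) (Q := nu)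
  (h := fun y => k (conj_subgroup g^-1 (stab aY y)) A'))//; last 3 first.
- by move=> B mB; rewrite /pushforward inv_nu.
- exact: (measurable_act _ g).
- exact: (measurable_funTS (measurableT_comp mkA mstabY)).
rewrite -(disintegration_integral mstabY m1 dis_l mC mkA)//.
(* The substitution [s] to its conjugate by [g] takes the conjugation off [k] and puts it on [l]. *)
rewrite (integral_is_pushforward (conj_theta g)
  (h := fun s : SubGrp G => k (conj_subgroup g^-1 s) A' * l s C))//; last 2 first.
- exact: (measurable_conj inj_e g).
- by apply: emeasurable_funM => //; exact: (measurable_kernel l C mC).
rewrite preimage_setT.
transitivity (\int[theta]_s (l (conj_subgroup g s) C * k s A')).
  by apply: eq_integral => s _; rewrite conj_subgroupK muleC.
rewrite (disintegration_integral mstab2 m1 dis_k mA' mlC)//.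
transitivity (\int[lambda]_(p in A') l (stab aZ (diag_action aX aZ g p).2) C).
  by apply: eq_integral => p _ /=; rewrite stab_act.
rewrite rel_indep_joining_integral_left// [RHS](integral_is_pushforward
  (f := diag_action aX aZ g) (P := lambda))//.
- by move=> B mB; rewrite /pushforward inv_lambda.
- exact: (measurable_act _ g).
- apply: measurable_funTS.
  exact: (measurableT_comp (measurable_kernel l C mC) mstab2).
Qed.

Let assoc (p : X * (Z * Y)) : (X * Z) * Y := ((p.1, p.2.1), p.2.2).

Let massoc : measurable_fun setT assoc.
Proof.
apply/measurable_fun_pairP; split; first apply/measurable_fun_pairP; first split.
- exact: measurable_fst.
- exact: (measurableT_comp measurable_fst measurable_snd).
- exact: (measurableT_comp measurable_snd measurable_snd).
Qed.

Lemma rel_indep_joining_unique (P Q : probability (X * (Z * Y))%type R) :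
  (forall A C, measurable A -> measurable C -> P (rect A C) = Q (rect A C)) ->
  forall E, measurable E -> P E = Q E.
Proof.
move=> PQ E mE.
have [P' P'E] := exists_pushforward P massoc.
have [Q' Q'E] := exists_pushforward Q massoc.
pose unassoc (q : (X * Z) * Y) : X * (Z * Y) := (q.1.1, (q.1.2, q.2)).
have mun : measurable_fun setT unassoc.
  apply/measurable_fun_pairP; split; last apply/measurable_fun_pairP; last split.
  - exact: (measurableT_comp measurable_fst measurable_fst).
  - exact: (measurableT_comp measurable_snd measurable_fst).
  - exact: measurable_snd.
have mE' : measurable (unassoc @^-1` E).
  by rewrite -[X in measurable X]setTI; exact: mun.
have EE : E = assoc @^-1` (unassoc @^-1` E).
  by apply/seteqP; split => -[x [z y]].
rewrite {1}EE [in RHS]EE; transitivity (P' (unassoc @^-1` E)).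
  by rewrite P'E.
rewrite (@measure_prod_unique _ _ _ _ _ P' Q')//; first by rewrite Q'E.
move=> A C mA mC.
have mAC : measurable (A `*` C) by exact: measurableX.
by rewrite P'E// Q'E//; exact: PQ.
Qed.

Lemma rel_indep_joining_invariant :
  Defs.invariant (diag_action aX (diag_action aZ aY)) xi.
Proof.
move=> g E mE.
have [P PE] := exists_pushforward xi
  (measurable_act (diag_action aX (diag_action aZ aY)) g).
rewrite -[LHS]PE//; apply: rel_indep_joining_unique => // A C mA mC.
have mr : measurable (rect A C).
  have mAC : measurable (A `*` C) by exact: measurableX.
  by have := massoc measurableT mAC; rewrite setTI.
rewrite (PE _ mr) /pushforward [RHS]/=.
by rewrite -(rel_indep_joining_rect_invariant g mA mC).
Qed.

Lemma rel_indep_joining_fst (A : set (X * Z)) : measurable A ->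
  xi [set p | A (p.1, p.2.1)] = lambda A.
Proof.
move=> mA; rewrite (_ : [set p | _] = rect A setT); last first.
  by apply/seteqP; split => p //= -[].
rewrite rel_indep_joining_rect// (dis_k.1 A mA).
by apply: eq_integral => s _; rewrite prob_kernel mule1.
Qed.

End rij.

(** * Weak containment in terms of labels *)

Section translates.
Context (G : groupType) d (Z : measurableType d) (a : borel_action G Z).

Definition translates (T : {fset G}) (I : finType) (c : Z -> I) (z : Z) :
  {ffun T -> I} := [ffun t => c (a (fsval t) z)].

Lemma label_translates (T : {fset G}) (I : finType) (c : Z -> I) :
  label c -> label (translates T c).
Proof.
move=> mc; apply: label_ffun => t.
exact: (label_measurable (measurable_act a _) mc).
Qed.

Lemma translates_comp (T : {fset G}) (I J : finType) (phi : I -> J)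
    (c : Z -> I) :
  translates T (phi \o c) =
  (fun s : {ffun T -> I} => [ffun t => phi (s t)]) \o translates T c.
Proof. by apply/funext => z; apply/ffunP => t; rewrite !ffunE. Qed.

Lemma cell_translates (T : {fset G}) n (C : 'I_n -> set Z) (c : Z -> 'I_n) f :
  (forall i, C i = c @^-1` [set i]) ->
  cell a C f = translates T c @^-1` [set f].
Proof.
move=> Cc; apply/seteqP; split => z /=.
  move=> Hz; apply/ffunP => t; rewrite ffunE.
  by have [w] := Hz t I; rewrite Cc /= => cw <-; rewrite actVK.
move=> <- t _; exists (a (fsval t) z); first by rewrite Cc /= ffunE.
exact: actK.
Qed.

Lemma translates_neq (R : realType) (P : probability Z R) (T : {fset G})
    (I : finType) (c c' : Z -> I) :
  Defs.invariant a P -> label c -> label c' ->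
  pr P [set z | translates T c z != translates T c' z] <=
  #|{: T}|%:R * pr P [set z | c z != c' z].
Proof.
move=> invP mc mc'; have mN := label_neq mc mc'.
apply: (@le_trans _ _ (pr P [set z | exists t : T,
    (a (fsval t) @^-1` [set z | c z != c' z]) z])).
  apply: pr_le.
  - by apply: label_neq; exact: label_translates.
  - rewrite (_ : [set z | _] = \bigcup_(t in [set: T])
        (a (fsval t) @^-1` [set z | c z != c' z])).
      by apply: fin_bigcup_measurable => // t _; exact: measurable_act_preimage.
    by apply/seteqP; split => z [t]; [exists t|move=> _; exists t].
  move=> z /= /eqP H; apply: contrapT => /forallNP H'; apply: H.
  apply/ffunP => t; rewrite !ffunE; apply/eqP; apply: contrapT => /negP.
  exact: (H' t).
apply: le_trans (pr_exists_le _ _) _.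
  by move=> t; exact: measurable_act_preimage.
rewrite (eq_bigr (fun=> pr P [set z | c z != c' z])).
  by rewrite sumr_const mulr_natl.
by move=> t _; rewrite /pr invP.
Qed.

End translates.

Lemma partition_label d (T : measurableType d) n (C : 'I_n -> set T) :
  ordered_partition C -> exists2 c : T -> 'I_n, label c &
    forall i, C i = c @^-1` [set i].
Proof.
move=> [mC tC coverC].
have /choice[c Hc] : forall x, exists i, C i x.
  move=> x; have : setT x by []. rewrite -coverC => -[i _ Ci].
  by exists i.
have CE i : C i = c @^-1` [set i].
  apply/seteqP; split => x /=; last by move=> <-; exact: Hc.
  by move=> Cx; apply: (tC _ _ I I); exists x.
by exists c => // i; rewrite -CE.
Qed.

Lemma label_partition d (T : measurableType d) n (c : T -> 'I_n) :
  label c -> ordered_partition (fun i => c @^-1` [set i]).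
Proof.
move=> mc; split => //.
  by move=> i j _ _ [x [/= <- <-]].
by apply/seteqP; split => // x _; exists (c x).
Qed.

Section weak_containment_labels.
Context (R : realType) (G : groupType).

Lemma weakly_contains_label d1 d2
    (Z : measurableType d1) (aZ : borel_action G Z) (eta : probability Z R)
    (Y : measurableType d2) (aY : borel_action G Y) (nu : probability Y R) :
  weakly_contains aZ eta aY nu ->
  forall (I : finType) (c : Y -> I) (T : {fset G}) eps, label c -> 0 < eps ->
  exists2 c' : Z -> I, label c' &
    ldist (law eta (translates aZ T c')) (law nu (translates aY T c)) < eps.
Proof.
move=> wc I c T eps mc e0.
have mrc : label (enum_rank \o c) by exact: label_comp.
have [D pD HD] := wc _ _ T eps (label_partition mrc) e0.
have [b mb Db] := partition_label pD.
exists (enum_val \o b); first exact: label_comp.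
have -> : c = enum_val \o (enum_rank \o c).
  by apply/funext => y /=; rewrite enum_rankK.
rewrite (translates_comp aZ T enum_val b).
rewrite (translates_comp aY T enum_val (enum_rank \o c)).
apply: (le_lt_trans (ldist_comp eta nu _ (label_translates aZ mb)
  (label_translates aY mrc))).
rewrite -lte_fin; apply: le_lt_trans HD; rewrite /ldist -sumEFin.
apply: lee_sum => f _.
rewrite (cell_translates aZ f Db) (cell_translates aY f (fun=> erefl)).
have m1 := label_translates (T := T) aZ mb f.
have m2 := label_translates (T := T) aY mrc f.
by rewrite -!prE.
Qed.

Lemma joining_weakly_contains_label d0 (X : measurableType d0)
    (aX : borel_action G X) (mu : probability X R) d1 d2
    (Y1 : measurableType d1) (aY1 : borel_action G Y1)
    (lambda1 : probability (X * Y1)%type R)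
    (Y2 : measurableType d2) (aY2 : borel_action G Y2)
    (lambda2 : probability (X * Y2)%type R) :
  joining_over aX mu aY1 lambda1 -> joining_over aX mu aY2 lambda2 ->
  (forall m n (A : X -> 'I_m) (c : Y2 -> 'I_n) (T : {fset G}) eps,
    label A -> label c -> 0 < eps ->
    exists2 c' : Y1 -> 'I_n, label c' &
      ldist (law lambda1 (fun p => (A p.1, translates aY1 T c' p.2)))
            (law lambda2 (fun p => (A p.1, translates aY2 T c p.2))) < eps) ->
  joining_weakly_contains aX mu aY1 lambda1 aY2 lambda2.
Proof.
move=> j1 j2 H; split => // m n A C T eps pA pC e0.
have [A' mA' AA'] := partition_label pA.
have [c mc Cc] := partition_label pC.
have [c' mc' Hc'] := H _ _ _ _ T _ mA' mc e0.
exists (fun i => c' @^-1` [set i]); first exact: label_partition.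
rewrite -lte_fin /ldist in Hc'; apply: le_lt_trans Hc'.
rewrite pair_big /= -sumEFin; apply: lee_sum => -[i f] _ /=.
have mlab d (Y : measurableType d) (aY : borel_action G Y) (b : Y -> 'I_n) :
    label b -> label (fun p : X * Y => (A' p.1, translates aY T b p.2)).
  move=> mb; apply: label_pair.
    exact: (label_measurable measurable_fst mA').
  exact: (label_measurable measurable_snd (label_translates aY mb)).
rewrite (cell_translates aY1 f (fun=> erefl)) (cell_translates aY2 f Cc) AA'.
have E d (Y : measurableType d) (h : Y -> {ffun T -> 'I_n}) :
    (fst @^-1` (A' @^-1` [set i])) `&` (snd @^-1` (h @^-1` [set f])) =
    (fun p : X * Y => (A' p.1, h p.2)) @^-1` [set (i, f)].
  by apply/seteqP; split => p /= [-> ->].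
have m1 := mlab _ _ aY1 _ mc' (i, f); have m2 := mlab _ _ aY2 _ mc (i, f).
by rewrite !E -!prE.
Qed.

End weak_containment_labels.

(** * Random colourings *)

Section fair_bits.
Context (R : realType).

Let bit (n : nat) (u : R) : bool := odd (Num.truncn (2 ^+ n.+1 * u)).

Let label_bit n : label (bit n : measurableTypeR R -> bool).
Proof.
have mle k : measurable [set u : R | (Num.truncn (2 ^+ n.+1 * u) <= k)%N].
  rewrite (_ : [set u | _] = `]-oo, (k.+1%:R / 2 ^+ n.+1)[%classic); last first.
    apply/seteqP; split => u /=; rewrite in_itv /= truncn_le_nat.
      by rewrite ltr_pdivlMr ?exprn_gt0// mulrC.
    by rewrite ltr_pdivlMr ?exprn_gt0// mulrC.
  exact: measurable_itv.
have mbit : measurable [set u : R | bit n u].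
  rewrite (_ : [set u | _] = \bigcup_(k in [set k | odd k])
      ([set u : R | (Num.truncn (2 ^+ n.+1 * u) <= k)%N] `\`
       [set u : R | (Num.truncn (2 ^+ n.+1 * u) <= k.-1)%N])).
    by apply: bigcup_measurable => k _; apply: measurableD.
  apply/seteqP; split => u; rewrite /bit /=.
    move=> ou; exists (Num.truncn (2 ^+ n.+1 * u)) => //; split => //=.
    by move: ou; case: Num.truncn => // m _ /=; rewrite ltnn.
  move=> [k /= ok [le /negP]]; rewrite -ltnNge => lt.
  suff -> : Num.truncn (2 ^+ n.+1 * u) = k by [].
  by apply/eqP; rewrite eqn_leq le /=; move: lt; case: (k).
have := @label_bool _ (measurableTypeR R) _ mbit.
by congr label; apply/funext => u; rewrite asboolb.
Qed.

Let digits n (k : nat) : {ffun 'I_n -> bool} :=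
  [ffun i : 'I_n => odd (k %/ 2 ^ (n - i.+1))].

Let digits_inj n : {in [pred k | k < 2 ^ n]%N &, injective (digits n)}.
Proof.
move=> k k' kn k'n /ffunP E.
(* The first [j] digits determine the quotient by [2 ^ (n - j)]; one more digit supplies the parity
   lost in halving. *)
have H j : (j <= n)%N -> (k %/ 2 ^ (n - j) = k' %/ 2 ^ (n - j))%N.
  elim: j => [|j IH] jn; first by rewrite subn0 !divn_small.
  have := E (Ordinal jn); rewrite !ffunE /= => Ej.
  have D (a : nat) : (a %/ 2 ^ (n - j) = (a %/ 2 ^ (n - j.+1))./2)%N.
    by rewrite -divn2 -divnMA -expnSr -subSn// subSS.
  have := IH (ltnW jn); rewrite !D => Eh.
  by rewrite -[LHS]odd_double_half -[RHS]odd_double_half Ej Eh.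
by have := H n (leqnn n); rewrite subnn expn0 !divn1.
Qed.

Let digits_surj n (s : {ffun 'I_n -> bool}) :
  exists2 k, (k < 2 ^ n)%N & digits n k = s.
Proof.
pose f (k : 'I_(2 ^ n)) := digits n k.
have inj_f : injective f.
  by move=> k k' /digits_inj H; apply/val_inj/H; rewrite inE.
have cE : (#|{ffun 'I_n -> bool}| <= #|'I_(2 ^ n)|)%N.
  by rewrite card_ffun card_bool !card_ord.
have [g _ fg] := inj_card_bij inj_f cE.
by exists (g s) => //; exact: fg.
Qed.

Let uP := uniform_prob (@ltr01 R).

Let uniform_itv (x y : R) : 0 <= x -> x < y -> y <= 1 ->
  pr uP `[x, y[ = y - x.
Proof.
move=> x0 xy y1; rewrite /pr /uP /= /uniform_prob (eq_integral (cst 1%E)).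
  by rewrite integral_cst//= mul1e lebesgue_measure_itv /= lte_fin xy.
move=> u; rewrite inE /= in_itv /= => /andP[xu uy].
by rewrite /uniform_pdf (le_trans x0 xu) (le_trans (ltW uy) y1) subr0 invr1.
Qed.

Let bits n (u : R) : {ffun 'I_n -> bool} := [ffun i : 'I_n => bit i u].

Let bits_digits n (k : nat) (u : R) : (k < 2 ^ n)%N ->
  k%:R / 2 ^+ n <= u < k.+1%:R / 2 ^+ n -> bits n u = digits n k.
Proof.
move=> kn /andP[ku uk]; apply/ffunP => i; rewrite !ffunE /bit; congr odd.
have p0 m : 0 < 2 ^+ m :> R by rewrite exprn_gt0.
have u0 : 0 <= u by apply: le_trans ku; rewrite divr_ge0// ltW.
have v0 : 0 <= 2 ^+ i.+1 * u by rewrite mulr_ge0// ltW.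
set K := (n - i.+1)%N.
have En : 2 ^+ n = 2 ^+ K * 2 ^+ i.+1 :> R by rewrite -exprD subnK.
have K0 : (0 < 2 ^ K)%N by rewrite expn_gt0.
move: ku uk; rewrite ler_pdivrMr// ltr_pdivlMr// En => ku uk.
apply/eqP; rewrite eqn_leq truncn_le_nat truncn_ge_nat//.
rewrite -(ltr_pM2l (p0 K)) -(ler_pM2l (p0 K)) mulrA -[_ * u]mulrC.
apply/andP; split.
  apply: lt_le_trans uk _; rewrite -natrX -natrM ler_nat mulnC.
  by rewrite -ltn_divLR//.
apply: le_trans ku; rewrite -natrX -natrM ler_nat mulnC.
exact: leq_divM.
Qed.

(** The bits are the binary digits of a uniform real in the unit interval: the first [n] digits are
    constant on each dyadic interval of length [2 ^- n]. *)
Lemma fair_bits : exists d (Omega : measurableType d)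
    (P : probability Omega R) (b : nat -> Omega -> bool),
  (forall n, label (b n)) /\
  forall n (s : {ffun 'I_n -> bool}),
    law P (fun u => [ffun i : 'I_n => b i u]) s = 2 ^- n.
Proof.
exists _, _, uP, bit; split; first exact: label_bit.
move=> n s.
have mb : label (bits n : measurableTypeR R -> _).
  by apply: label_ffun => i; exact: label_bit.
(* Only the lower bound is computed. The [2 ^ n] lower bounds already add up to 1, so all of them
   are equalities, and nothing need be said about the rest of the line. *)
have ge s' : 2 ^- n <= law uP (bits n : measurableTypeR R -> _) s'.
  have [k kn <-] := digits_surj s'.
  have p0 m : 0 < 2 ^+ m :> R by rewrite exprn_gt0.
  have -> : 2 ^- n = pr uP `[k%:R / 2 ^+ n, k.+1%:R / 2 ^+ n[.
    rewrite uniform_itv.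
    - by rewrite -mulrBl -natrB// subSnn mul1r.
    - by rewrite divr_ge0// ltW.
    - by rewrite ltr_pM2r ?invr_gt0// ltr_nat.
    - by rewrite ler_pdivrMr// mul1r -natrX ler_nat.
  apply: pr_le; [exact: measurable_itv|exact: (mb (digits n k))|].
  by move=> u; rewrite /= in_itv /= => /(bits_digits kn).
have sum0 : \sum_s' (law uP (bits n : measurableTypeR R -> _) s' - 2 ^- n) = 0.
  rewrite sumrB law_sum// sumr_const card_ffun card_bool card_ord -[X in 1 - X]mulr_natl.
  by rewrite natrX mulfV ?subrr// expf_neq0.
apply/eqP; rewrite -subr_eq0.
move/eqP: sum0; rewrite psumr_eq0.
  by move=> /allP /(_ s); rewrite mem_index_enum => /(_ isT).
by move=> s' _; rewrite subr_ge0.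
Qed.

End fair_bits.

(** * Probabilities of patterns in a random 2-colouring *)

Section colorings.
Context (R : realType).

Definition compatible (I : finType) (T : eqType) (rho : I -> T)
  (eta : {ffun I -> bool}) : bool :=
  [forall i, forall j, (rho i == rho j) ==> (eta i == eta j)].

(* The probability that a uniformly random 2-colouring of a set containing the
   values of [rho] restricts to [eta] along [rho]. *)
Definition coloring_prob (I : finType) (T : eqType) (rho : I -> T)
    (eta : {ffun I -> bool}) : R :=
  if compatible rho eta
  then 2 ^- #|[set [set j | rho i == rho j]%SET | i : I]%SET| else 0.

(** This is why the exponent in [coloring_prob] counts classes of indices and not values of [rho]:
    points of an orbit, their codes, the atoms containing them and the rows of a pattern become
    interchangeable as soon as they coincide for the same indices. *)
Lemma eq_coloring_prob (I : finType) (T T' : eqType) (rho : I -> T)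
    (rho' : I -> T') eta :
  (forall i j, (rho i == rho j) = (rho' i == rho' j)) ->
  coloring_prob rho eta = coloring_prob rho' eta.
Proof.
move=> H; rewrite /coloring_prob.
have -> : compatible rho eta = compatible rho' eta.
  by apply: eq_forallb => i; apply: eq_forallb => j; rewrite H.
suff -> : [set [set j | rho i == rho j]%SET | i : I]%SET =
    [set [set j | rho' i == rho' j]%SET | i : I]%SET by [].
by apply: eq_imset => i; apply/setP => j; rewrite !inE H.
Qed.

Lemma coloring_prob_ge0 (I : finType) (T : eqType) (rho : I -> T) eta :
  0 <= coloring_prob rho eta.
Proof. by rewrite /coloring_prob; case: ifP. Qed.

Lemma coloring_prob_le1 (I : finType) (T : eqType) (rho : I -> T) eta :
  coloring_prob rho eta <= 1.
Proof.
by rewrite /coloring_prob; case: ifP => // _; rewrite invf_le1 ?exprn_ege1 ?exprn_gt0 ?ler1n.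
Qed.

Section count.
Context (I N : finType).
Implicit Types (rho : I -> N) (eta : {ffun I -> bool}).

Definition restricts rho eta (s : {ffun N -> bool}) : bool :=
  [forall i, s (rho i) == eta i].

Let F rho eta (k : N) : pred bool :=
  [pred c | [forall i, (rho i == k) ==> (eta i == c)]].

Let restrictsE rho eta s : restricts rho eta s = (s \in family (F rho eta)).
Proof.
apply/forallP/familyP => [H k|H i].
  by rewrite inE; apply/forallP => i; apply/implyP => /eqP <-; rewrite eq_sym.
have := H (rho i); rewrite inE => /forallP /(_ i).
by rewrite eqxx /= eq_sym.
Qed.

Let card_familyE (E : N -> pred bool) :
  #|(family E : simpl_pred {ffun N -> bool})| = (\prod_k #|E k|)%N.
Proof.
by rewrite card_family foldrE big_map -big_enum.
Qed.

(** The values on the image of [rho] are forced and the others free. The classes in [coloring_prob]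
    correspond to the points of that image. *)
Lemma card_restricts rho eta :
  #|[pred s | restricts rho eta s]|%:R / 2 ^+ #|N| = coloring_prob rho eta.
Proof.
rewrite /coloring_prob; case: ifPn => [co|]; last first.
  rewrite negb_forall => /existsP[i]; rewrite negb_forall => /existsP[j].
  rewrite negb_imply => /andP[/eqP rij eij].
  rewrite eq_card0 ?mul0r// => s; rewrite inE; apply/negbTE.
  apply: contra eij => /forallP H; rewrite -(eqP (H i)) -(eqP (H j)).
  by rewrite rij.
pose im : {set N} := [set rho i | i : I]%SET.
have -> : #|[pred s | restricts rho eta s]| = (2 ^ (#|N| - #|im|))%N.
  rewrite (eq_card (fun s => restrictsE rho eta s)) card_familyE.
  rewrite (bigID (fun k => k \in im)) /= big1 ?mul1n; last first.
    move=> k /imsetP[i _ ->]; apply/eqP; rewrite -(card1 (eta i)); apply/eqP.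
    apply: eq_card => c; rewrite !inE; apply/forallP/eqP => [H|-> j].
      by have := H i; rewrite eqxx /= => /eqP.
    apply/implyP => rji; rewrite eq_sym; have := co => /forallP/(_ i)/forallP/(_ j).
    by rewrite eq_sym rji.
  rewrite (eq_bigr (fun=> 2%N)); last first.
    move=> k kim; rewrite -card_bool; apply: eq_card => c; rewrite !inE.
    apply/forallP => i; apply/implyP => /eqP rik.
    by move: kim; rewrite -rik imset_f.
  rewrite prod_nat_const; congr (2 ^ _)%N.
  by rewrite -(cardC (mem im)) addKn; apply: eq_card.
have -> : #|[set [set j | rho i == rho j]%SET | i : I]%SET| = #|im|.
  pose cl k := [set j | k == rho j]%SET.
  rewrite -[RHS](card_in_imset (f := cl)); last first.
    move=> k k' /imsetP[i _ ->] /imsetP[i' _ ->] /setP /(_ i).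
    by rewrite !inE eqxx => /esym/eqP.
  by rewrite -imset_comp.
have le : (#|im| <= #|N|)%N by exact: max_card.
rewrite natrX -{2}(subnK le) exprD invfM mulrA mulfV ?mul1r//.
Qed.

(** Colours of disjoint sets of sites are independent; both counts are products over the sites and
    are compared factor by factor. *)
Lemma card_restricts2 rho rho' eta eta' :
  (forall i j, rho i != rho' j) ->
  #|[pred s | restricts rho eta s && restricts rho' eta' s]|%:R / 2 ^+ #|N| =
  coloring_prob rho eta * coloring_prob rho' eta'.
Proof.
move=> dis; rewrite -!card_restricts.
suff : (#|[pred s | restricts rho eta s && restricts rho' eta' s]| * 2 ^ #|N| =
  #|[pred s | restricts rho eta s]| * #|[pred s | restricts rho' eta' s]|)%N.
  move=> /(congr1 (fun n => n%:R : R)); rewrite !natrM natrX => E.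
  rewrite mulrACA -E -mulrA; congr (_ * _).
  by rewrite mulrA mulfV ?mul1r// expf_neq0.
pose FF k := [pred c | F rho eta k c && F rho' eta' k c].
rewrite (eq_card (B := family FF)); last first.
  move=> s; rewrite inE !restrictsE; apply/andP/familyP => [[/familyP H /familyP H'] k|H].
    by rewrite inE; apply/andP; split; [exact: H|exact: H'].
  by split; apply/familyP => k; have := H k; rewrite inE => /andP[].
rewrite (eq_card (fun s => restrictsE rho eta s)).
rewrite [X in _ = (_ * X)%N](eq_card (fun s => restrictsE rho' eta' s)).
rewrite !card_familyE -big_split /= -prod_nat_const -big_split /=.
apply: eq_bigr => k _.
(* At each site one of the two constraints is void, by disjointness; its 2 choices match the factor
   contributed by [2 ^ #|N|]. *)
have [/existsP[i /eqP ik]|nk] := boolP [exists i, rho i == k].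
  have full c : F rho' eta' k c.
    apply/forallP => j; apply/implyP => /eqP jk.
    by have := dis i j; rewrite ik jk eqxx.
  rewrite -card_bool; congr (_ * _)%N; apply: eq_card => c.
    by have := full c; rewrite /F !inE unfold_in /= => ->; rewrite andbT.
  by have := full c; rewrite /F !inE /= => ->.
have full c : F rho eta k c.
  apply/forallP => j; apply/implyP => jk; case/existsP: nk; by exists j.
rewrite mulnC -card_bool; congr (_ * _)%N; apply: eq_card => c.
  by have := full c; rewrite /F !inE /= => ->.
by have := full c; rewrite /F !inE unfold_in /= => ->.
Qed.

End count.

Lemma bits_coloring d (Omega : measurableType d) (P : probability Omega R)
    (b : nat -> Omega -> bool) (I : finType) (rho : I -> nat) eta :
  (forall n, label (b n)) ->
  (forall n (s : {ffun 'I_n -> bool}),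
     law P (fun u => [ffun i : 'I_n => b i u]) s = 2 ^- n) ->
  law P (fun u => [ffun i => b (rho i) u]) eta = coloring_prob rho eta.
Proof.
move=> mb Pb; pose n := (\max_i rho i).+1.
have rn i : (rho i < n)%N by rewrite ltnS; exact: leq_bigmax.
pose r i : 'I_n := Ordinal (rn i).
have mB : label (fun u => [ffun i : 'I_n => b i u]).
  by apply: label_ffun => i; exact: mb.
rewrite (eq_coloring_prob (rho' := r))// -card_restricts card_ord.
rewrite (_ : (fun u => _) = (fun s : {ffun 'I_n -> bool} => [ffun i => s (r i)])
    \o (fun u => [ffun i : 'I_n => b i u])); last first.
  by apply/funext => u; apply/ffunP => i; rewrite !ffunE.
rewrite law_comp// (eq_bigr (fun=> 2 ^- n)) => [|s _]; last exact: Pb.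
rewrite sumr_const -[LHS]mulr_natl; congr (_%:R * _); apply: eq_card => s.
transitivity ([ffun i => s (r i)] == eta) => //.
rewrite inE; apply/eqP/forallP => [E i|H]; first by rewrite -E ffunE.
by apply/ffunP => i; rewrite ffunE; exact/eqP.
Qed.

End colorings.

Section product_probability.
Context (R : realType) d1 d2 (T1 : measurableType d1) (T2 : measurableType d2)
  (P : probability T1 R) (Q : probability T2 R).

Definition product_probability : set (T1 * T2) -> \bar R := (P \x Q)%E.

HB.instance Definition _ := Measure.on product_probability.

Let product_probability_setT : product_probability setT = 1%E.
Proof.
rewrite -setXTT /product_probability product_measure1E//.
rewrite -[RHS]mule1; congr (_ * _)%E; exact: probability_setT.
Qed.

HB.instance Definition _ :=
  Measure_isProbability.Build _ _ R product_probability product_probability_setT.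

Lemma product_probabilityX A B : measurable A -> measurable B ->
  pr product_probability (A `*` B) = pr P A * pr Q B.
Proof.
move=> mA mB; rewrite /pr /= /product_probability product_measure1E// fineM//.
  by rewrite fin_num_measure.
by rewrite fin_num_measure.
Qed.

Lemma product_probabilityE A : product_probability A =
  (\int[P]_x Q (xsection A x))%E.
Proof. by []. Qed.

End product_probability.

(** * Finer and finer partitions, and the absence of atoms *)

Section separating_labels.
Context d (Z : measurableType d) (U : nat -> set Z).
Hypotheses (mU : forall n, measurable (U n)) (sepU : separating U).

Definition sep_label (N : nat) (z : Z) : {ffun 'I_N -> bool} :=
  [ffun n : 'I_N => `[< U n z >]].

Lemma label_sep_label N : label (sep_label N).
Proof. by apply: label_ffun => n; exact: label_bool. Qed.

Lemma sep_label_eq M N x y : (M <= N)%N ->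
  sep_label N x = sep_label N y -> sep_label M x = sep_label M y.
Proof.
move=> MN /ffunP H; apply/ffunP => n; have := H (widen_ord MN n).
by rewrite !ffunE.
Qed.

Lemma sep_label_inj x y : (forall N, sep_label N x = sep_label N y) -> x = y.
Proof.
move=> H; apply: sepU => n; have /ffunP/(_ ord_max) := H n.+1.
rewrite !ffunE /= => E; split => Un; apply/asboolP.
  by rewrite -E; exact/asboolP.
by rewrite E; exact/asboolP.
Qed.

(** The events decrease to the null set where [u = v] inside [B]. It is applied to two independent
    points of Z, to two translates of one point, and to a point and its image under a group element
    that moves it. *)
Lemma sep_label_limit (R : realType) d' (M : measurableType d')
    (m : probability M R) (u v : M -> Z) (B : set M) eps :
  measurable_fun setT u -> measurable_fun setT v -> measurable B ->
  m (B `&` [set x | u x = v x]) = 0%E -> 0 < eps ->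
  exists N0, forall N, (N0 <= N)%N ->
    pr m (B `&` [set x | sep_label N (u x) == sep_label N (v x)]) < eps.
Proof.
move=> mu mv mB mBuv e0.
pose F N := B `&` [set x | sep_label N (u x) == sep_label N (v x)].
have mF N : measurable (F N).
  apply: measurableI => //.
  rewrite (_ : [set x | _] =
      ~` [set x | (sep_label N \o u) x != (sep_label N \o v) x]).
    apply: measurableC; apply: label_neq;
      by apply: label_measurable => //; exact: label_sep_label.
  by apply/seteqP; split => x /=; [move=> ->|move/negP; rewrite negbK].
have FE : \bigcap_N F N = B `&` [set x | u x = v x].
  apply/seteqP; split => x.
    move=> H; split; first by have [] := H 0%N I.
    by apply: sep_label_inj => N; have [_ /eqP] := H N I.
  by move=> [Bx /= uv] N _; split => //=; rewrite uv.
have : (m \o F) x @[x --> \oo] --> m (\bigcap_N F N).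
  apply: nonincreasing_cvg_mu => //.
  - by rewrite -ge0_fin_numE// fin_num_measure.
  - exact: bigcapT_measurable.
  - move=> M' N MN; apply/subsetPset => x [Bx /eqP Nx]; split => //=; apply/eqP.
    exact: sep_label_eq Nx.
rewrite FE mBuv.
move=> /fine_cvgP[_] /cvgrPdist_lt /(_ eps e0)[N0 _ HN]; exists N0 => N NN.
have := HN N NN; rewrite sub0r normrN /= ger0_norm//.
exact: fine_ge0.
Qed.

End separating_labels.

Section atomless.
Context (R : realType) (G : groupType) d (Z : measurableType d)
  (a : borel_action G Z) (eta : probability Z R) (U : nat -> set Z).
Hypotheses (mU : forall n, measurable (U n)) (sepU : separating U)
  (inv_eta : Defs.invariant a eta).

Lemma measurable_singleton (z : Z) : measurable [set z].
Proof.
rewrite (_ : [set z] = [set x | x = z])//.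
by apply: (measurable_equalizer mU sepU).
Qed.

Lemma singleton_act g z : eta [set a g z] = eta [set z].
Proof.
rewrite -(inv_eta g); last exact: measurable_singleton.
congr (eta _); apply/seteqP; split => x /=; last by move=> ->.
by move=> /(congr1 (a g^-1%g)); rewrite !actK.
Qed.

(** All points of an orbit have the same mass [c]; if [c] were positive, more than [1 / c] of them
    would exceed total mass 1. *)
Lemma infinite_orbit_singleton z :
  infinite_set (range (a ^~ z)) -> eta [set z] = 0%E.
Proof.
move=> inf; have m1 := measurable_singleton; set c := pr eta [set z].
suff c0 : c = 0 by rewrite -prE// -/c c0.
apply/eqP; apply: contrapT => /negP cn0.
have c_gt0 : 0 < c by rewrite lt_neqAle eq_sym cn0 pr_ge0.
have Hs (s : seq Z) : uniq s -> (forall x, x \in s -> range (a ^~ z) x) ->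
    measurable [set x | x \in s] /\ pr eta [set x | x \in s] = (size s)%:R * c.
  elim: s => [_ _|x s IH /= /andP[xs us] Hs].
    by rewrite (_ : [set x | _] = set0) ?pr0 ?mul0r//; apply/seteqP; split.
  have [ms prs] := IH us (fun y ys => Hs y (mem_behead (s := x :: s) ys)).
  have E : [set y | y \in x :: s] = [set x] `|` [set y | y \in s].
    apply/seteqP; split => y /=; rewrite in_cons.
      by case/orP => [/eqP|]; [left|right].
    by case => [->|->]; rewrite ?eqxx ?orbT.
  split; first by rewrite E; exact: measurableU.
  rewrite E prU// ?prs; last first.
    by apply/seteqP; split => // y /= [-> ]; rewrite (negbTE xs).
  have [g _ <-] := Hs x (mem_head _ _).
  by rewrite /pr singleton_act -/(pr _ _) -/c -[_.+1]add1n natrD mulrDl mul1r.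
pose n := (Num.truncn c^-1).+1.
have [B BO nB] := infinite_set_fset n inf.
have [mB prB] := Hs (enum_fset B) (fset_uniq B) BO.
have : 1 < pr eta [set x | x \in enum_fset B].
  rewrite prB; apply: (@lt_le_trans _ _ (n%:R * c)).
    by rewrite -ltr_pdivrMr// div1r truncnS_gt.
  by rewrite ler_pM2r// ler_nat.
by rewrite ltNge pr_le1.
Qed.

Lemma aperiodic_diagonal : aperiodic a eta ->
  product_probability eta eta [set p | p.1 = p.2] = 0%E.
Proof.
move=> ap; rewrite product_probabilityE.
have mD : measurable [set p : Z * Z | p.1 = p.2].
  exact: (measurable_equalizer mU sepU measurable_fst measurable_snd).
rewrite (ae_eq_integral (cst 0%E))//; first exact: integral0.
  exact: measurable_fun_xsection.
apply: filterS ap => z /infinite_orbit_singleton z0 _ /=; rewrite -[RHS]z0.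
congr (eta _); apply/seteqP; split => x.
  by move=> /xsectionP /= ->.
by move=> /= ->; apply/xsectionP.
Qed.

End atomless.

(** * Second moment of a random colouring of atoms *)

Section second_moment.
Context (R : realType) (L N J : finType).
Variables (p : L -> R) (A : pred L) (kappa : L -> R) (r : L -> J -> N)
  (s : {ffun J -> bool}).
Hypotheses (p_ge0 : forall l, 0 <= p l) (p_sum : \sum_l p l = 1)
  (kappa01 : forall l, 0 <= kappa l <= 1).

Let a l := p l * (A l)%:R.
Let k l := coloring_prob R (r l) s.
Let avg (f : {ffun N -> bool} -> R) := (\sum_sigma f sigma) / 2 ^+ #|N|.

(** [r l j] is the site of the [j]-th point of a sample with label [l], and [A] selects labels. This
    is the probability that the selected samples display [s] once the sites are coloured by
    [sigma]. *)
Definition colored_mass (sigma : {ffun N -> bool}) : R :=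
  \sum_l p l * (A l)%:R * (restricts (r l) s sigma)%:R.

Let m := \sum_l p l * (A l)%:R * kappa l.
Let M := \sum_l a l * k l.

Let p2_gt0 : 0 < 2 ^+ #|N| :> R. Proof. by rewrite exprn_gt0. Qed.

Let avg_sum (I : finType) (F : I -> {ffun N -> bool} -> R) :
  avg (fun sg => \sum_i F i sg) = \sum_i avg (F i).
Proof. by rewrite /avg exchange_big mulr_suml. Qed.

Let avgZ c F : avg (fun sg => c * F sg) = c * avg F.
Proof. by rewrite /avg -mulr_sumr mulrA. Qed.

Let avg_pred (E : pred {ffun N -> bool}) :
  avg (fun sg => (E sg)%:R) = #|[pred sg | E sg]|%:R / 2 ^+ #|N|.
Proof.
rewrite /avg; congr (_ / _); rewrite -sum1_card natr_sum [RHS]big_mkcond /=.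
by apply: eq_bigr => sg _; rewrite inE; case: (E sg).
Qed.

Let avg_mass : avg colored_mass = M.
Proof.
rewrite /colored_mass avg_sum; apply: eq_bigr => l _.
by rewrite avgZ avg_pred card_restricts.
Qed.

Let C l l' := avg (fun sg => (restricts (r l) s sg && restricts (r l') s sg)%:R).

Let avg_mass2 : avg (fun sg => colored_mass sg ^+ 2) =
  \sum_l \sum_l' a l * a l' * C l l'.
Proof.
rewrite (_ : (fun sg => _) = (fun sg => \sum_l \sum_l' a l * a l' *
    (restricts (r l) s sg && restricts (r l') s sg)%:R)).
  rewrite avg_sum; apply: eq_bigr => l _; rewrite avg_sum.
  by apply: eq_bigr => l' _; rewrite avgZ.
apply/funext => sg; rewrite expr2 /colored_mass mulr_suml; apply: eq_bigr => l _.
rewrite mulr_sumr; apply: eq_bigr => l' _.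
by rewrite -mulnb natrM /a mulrACA.
Qed.

Let k01 l : 0 <= k l <= 1.
Proof. by rewrite coloring_prob_ge0 coloring_prob_le1. Qed.

Let C_le1 l l' : C l l' <= 1.
Proof.
rewrite /C avg_pred ler_pdivrMr// mul1r -natrX ler_nat.
by apply: leq_trans (max_card _) _; rewrite card_ffun card_bool.
Qed.

Let collide l l' : bool := [exists j, exists j', r l j == r l' j'].

Let C_disjoint l l' : ~~ collide l l' -> C l l' = k l * k l'.
Proof.
move=> H; rewrite /C avg_pred card_restricts2// => j j'.
by apply: contra H => e; apply/existsP; exists j; apply/existsP; exists j'.
Qed.

Let a_ge0 l : 0 <= a l. Proof. by rewrite mulr_ge0. Qed.
Let a_le l : a l <= p l.
Proof. by rewrite /a; case: (A l); rewrite ?mulr1// mulr0. Qed.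

(** Labels using disjoint sites are independent and contribute no covariance; for the others the
    trivial bound by 1 is enough. *)
Let cov_le : avg (fun sg => colored_mass sg ^+ 2) - M ^+ 2 <=
  \sum_l \sum_l' p l * p l' * (collide l l')%:R.
Proof.
have -> : M ^+ 2 = \sum_l \sum_l' a l * a l' * (k l * k l').
  rewrite expr2 /M mulr_suml; apply: eq_bigr => l _; rewrite mulr_sumr.
  by apply: eq_bigr => l' _; rewrite mulrACA.
rewrite avg_mass2 -sumrB; apply: ler_sum => l _; rewrite -sumrB.
apply: ler_sum => l' _; rewrite -mulrBr.
case: (boolP (collide l l')) => [co|nco]; last first.
  by rewrite C_disjoint// subrr !mulr0.
rewrite mulr1; apply: (@le_trans _ _ (a l * a l')); last exact: ler_pM.
rewrite ler_piMr ?mulr_ge0//.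
have := C_le1 l l'; have /andP[k0 _] := k01 l; have /andP[k0' _] := k01 l'.
have := mulr_ge0 k0 k0'; lra.
Qed.

Let beta := \sum_l p l * (kappa l != k l)%:R.

Let beta_le1 : beta <= 1.
Proof.
rewrite -p_sum; apply: ler_sum => l _; rewrite ler_piMr//.
by case: (_ != _).
Qed.

Let bias_le : `|M - m| <= beta.
Proof.
rewrite /M /m -sumrB; apply: le_trans (ler_norm_sum _ _ _) _.
apply: ler_sum => l _; rewrite -mulrBr normrM ger0_norm//.
have [->|ne] := eqVneq (kappa l) (k l); first by rewrite subrr normr0 !mulr0.
rewrite mulr1 -[leRHS]mulr1; apply: ler_pM => //.
have /andP[k0 k1] := k01 l; have /andP[h0 h1] := kappa01 l.
rewrite ler_norml; apply/andP; split; lra.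
Qed.

(* The variance is paid by the pairs of labels that share a colour site, the bias
   by the labels whose nominal probability [kappa] is not the actual one. *)
Lemma second_moment_le :
  (\sum_sigma (colored_mass sigma - m) ^+ 2) / 2 ^+ #|N| <=
  \sum_l \sum_l' p l * p l' * [exists j, exists j', r l j == r l' j']%:R +
  \sum_l p l * (kappa l != coloring_prob R (r l) s)%:R.
Proof.
have -> : (\sum_sigma (colored_mass sigma - m) ^+ 2) / 2 ^+ #|N| =
    (avg (fun sg => colored_mass sg ^+ 2) - M ^+ 2) + (M - m) ^+ 2.
  have -> : \sum_sigma (colored_mass sigma - m) ^+ 2 =
      \sum_sg colored_mass sg ^+ 2 - 2 * m * (\sum_sg colored_mass sg) +
      m ^+ 2 * 2 ^+ #|N|.
    have -> : m ^+ 2 * 2 ^+ #|N| = \sum_(sg : {ffun N -> bool}) m ^+ 2.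
      by rewrite sumr_const card_ffun card_bool -[RHS]mulr_natr natrX.
    rewrite mulr_sumr -sumrB -big_split /=; apply: eq_bigr => sg _; ring.
  rewrite -avg_mass /avg; field.
  by rewrite gt_eqF.
apply: lerD; first exact: cov_le.
(* The bias enters squared, but [beta] is at most 1, so the linear bound suffices. *)
apply: le_trans (_ : beta ^+ 2 <= _); last first.
  by rewrite expr2 ler_piMr//; apply: sumr_ge0 => l _; rewrite mulr_ge0.
by rewrite -real_normK ?num_real// ler_sqr ?nnegrE ?bias_le//; apply: sumr_ge0 => l _; rewrite mulr_ge0.
Qed.

End second_moment.

(** The finitely many deviations are summed before averaging, so that a single colouring is good for
    all of them at once. *)
Lemma exists_le_avg (R : realType) (N K : finType) (Y : K -> {ffun N -> bool} -> R)
    (B : R) :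
  (forall t, (\sum_s Y t s) / 2 ^+ #|N| <= B) ->
  exists s, \sum_t Y t s <= #|K|%:R * B.
Proof.
move=> H; apply: contrapT => /forallNP H'.
have p2 : 0 < 2 ^+ #|N| :> R by rewrite exprn_gt0.
have : \sum_(s : {ffun N -> bool}) (#|K|%:R * B) < \sum_s \sum_t Y t s.
  apply: ltr_sum => [|s _]; last by rewrite ltNge; apply/negP.
  by apply/hasP; exists [ffun=> true]; rewrite ?mem_index_enum.
rewrite exchange_big /= sumr_const -[ltLHS]mulr_natr card_ffun card_bool natrX.
rewrite -ltr_pdivlMr// mulr_suml ltNge => /negP; apply.
apply: le_trans (ler_sum _ (fun t _ => H t)) _.
by rewrite sumr_const mulr_natl.
Qed.

Section random_labels.
Context (R : realType) d d' (V : measurableType d) (Z : measurableType d')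
  (lambda : probability V R) (eta : probability Z R) (U : nat -> set Z)
  (J I : finType) (p : J -> V -> Z) (alpha : V -> I).
Hypotheses (mU : forall n, measurable (U n)) (sepU : separating U)
  (mp : forall j, measurable_fun setT (p j))
  (pushp : forall j, is_pushforward (p j) lambda eta)
  (diag0 : product_probability eta eta [set q | q.1 = q.2] = 0%E)
  (malpha : label alpha).

(** The coincidence matrix of the points [p j x]. Two of its rows are equal exactly when the points
    are, so the pattern can itself be used as the map [rho] of [coloring_prob]. *)
Definition pattern (x : V) : {ffun J -> {ffun J -> bool}} :=
  [ffun j => [ffun j' => `[< p j x = p j' x >]]].

Lemma label_pattern : label pattern.
Proof.
apply: label_ffun => j; apply: label_ffun => j'; apply: label_bool.
exact: (measurable_equalizer mU sepU).
Qed.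

Let kappa (pi : {ffun J -> {ffun J -> bool}}) s := coloring_prob R pi s.

Let q N := sep_label U N.

Let mq N : label (q N). Proof. exact: label_sep_label. Qed.

(** A sample is recorded by its value of [alpha], the true coincidences of its points, and the atoms
    containing the points. The true coincidences give the nominal probability, the atoms the actual
    one. *)
Let L N : finType := (I * {ffun J -> {ffun J -> bool}} *
  {ffun J -> {ffun 'I_N -> bool}})%type.

Let ell N (x : V) : L N := ((alpha x, pattern x), [ffun j => q N (p j x)]).

Let mell N : label (ell N).
Proof.
apply: label_pair; first exact: label_pair malpha label_pattern.
by apply: label_ffun => j; exact: (label_measurable (mp j) (@mq N)).
Qed.

(** A union bound over pairs of indices: every [p j] has law [eta], so the atoms of two independent
    samples collide as those of two independent points of Z do. *)
Let collisions N : \sum_l \sum_l' law lambda (ell N) l * law lambda (ell N) l' *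
    [exists j, exists j', l.2 j == l'.2 j']%:R <=
  #|J|%:R ^+ 2 * pr (product_probability eta eta)
    [set z | q N z.1 == q N z.2].
Proof.
have push j v : \sum_l law lambda (ell N) l * (l.2 j == v)%:R = law eta (q N) v.
  rewrite -(law_pre (pushp j) (@mq N)).
  rewrite (_ : q N \o p j = (fun l : L N => l.2 j) \o ell N); last first.
    by apply/funext => x; rewrite /= ffunE.
  rewrite law_comp// [RHS]big_mkcond /=; apply: eq_bigr => l _.
  by case: eqP; rewrite ?mulr1 ?mulr0.
have diagE : pr (product_probability eta eta) [set z | q N z.1 == q N z.2] =
    \sum_v law eta (q N) v * law eta (q N) v.
  have m2 : label (fun z : Z * Z => (q N z.1, q N z.2)).
    apply: label_pair.
      exact: (label_measurable measurable_fst (@mq N)).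
    exact: (label_measurable measurable_snd (@mq N)).
  rewrite (pr_label _ (fun vw => vw.1 == vw.2) m2) [LHS]big_mkcond.
  transitivity (\sum_v \sum_w (if v == w then
    law (product_probability eta eta) (fun z : Z * Z => (q N z.1, q N z.2)) (v, w)
    else 0)); first by rewrite pair_big; apply: eq_bigr => -[].
  apply: eq_bigr => v _; rewrite (bigD1 v)//= eqxx big1 ?addr0; last first.
    by move=> w; rewrite eq_sym => /negbTE ->.
  rewrite -product_probabilityX; [|exact: (@mq N)..]; congr (pr _ _).
  by apply/seteqP; split => z /= [-> ->].
rewrite diagE.
apply: (@le_trans _ _ (\sum_l \sum_l' \sum_j \sum_j' \sum_v
    (law lambda (ell N) l * (l.2 j == v)%:R) *
    (law lambda (ell N) l' * (l'.2 j' == v)%:R))).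
  apply: ler_sum => l _; apply: ler_sum => l' _.
  have pos : 0 <= law lambda (ell N) l * law lambda (ell N) l'.
    by rewrite mulr_ge0// law_ge0.
  have E j j' : \sum_v (law lambda (ell N) l * (l.2 j == v)%:R) *
      (law lambda (ell N) l' * (l'.2 j' == v)%:R) =
      law lambda (ell N) l * law lambda (ell N) l' * (l.2 j == l'.2 j')%:R.
    rewrite (bigD1 (l.2 j))//= eqxx big1 ?addr0; last first.
      by move=> v; rewrite eq_sym => /negbTE ->; rewrite mulr0 mul0r.
    by rewrite mulr1 [l'.2 j' == _]eq_sym mulrA.
  case: existsP => [[j /existsP[j' jj']]|_]; last first.
    rewrite mulr0; apply: sumr_ge0 => j _; apply: sumr_ge0 => j' _.
    by rewrite E mulr_ge0.
  rewrite (bigD1 j)//= (bigD1 j')//= E jj' mulr1 -addrA lerDl addr_ge0//.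
    by apply: sumr_ge0 => i _; rewrite E mulr_ge0.
  apply: sumr_ge0 => i _; apply: sumr_ge0 => i' _.
  by rewrite E mulr_ge0.
rewrite le_eqVlt; apply/orP; left; apply/eqP.
transitivity (\sum_(j : J) \sum_(j' : J) \sum_v law eta (q N) v * law eta (q N) v).
  under eq_bigr do (rewrite exchange_big /=; under eq_bigr do
    (rewrite exchange_big /=; under eq_bigr do rewrite exchange_big /=)).
  rewrite exchange_big /=; apply: eq_bigr => j _.
  rewrite exchange_big /=; apply: eq_bigr => j' _.
  rewrite exchange_big /=; apply: eq_bigr => v _.
  rewrite -{1}(push j v) -(push j' v) mulr_suml; apply: eq_bigr => l _.
  by rewrite mulr_sumr.
by rewrite !sumr_const -[LHS]mulr_natl -[X in _ * X = _]mulr_natl expr2 mulrA.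
Qed.

(** Nominal and actual probability can differ only if two distinct points of the sample lie in the
    same atom. *)
Let bad N s : \sum_l law lambda (ell N) l *
    (kappa l.1.2 s != coloring_prob R l.2 s)%:R <=
  \sum_j \sum_j' pr lambda ([set x | p j x <> p j' x] `&`
      [set x | q N (p j x) == q N (p j' x)]).
Proof.
set F := fun jj : J * J => [set x | p jj.1 x <> p jj.2 x] `&`
  [set x | q N (p jj.1 x) == q N (p jj.2 x)].
have mF jj : measurable (F jj).
  apply: measurableI.
    by apply: measurableC; exact: (measurable_equalizer mU sepU).
  rewrite (_ : [set x | _] = ~` [set x | (q N \o p jj.1) x != (q N \o p jj.2) x]).
    by apply: measurableC; apply: label_neq; apply: label_measurable.
  by apply/seteqP; split => x /=; [move=> ->|move/negP; rewrite negbK].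
rewrite [leRHS](_ : _ = \sum_jj pr lambda (F jj)); last first.
  by rewrite pair_big.
apply: le_trans (pr_exists_le _ mF).
rewrite [leLHS](_ : _ = pr lambda [set x |
    kappa (ell N x).1.2 s != coloring_prob R (ell N x).2 s]); last first.
  rewrite (pr_label _ (fun l : L N => kappa l.1.2 s != coloring_prob R l.2 s) (@mell N)).
  rewrite [RHS]big_mkcond /=; apply: eq_bigr => l _.
  by case: ifP; rewrite ?mulr1 ?mulr0.
apply: pr_le.
- exact: (label_preimage [set l : L N | kappa l.1.2 s != coloring_prob R l.2 s] (@mell N)).
- rewrite (_ : [set x | _] = \bigcup_(jj in [set: J * J]) F jj).
    by apply: fin_bigcup_measurable.
  by apply/seteqP; split => x [jj]; [exists jj|move=> _; exists jj].
move=> x /= /negP H; apply: contrapT => /forallNP H'; apply: H; apply/eqP.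
apply: eq_coloring_prob => j j'; rewrite !ffunE.
apply/eqP/eqP => [/ffunP/(_ j')|qjj].
  rewrite !ffunE => E; have /asboolP -> // : `[< p j x = p j' x >].
  by rewrite E; exact/asboolP.
have -> : p j x = p j' x.
  by apply: contrapT => ne; apply: (H' (j, j')); split => //; exact/eqP.
by [].
Qed.

Let massE N (sg : {ffun {ffun 'I_N -> bool} -> bool}) i s :
  law lambda (fun x => (alpha x, [ffun j => sg (q N (p j x))])) (i, s) =
  colored_mass (law lambda (ell N)) [pred l : L N | l.1.1 == i]
    (fun l : L N => l.2) s sg.
Proof.
rewrite (_ : (fun x => _) =
    (fun l : L N => (l.1.1, [ffun j => sg (l.2 j)])) \o ell N); last first.
  by apply/funext => x /=; congr pair; apply/ffunP => j; rewrite !ffunE.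
rewrite law_comp// big_mkcond /=; apply: eq_bigr => l _.
rewrite xpair_eqE /= /restricts -mulrA -natrM mulnb.
rewrite (_ : (_ == s) = [forall j, sg (l.2 j) == s j]); last first.
  apply/eqP/forallP => [<- j|H]; first by rewrite ffunE.
  by apply/ffunP => j; rewrite ffunE; exact/eqP.
by case: ifP; rewrite ?mulr1 ?mulr0.
Qed.

Let meanE N i s :
  \sum_pi law lambda (fun x => (alpha x, pattern x)) (i, pi) *
         coloring_prob R pi s =
  \sum_l law lambda (ell N) l * (l.1.1 == i)%:R * kappa l.1.2 s.
Proof.
rewrite [RHS](partition_big (fun l : L N => l.1.2) predT)//=.
apply: eq_bigr => pi _.
rewrite (_ : (fun x => _) = (fun l : L N => l.1) \o ell N)//.
rewrite law_comp// mulr_suml big_mkcond [RHS]big_mkcond /=; apply: eq_bigr => -[[i' pi'] w] _ /=.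
rewrite xpair_eqE; case: (i' == i) => /=; case: eqP => [->|_] //=;
  by rewrite ?mulr1 ?mulr0 ?mul0r.
Qed.

(** The colour sites are the atoms of [sep_label U N]. For large [N] collisions are rare because the
    diagonal is null, and bad samples because distinct points get separated; the mean square
    deviation is then small for every target, and some colouring is good for all targets. *)
Lemma random_labels eps : 0 < eps ->
  exists2 c : Z -> bool, label c &
    ldist (law lambda (fun x => (alpha x, [ffun j => c (p j x)])))
      (fun t => \sum_pi law lambda (fun x => (alpha x, pattern x)) (t.1, pi) *
         coloring_prob R pi t.2) < eps.
Proof.
move=> e0; pose T : finType := (I * {ffun J -> bool})%type.
pose e1 := eps / #|T|.+1%:R; have e1_gt0 : 0 < e1 by rewrite divr_gt0.
(* [D] exceeds [#|T|] times [2 #|J|^2], so the deviations summed over [T] stay below [e1 ^+ 2]. Each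
   is then at most [e1] in absolute value, and [#|T|] of those add up to less than [eps]. *)
pose D := (#|T|.+1 * (#|J| ^ 2 * 2).+1)%N.
pose c := e1 ^+ 2 / D%:R.
have c_gt0 : 0 < c by rewrite divr_gt0 ?exprn_gt0// ltr0n.
have /choice[N1 HN1] : forall jj : J * J, exists N0, forall N, (N0 <= N)%N ->
    pr lambda ([set x | p jj.1 x <> p jj.2 x] `&`
      [set x | q N (p jj.1 x) == q N (p jj.2 x)]) < c.
  move=> jj; apply: (sep_label_limit mU sepU (mp jj.1) (mp jj.2)) => //.
    by apply: measurableC; exact: (measurable_equalizer mU sepU).
  by rewrite (_ : _ `&` _ = set0) ?measure0//; apply/seteqP; split => // x [].
have [N2 HN2] : exists N0, forall N, (N0 <= N)%N ->
    pr (product_probability eta eta)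
      (setT `&` [set z | q N z.1 == q N z.2]) < c.
  apply: (sep_label_limit mU sepU measurable_fst measurable_snd) => //.
  by rewrite setTI.
pose N := maxn N2 (\max_jj N1 jj).
pose m t := \sum_pi law lambda (fun x => (alpha x, pattern x)) (t.1, pi) *
  coloring_prob R pi t.2.
pose X (t : T) (sg : {ffun {ffun 'I_N -> bool} -> bool}) :=
  colored_mass (law lambda (ell N)) [pred l : L N | l.1.1 == t.1]
    (fun l : L N => l.2) t.2 sg.
pose B := #|J|%:R ^+ 2 * c *+ 2.
have avgB t : (\sum_sg (X t sg - m t) ^+ 2) / 2 ^+ #|{ffun 'I_N -> bool}| <= B.
  rewrite /m (meanE N).
  have l0 l : 0 <= law lambda (ell N) l by exact: law_ge0.
  have kappa01 (l : L N) : 0 <= kappa l.1.2 t.2 <= 1.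
    by rewrite coloring_prob_ge0 coloring_prob_le1.
  have H := second_moment_le [pred l : L N | l.1.1 == t.1]
    (fun l : L N => l.2) t.2 l0 (@law_sum _ _ _ lambda _ _ (@mell N)) kappa01.
  apply: (le_trans H).
  rewrite /B mulr2n; apply: lerD.
    apply: le_trans (collisions N) _; rewrite ler_wpM2l ?exprn_ge0//.
    by have := HN2 N (leq_maxl _ _); rewrite setTI => /ltW.
  apply: le_trans (bad N t.2) _.
  apply: (@le_trans _ _ (\sum_(j : J) \sum_(j' : J) c)).
    apply: ler_sum => j _; apply: ler_sum => j' _; apply/ltW.
    apply: (HN1 (j, j')); apply: leq_trans (leq_maxr _ _).
    exact: (leq_bigmax (j, j')).
  by rewrite !sumr_const -[leLHS]mulr_natl -[X in _ * X <= _]mulr_natl expr2 mulrA.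
have [sg Hsg] := exists_le_avg (Y := fun t sg => (X t sg - m t) ^+ 2) avgB.
exists (sg \o q N); first by apply: label_comp; exact: mq.
have HT : \sum_t (X t sg - m t) ^+ 2 < e1 ^+ 2.
  apply: le_lt_trans Hsg _.
  have -> : #|T|%:R * B = e1 ^+ 2 * ((#|T| * (#|J| ^ 2 * 2))%:R / D%:R).
    by rewrite /B /c !natrM; ring.
  rewrite gtr_pMr ?exprn_gt0// ltr_pdivrMr ?ltr0n// mul1r ltr_nat /D.
  by move: (#|J| ^ 2 * 2)%N => M; rewrite mulSn mulnS addSn ltnS addnA leq_addl.
have Ht t : `|X t sg - m t| <= e1.
  rewrite -ler_sqr ?nnegrE ?(ltW e1_gt0)// real_normK ?num_real//.
  apply: le_trans (ltW HT); rewrite (bigD1 t)//= lerDl.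
  by apply: sumr_ge0 => t' _; exact: sqr_ge0.
apply: (@le_lt_trans _ _ (\sum_(t : T) e1)).
  by apply: ler_sum => -[i s] _ /=; rewrite massE; exact: (Ht (i, s)).
rewrite sumr_const -[ltLHS]mulr_natr /e1 mulrAC ltr_pdivrMr//.
by rewrite ltr_pM2l// ltr_nat.
Qed.

End random_labels.

(** The type carries [R], [e] and [inj_e] so that canonical structures can be attached to it: the
    metric takes values in [R] and is built from the coding [e]. *)
Definition bernoulli_space (R : realType) (G : Type) (e : G -> nat)
  (inj_e : injective e) := G -> bool.

(** * The independent colouring of orbits *)

Section bernoulli_space.
Context (R : realType) (G : Type) (e : G -> nat) (inj_e : injective e).
Local Notation B := (bernoulli_space R inj_e).

HB.instance Definition _ := gen_eqMixin B.
HB.instance Definition _ := gen_choiceMixin B.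
HB.instance Definition _ := isPointed.Build B (fun=> false).

Definition agree (n : nat) (x y : G -> bool) : Prop :=
  forall g, (e g < n)%N -> x g = y g.

(* A metric for the product topology of {0,1}^G; at least one is needed to see
   {0,1}^G as a standard Borel space. *)
Definition bern_dist (x y : B) : R :=
  if pselect (exists n, `[< ~ agree n x y >]) is left E
  then (ex_minn E)%:R^-1 else 0.

Lemma bern_dist_le n x y : bern_dist x y <= n.+1%:R^-1 <-> agree n x y.
Proof.
rewrite /bern_dist; case: pselect => [E|/forallNP E]; last first.
  by split => // _; apply: contrapT => nn; exact: (E n (asboolT nn)).
case: ex_minnP => N /asboolP nN minN.
(* [agree 0] is vacuous, so the first disagreement has positive index and inversion is
   order-reversing there. *)
have N0 : (0 < N)%N by case: N nN {minN} => // -[].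
rewrite lef_pV2 ?posrE ?ltr0n// ler_nat; split => [nltN|nn].
  by apply: contrapT => nn; have := minN n (asboolT nn); rewrite leqNgt nltN.
rewrite ltnNge; apply/negP => Nn; apply: nN => g gN; apply: nn.
exact: leq_trans Nn.
Qed.

Lemma bern_dist_ge n x y : ~ agree n x y -> n%:R^-1 <= bern_dist x y.
Proof.
move=> nn; rewrite /bern_dist; case: pselect => [E|]; last first.
  by case; exists n; exact/asboolP.
case: ex_minnP => N /asboolP nN minN.
have N0 : (0 < N)%N by case: N nN {minN} => // -[].
have Nn : (N <= n)%N by apply: minN; exact/asboolP.
by rewrite lef_pV2 ?posrE ?ltr0n ?(leq_trans N0 Nn)// ler_nat.
Qed.

Lemma agreexx n x : agree n x x. Proof. by []. Qed.

Let dist_ge0 x y : 0 <= bern_dist x y.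
Proof. by rewrite /bern_dist; case: pselect. Qed.

Let distxx x : bern_dist x x = 0.
Proof.
rewrite /bern_dist; case: pselect => // E; exfalso; move: E => [n /asboolP].
by apply; exact: agreexx.
Qed.

Let dist_pos x y : bern_dist x y = 0 -> x = y.
Proof.
move=> d0; apply/funext => g.
have /bern_dist_le : bern_dist x y <= (e g).+2%:R^-1 by rewrite d0 invr_ge0.
by apply.
Qed.

Let dist_sym x y : bern_dist x y = bern_dist y x.
Proof.
rewrite /bern_dist.
have E n : `[< ~ agree n x y >] = `[< ~ agree n y x >].
  by apply: asbool_equiv_eq; split => H H'; apply: H => g /H'.
case: pselect => [E1|E1]; case: pselect => [E2|E2] //.
- by congr (_%:R^-1); apply: eq_ex_minn.
- by exfalso; apply: E2; move: E1 => [n]; rewrite E; exists n.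
- by exfalso; apply: E1; move: E2 => [n]; rewrite -E; exists n.
Qed.

Let dist_triangle y x z : bern_dist x z <= bern_dist x y + bern_dist y z.
Proof.
rewrite {1}/bern_dist; case: pselect => [E|_]; last exact: addr_ge0.
case: ex_minnP => N /asboolP nN _.
(* The ultrametric argument: a disagreement of [x] and [z] below [N] is one of [x] and [y] or of [y]
   and [z]. *)
have [xy|/bern_dist_ge xy] := pselect (agree N x y); last first.
  by rewrite (le_trans xy)// lerDl.
have /bern_dist_ge yz : ~ agree N y z.
  by move=> yz; apply: nN => g gN; rewrite xy// yz.
by rewrite (le_trans yz)// lerDr.
Qed.

HB.instance Definition _ :=
  isMetric.Build R B distxx dist_pos dist_sym dist_triangle.

Lemma bern_ball_agree n (x y : B) : ball x n.+1%:R^-1 y -> agree n x y.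
Proof. by rewrite ballEmdist /= => /ltW /bern_dist_le. Qed.

Lemma agree_bern_ball (eps : R) : 0 < eps ->
  exists n, forall x y : B, agree n x y -> ball x eps y.
Proof.
move=> e0; have [n] := ltr_add_invr e0; rewrite add0r => ne.
exists n => x y /bern_dist_le xy; rewrite ballEmdist /=.
exact: le_lt_trans ne.
Qed.

Let bern_complete (F : set_system B) : ProperFilter F -> cauchy F -> cvg F.
Proof.
move=> FF /cauchyP cF.
have /choice[x Fx] : forall n : nat, exists x : B, F (ball x n.+1%:R^-1).
  by move=> n; apply: cF.
have agr k n g : (e g < k)%N -> (e g < n)%N -> x k g = x n g.
  move=> gk gn; have [w [wk wn]] := filter_ex (filterI (Fx k) (Fx n)).
  by rewrite (bern_ball_agree wk gk) (bern_ball_agree wn gn).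
(* The bit at [g] is stable from index [(e g).+1] on, the first whose ball controls the code
   [e g]. *)
pose l : B := fun g => x (e g).+1 g.
apply/cvg_ex; exists l; apply/cvg_ballP => eps e0.
have [n Hn] := agree_bern_ball e0.
near=> y.
  apply: Hn => g gn; rewrite /l (agr _ n)//.
  apply: bern_ball_agree gn; near: y.
  exact: Fx.
Unshelve. all: by end_near.
Qed.

HB.instance Definition _ := Uniform_isComplete.Build B bern_complete.

Lemma bern_open_agree (O : set B) (x : B) : open O -> O x ->
  exists n, forall y, agree n x y -> O y.
Proof.
rewrite openE => oO /oO /nbhs_ballP[eps /= e0 xO].
by have [n Hn] := agree_bern_ball e0; exists n => y /Hn /xO.
Qed.

Lemma bern_separable : Defs.separable B.
Proof.
exists (range (fun (s : seq bool) g => nth false s (e g))).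
  exact: sub_countable (card_image_le _ _) (countableP _).
move=> O [x Ox] oO; have [n Hn] := bern_open_agree oO Ox.
pose s := mkseq (fun k => `[< exists2 g, e g = k & x g >]) n.
exists (fun g => nth false s (e g)); split; last by exists s.
apply: Hn => g gn; rewrite nth_mkseq//; apply/idP/asboolP.
  by move=> xg; exists g.
by move=> [h /inj_e ->].
Qed.

Lemma bern_open_bit g : open [set x : B | x g].
Proof.
rewrite openE => x /= xg; apply/nbhs_ballP; exists (e g).+2%:R^-1 => //=.
by move=> y /bern_ball_agree /(_ g (ltnSn _)) yg; rewrite /= -yg.
Qed.

Definition bern_measurable := g_sigma_algebraType (@open B).

Lemma bern_standard_borel : standard_borel R bern_measurable.
Proof.
exists B, id; split => //; first exact: bern_separable.
by exists id.
Qed.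

Lemma bern_cylinder :
  cylinder_generated (fun (x : bern_measurable) g => x g).
Proof.
apply/seteqP; split.
  apply: smallest_sub; first exact: smallest_sigma_algebra.
  move=> O oO; apply: (cylinder_open inj_e) => x Ox.
  have [n Hn] := bern_open_agree oO Ox; exists n => y xy; apply: Hn => g gn.
  by apply/idP/idP => /(xy g gn).
apply: smallest_sub; first exact: smallest_sigma_algebra.
by move=> _ [g ->]; apply: sub_sigma_algebra; exact: bern_open_bit.
Qed.

End bernoulli_space.

Section shift.
Context (R : realType) (G : groupType) (e : G -> nat) (inj_e : injective e).
Local Notation W := (bern_measurable R inj_e).

Let shift (h : G) (w : W) : W := fun g => w (g * h)%g.
Let shift1 w : shift 1%g w = w.
Proof. by apply/funext => g; rewrite /shift mulg1. Qed.
Let shiftM g h w : shift (g * h)%g w = shift g (shift h w).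
Proof. by apply/funext => x; rewrite /shift mulgA. Qed.
Let measurable_shift g : measurable_fun setT (shift g).
Proof.
apply: (measurable_fun_cylinder (G := G) (bern_cylinder R inj_e)) => h.
exact: (measurable_bit (G := G) (bern_cylinder R inj_e)).
Qed.

Definition shift_action : borel_action G W :=
  BorelAction shift1 shiftM measurable_shift.

End shift.

Section independent_equalities.
Context (R : realType).

(* Each edge has an end which is neither its other end nor on a later edge. *)
Fixpoint fresh_edges (c : seq (nat * nat)) : bool :=
  if c is pq :: c' then
    [&& pq.1 != pq.2, pq.1 \notin unzip1 c', pq.1 \notin unzip2 c' &
        fresh_edges c']
  else true.

Let holds n (c : seq (nat * nat)) (s : {ffun 'I_n.+1 -> bool}) : bool :=
  all (fun pq => s (inord pq.1) == s (inord pq.2)) c.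

(** Flipping the fresh end of the first edge toggles the equality on that edge and leaves the later
    ones alone, so each edge halves the count. *)
Let card_holds n c : fresh_edges c ->
  all (fun pq => (pq.1 <= n)%N && (pq.2 <= n)%N) c ->
  (#|[pred s | @holds n c s]| * 2 ^ size c = 2 ^ n.+1)%N.
Proof.
elim: c => [_ _|[p q] c IH].
  rewrite muln1 (eq_card (B := {: {ffun 'I_n.+1 -> bool}})).
    by rewrite card_ffun card_bool card_ord.
  by move=> s; rewrite !inE.
move=> /and4P[/= pq p1 p2 fr] /andP[/andP[pn qn] cn].
rewrite -(IH fr cn) expnS mulnA; congr (_ * _)%N.
pose eqs (s : {ffun 'I_n.+1 -> bool}) := s (inord p) == s (inord q).
have <- : (#|[pred s | @holds n c s && eqs s]| +
  #|[pred s | @holds n c s && ~~ eqs s]| = #|[pred s | @holds n c s]|)%N.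
  rewrite -[RHS](cardID (mem (fun s => eqs s))); congr (_ + _)%N.
  by apply: eq_card => s; rewrite !inE andbC.
pose flip (s : {ffun 'I_n.+1 -> bool}) : {ffun 'I_n.+1 -> bool} :=
  [ffun i => if i == inord p then ~~ s i else s i].
have flipK : involutive flip.
  by move=> s; apply/ffunP => i; rewrite !ffunE; case: eqP => // _; rewrite negbK.
have ne (r : nat) (s : {ffun 'I_n.+1 -> bool}) : (r <= n)%N -> r != p ->
    flip s (inord r) = s (inord r).
  move=> rn rp; rewrite ffunE ifN//; apply: contra rp => /eqP/(congr1 val).
  by rewrite /= !inordK// => ->.
have fl s : @holds n c (flip s) = @holds n c s.
  apply: eq_in_all => -[r t] rt.
  have /andP[/= rn tn] := allP cn _ rt.
  rewrite /= !ne//.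
  - by apply: contra p2 => /eqP <-; apply/mapP; exists (r, t).
  - by apply: contra p1 => /eqP <-; apply/mapP; exists (r, t).
have fe s : eqs (flip s) = ~~ eqs s.
  rewrite /eqs (ne q) 1?eq_sym// ffunE eqxx.
  by case: (s _); case: (s _).
have -> : #|[pred s | @holds n c s && ~~ eqs s]| =
    #|[pred s | @holds n c s && eqs s]|.
  rewrite -(fintype.card_image (inv_inj flipK)); apply: eq_card => s.
  apply/fintype.imageP/idP => [[t + ->]|]; rewrite !inE.
    by rewrite fl fe.
  by move=> H; exists (flip s); rewrite ?flipK// inE fl fe negbK.
rewrite muln2 addnn; congr (_.*2); apply: eq_card => s.
by rewrite !inE andbC.
Qed.

Lemma fresh_edges_prob d (Omega : measurableType d) (P : probability Omega R)
    (b : nat -> Omega -> bool) c :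
  (forall n, label (b n)) ->
  (forall n (s : {ffun 'I_n -> bool}),
     law P (fun u => [ffun i : 'I_n => b i u]) s = 2 ^- n) ->
  fresh_edges c ->
  pr P [set u | all (fun pq => b pq.1 u == b pq.2 u) c] = 2 ^- size c.
Proof.
move=> mb Pb fr.
pose n := \max_(pq <- c) maxn pq.1 pq.2.
have cn : all (fun pq => (pq.1 <= n)%N && (pq.2 <= n)%N) c.
  by apply/allP => pq pqc; rewrite -geq_max /n (big_rem pq)//= leq_maxl.
have mB : label (fun u => [ffun i : 'I_n.+1 => b i u]).
  by apply: label_ffun => i; exact: mb.
rewrite (_ : [set u | _] =
    [set u | @holds n c [ffun i : 'I_n.+1 => b i u]]); last first.
  apply: eq_set => u; congr is_true; apply: eq_in_all => pq /(allP cn)/andP[pn qn].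
  by rewrite !ffunE !inordK.
rewrite (pr_label _ (@holds n c) mB) (eq_bigr (fun=> 2 ^- n.+1)) => [|s _]; last exact: Pb.
rewrite sumr_const -[LHS]mulr_natl.
have H := card_holds fr cn.
have p0 k : 2 ^+ k != 0 :> R by rewrite expf_neq0.
apply: (mulIf (p0 n.+1)); rewrite mulrVK ?unitfE//.
by rewrite -[2 ^+ n.+1]natrX -H natrM natrX mulrC mulfK.
Qed.

End independent_equalities.

Lemma null_exists (R : realType) d (T : measurableType d)
    (P : probability T R) (G : Type) (e : G -> nat) (A : G -> set T) :
  injective e -> (forall g, measurable (A g)) -> (forall g, P (A g) = 0%E) ->
  P [set x | exists g, A g x] = 0%E.
Proof.
move=> inj_e mA A0.
have mE := measurable_exists inj_e mA.
apply/(negligibleP P mE).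
rewrite (_ : [set x | _] = \bigcup_n [set x | exists2 g, e g = n & A g x]).
  apply: negligible_bigcup => n.
  have [[g eg]|H] := pselect (exists g, e g = n).
    apply: (@negligibleS _ _ _ _ (A g)).
      by move=> x [g' eg' Ag']; rewrite (inj_e _ _ (etrans eg (esym eg'))).
    by apply/(negligibleP P (mA g)); exact: A0.
  rewrite (_ : [set x | _] = set0); first exact: negligible_set0.
  by apply/seteqP; split => // x [g eg _]; apply: H; exists g.
apply/seteqP; split => x /=; first by move=> [g Ag]; exists (e g) => //; exists g.
by move=> [n _ [g _ Ag]]; exists g.
Qed.

(** * The law of the orbit colouring and its stabilizers *)

Section generic_colouring.
Context (R : realType) (G : groupType) (e : G -> nat) (inj_e : injective e).
Context d (Z : measurableType d) (a : borel_action G Z)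
  (eta : probability Z R) (U : nat -> set Z).
Hypotheses (mU : forall n, measurable (U n)) (sepU : separating U)
  (inv_eta : Defs.invariant a eta).
Context d' (Omega : measurableType d') (P : probability Omega R)
  (b : nat -> Omega -> bool).
Hypotheses (mb : forall n, label (b n))
  (Pb : forall n (s : {ffun 'I_n -> bool}),
     law P (fun u => [ffun i : 'I_n => b i u]) s = 2 ^- n).
Local Notation W := (bern_measurable R inj_e).

Let hits (z : Z) (g : G) (n : nat) : bool :=
  `[< exists h, e h = n /\ a h z = a g z >].

Let hits_ex z g : exists n, hits z g n.
Proof. by exists (e g); apply/asboolP; exists g. Qed.

(* The least code of a group element with the same action on [z]: it names
   the point [a g z] of the orbit of [z]. *)
Definition point_code (z : Z) (g : G) : nat := ex_minn (hits_ex z g).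

Lemma point_code_eq z g h : point_code z g = point_code z h <-> a g z = a h z.
Proof.
rewrite /point_code; split.
  case: ex_minnP => n /asboolP[g' [<- <-]] _.
  by case: ex_minnP => m /asboolP[h' [<- <-]] _ /inj_e ->.
by move=> gh; apply: eq_ex_minn => n; rewrite /hits gh.
Qed.

Let measurable_hits g n : measurable [set z | hits z g n].
Proof.
rewrite (_ : [set z | _] = [set z | exists h, e h = n /\ a h z = a g z]).
  apply: (measurable_exists inj_e (A := fun h =>
    [set z | e h = n /\ a h z = a g z])) => h.
  apply: (@measurableI _ _ [set _ | e h = n] [set z | a h z = a g z]).
    exact: measurable_prop.
  by apply: (measurable_equalizer mU sepU); exact: measurable_act.
by apply/seteqP; split => z /= /asboolP.
Qed.

Let measurable_point_code g n : measurable [set z | point_code z g = n].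
Proof.
rewrite (_ : [set z | _] = [set z | hits z g n] `&`
  [set z | forall k, (k < n)%N -> ~ hits z g k]).
  apply: measurableI => //.
  apply: (@measurable_forall _ _ _ id _
    (fun k => [set z | (k < n)%N -> ~ hits z g k])) => // k.
  have [kn|kn] := boolP (k < n)%N.
    rewrite (_ : [set z | _] = ~` [set z | hits z g k]).
      exact: measurableC.
    by apply/seteqP; split => z /=; [exact|].
  by rewrite (_ : [set z | _] = setT)//; apply/seteqP; split.
apply/seteqP; split => z /=; rewrite /point_code.
  case: ex_minnP => m hm minm <-; split => // k km hk.
  by have := minm k hk; rewrite leqNgt km.
case: ex_minnP => m hm minm [hn nk]; apply/eqP; rewrite eqn_leq minm//=.
by rewrite leqNgt; apply/negP => mn; exact: (nk m mn hm).
Qed.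

Definition orbit_colouring (p : Z * Omega) : W :=
  fun g => b (point_code p.1 g) p.2.

Lemma measurable_orbit_colouring : measurable_fun setT orbit_colouring.
Proof.
apply: (measurable_fun_cylinder (G := G) (bern_cylinder R inj_e)) => g.
rewrite (_ : [set p | _] =
    \bigcup_n ([set z | point_code z g = n] `*` (b n @^-1` [set true]))).
  apply: bigcupT_measurable => n; apply: measurableX => //; exact: mb.
apply/seteqP; split => [[z u] /= bu|[z u] [n _ [/= <- ]]//].
by exists (point_code z g).
Qed.

(** A colouring fixed by [h] has equal bits at [g z] and [g h z] for all [g]. An infinite orbit
    always has a point [g z] not yet used, so arbitrarily many of these equalities are
    independent. *)
Let fresh_equalities (z : Z) (h : G) n :
  infinite_set (range (a ^~ z)) -> a h z <> z ->
  exists gs : seq G, size gs = n /\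
    fresh_edges [seq (point_code z g, point_code z (g * h)%g) | g <- gs].
Proof.
move=> inf hz; elim: n => [|n [gs [sgs fr]]]; first by exists [::].
pose c := [seq (point_code z g, point_code z (g * h)%g) | g <- gs].
have [g gP] : exists g, point_code z g \notin unzip1 c ++ unzip2 c.
  apply: contrapT => /forallNP all; apply: inf.
  pose V := unzip1 c ++ unzip2 c.
  pose f (v : nat) : Z := if pselect (exists g, point_code z g = v) is left E
    then a (projT1 (cid E)) z else z.
  apply: (@sub_finite_set _ _ (f @` [set` V])); last first.
    by apply: finite_image; exact: finite_seq.
  move=> _ [g _ <-]; exists (point_code z g).
    by have /negP := all g; rewrite negbK.
  rewrite /f; case: pselect; last by case; exists g.
  by move=> E; case: cid => g' /= /point_code_eq.
exists (g :: gs); split; first by rewrite /= sgs.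
move: gP; rewrite mem_cat negb_or => /andP[g1 g2] /=.
rewrite g1 g2 fr !andbT; apply/eqP => /point_code_eq; rewrite actM => /esym.
by move=> /(congr1 (a g^-1%g)); rewrite !actK.
Qed.

Let fixed (h : G) : set (Z * Omega) := [set p | a h p.1 <> p.1 /\
  shift_action R inj_e h (orbit_colouring p) = orbit_colouring p].

Let bern_sep := standard_borel_separating (bern_standard_borel R inj_e).

Let measurable_fixed h : measurable (fixed h).
Proof.
have [V [mV sepV]] := bern_sep.
apply: measurableI.
  apply: measurableC.
  apply: (measurable_equalizer mU sepU (S := (Z * Omega)%type)
    (f := fun p => a h p.1) (g := fst)) => //.
  exact: (measurableT_comp (measurable_act a h) measurable_fst).
apply: (measurable_equalizer mV sepV (S := (Z * Omega)%type)
    (f := fun p => shift_action R inj_e h (orbit_colouring p))).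
  exact: (measurableT_comp (measurable_act (shift_action R inj_e) h)
    measurable_orbit_colouring).
exact: measurable_orbit_colouring.
Qed.

(** If [h] moves [z], being fixed by [h] entails [n] independent equalities of bits and has
    probability at most [2 ^- n], for every [n]. *)
Let fixed_section z h : infinite_set (range (a ^~ z)) ->
  P (xsection (fixed h) z) = 0%E.
Proof.
move=> inf; have mx : measurable (xsection (fixed h) z).
  exact: measurable_xsection.
rewrite -prE//; congr EFin; apply/eqP; rewrite eq_le pr_ge0 andbT.
have [hz|hz] := pselect (a h z = z).
  rewrite (_ : xsection _ _ = set0) ?pr0//; apply/seteqP; split => // u.
  by move=> /xsectionP[] /=.
apply/ler_addgt0Pl => eps e0; rewrite addr0.
have [n ne] : exists n, 2 ^- n < eps :> R.
  have [n] := ltr_add_invr e0; rewrite add0r => ne; exists n.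
  apply: le_lt_trans ne; rewrite lef_pV2 ?posrE ?exprn_gt0 ?ltr0n//.
  by rewrite -natrX ler_nat ltn_expl.
have [gs [sgs fr]] := fresh_equalities n inf hz.
have := fresh_edges_prob mb Pb fr; rewrite size_map sgs => prn.
apply: le_trans (ltW ne); rewrite -prn; apply: pr_le => //.
  set c := map _ _; elim: {sgs fr prn} c => [|pq c IH].
    by rewrite (_ : [set u | _] = setT)//; apply/seteqP; split.
  rewrite (_ : [set u | _] = ~` [set u | b pq.1 u != b pq.2 u] `&`
      [set u | all (fun pq => b pq.1 u == b pq.2 u) c]).
    by apply: measurableI => //; apply: measurableC; apply: label_neq.
  apply/seteqP; split => u /=.
    by move=> /andP[/eqP -> ->]; rewrite eqxx.
  by move=> [/negP]; rewrite negbK => -> ->.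
move=> u /xsectionP[_ /=] H; apply/allP => _ /mapP[g _ ->] /=.
by have /= := congr1 (fun w => w g) H; rewrite /orbit_colouring /= => ->.
Qed.

(** Elements fixing [z] always fix its colouring. The converse fails only on the countable union of
    the null sets [fixed h]. *)
Lemma stab_orbit_colouring : aperiodic a eta ->
  exists N, [/\ measurable N, product_probability eta P N = 0%E &
    forall p, ~ N p ->
      stab (shift_action R inj_e) (orbit_colouring p) = stab a p.1].
Proof.
move=> ap; exists [set p | exists h, fixed h p].
have mN : measurable [set p | exists h, fixed h p] by exact: (measurable_exists inj_e).
split => //.
  rewrite product_probabilityE (ae_eq_integral (cst 0%E))//; first exact: integral0.
    exact: measurable_fun_xsection.
  apply: filterS ap => z inf _ /=.
  rewrite (_ : xsection _ z = [set u | exists h, xsection (fixed h) z u]).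
    apply: (null_exists inj_e) => h; first exact: measurable_xsection.
    exact: fixed_section.
  apply/seteqP; split => u.
    by move=> /xsectionP[h hu]; exists h; apply/xsectionP.
  by move=> [h /xsectionP hu]; apply/xsectionP; exists h.
move=> p Np; apply: subgroup_ext => h; rewrite /stab /=; split => [Hh|hz].
  by apply: contrapT => hz; apply: Np; exists h.
apply/funext => g; rewrite /orbit_colouring /=; congr (b _ _).
by apply/point_code_eq; rewrite actM hz.
Qed.

(** By Fubini it is enough to fix [z]. The bits read along [r] are then bits of the points' codes,
    which coincide exactly when the points do, that is, when the rows of [pattern] do. *)
Lemma orbit_colouring_integral (J : finType) (r : J -> G) (h : Z -> \bar R)
    (s : {ffun J -> bool}) :
  measurable_fun setT h -> (forall z, (0 <= h z)%E) ->
  (\int[product_probability eta P]_(p in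
     [set p | [ffun j => orbit_colouring p (r j)] = s]) h p.1 =
   \int[eta]_z (h z * (coloring_prob R (pattern (fun j => a (r j)) z) s)%:E))%E.
Proof.
move=> mh h0; pose D : set (Z * Omega) :=
  [set p | [ffun j => orbit_colouring p (r j)] = s].
have mD : measurable D.
  have ml : label (fun p => [ffun j => orbit_colouring p (r j)]).
    apply: label_ffun => j.
    apply: (label_measurable (f := fun w : W => w (r j))
      measurable_orbit_colouring) => c.
    have mt := measurable_bit (G := G) (bern_cylinder R inj_e) (r j).
    case: c; first exact: mt.
    rewrite (_ : _ @^-1` _ = ~` [set w : W | w (r j)]); first exact: measurableC.
    by apply/seteqP; split => w /=; [move=> ->|move/negP/negbTE].
  exact: (ml s).
pose f p := (h p.1 * (\1_D p)%:E)%E.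
have mf : measurable_fun setT f.
  apply: emeasurable_funM; first exact: (measurableT_comp mh measurable_fst).
  by apply/measurable_EFinP; exact: measurable_indic.
have f0 p : (0 <= f p)%E by rewrite mule_ge0// lee_fin.
transitivity (\int[product_probability eta P]_p f p)%E.
  rewrite integral_mkcond; apply: eq_integral => p _.
  by rewrite patchE /f indicE; case: ifP => _; rewrite ?mule1 ?mule0.
rewrite [LHS](@fubini_tonelli1 _ _ _ _ _ eta P f mf f0); apply: eq_integral => z _.
rewrite /fubini_F /f /=.
have mx : measurable (xsection D z) by exact: measurable_xsection.
transitivity (\int[P]_y (h z * (\1_(xsection D z) y)%:E))%E.
  by apply: eq_integral => u _; rewrite !indicE mem_xsection.
rewrite ge0_integralZl//; last by apply/measurable_EFinP; exact: measurable_indic.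
rewrite integral_indic// setIT; congr (_ * _)%E.
rewrite -[LHS](prE P mx); congr EFin.
rewrite -(eq_coloring_prob R (rho := fun j => point_code z (r j))).
  rewrite -(bits_coloring _ _ mb Pb); congr (pr P _).
  by apply/seteqP; split => u; rewrite /D; [move=> /xsectionP|move=> ?; apply/xsectionP].
move=> j j'; apply/eqP/eqP => [/point_code_eq E|/ffunP/(_ j')].
  by apply/ffunP => k; rewrite !ffunE E.
rewrite !ffunE => E; apply/point_code_eq/asboolP.
by rewrite E; exact/asboolP.
Qed.

Variables (omega : probability W R).
Hypothesis omegaE : is_pushforward orbit_colouring (product_probability eta P) omega.

Let bits_at (J : finType) (r : J -> G) (w : W) := [ffun j => w (r j)].

Let label_bits_at (J : finType) (r : J -> G) : label (bits_at r).
Proof.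
apply: label_ffun => j c.
have mt := measurable_bit (G := G) (bern_cylinder R inj_e) (r j).
case: c; first exact: mt.
rewrite (_ : _ @^-1` _ = ~` [set w : W | w (r j)]); first exact: measurableC.
by apply/seteqP; split => w /=; [move=> ->|move/negP/negbTE].
Qed.

Let law_bits_at (J : finType) (r : J -> G) s : (law omega (bits_at r) s)%:E =
  (\int[eta]_z (coloring_prob R (pattern (fun j => a (r j)) z) s)%:E)%E.
Proof.
have m1 : measurable (bits_at r @^-1` [set s]) by exact: label_bits_at.
rewrite prE// omegaE//.
have := @orbit_colouring_integral J r (cst 1%E) s (measurable_cst _) (fun=> lee01).
rewrite integral_cst ?mul1e//.
  by move=> E; rewrite [LHS]E; apply: eq_integral => z _; rewrite mul1e.
have := measurable_orbit_colouring measurableT m1.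
by rewrite setTI.
Qed.

(** Codes are relative to the base point, so the colouring is not equivariant pointwise: the same
    point may read another bit from [h z] than from [z]. Only laws agree: windows of the shifted
    colouring have the coincidences of [h z], and [eta] is invariant. *)
Lemma omega_invariant : Defs.invariant (shift_action R inj_e) omega.
Proof.
move=> h E mE.
have [Q QE] := exists_pushforward omega (measurable_act (shift_action R inj_e) h).
rewrite -[LHS]QE//; apply: (cylinder_unique (bern_cylinder R inj_e)) => // F s.
have wE x : window (fun (x : W) g => x g) F x = bits_at (fun g : F => val g) x.
  by apply/ffunP => g; rewrite !ffunE asboolb.
rewrite (_ : window _ F = bits_at (fun g : F => val g)); last exact/funext.
rewrite -(law_pre QE (@label_bits_at _ _)); apply: EFin_inj.
rewrite (_ : _ \o _ = bits_at (fun g : F => val g * h)%g); last first.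
  by apply/funext => w; apply/ffunP => g; rewrite !ffunE.
rewrite !law_bits_at.
transitivity (\int[eta]_z (coloring_prob R
    (pattern (fun g : F => a (val g)) (a h z)) s)%:E)%E.
  apply: eq_integral => z _.
  rewrite (_ : pattern _ z = pattern (fun g : F => a (val g)) (a h z))//.
  by apply/ffunP => g; apply/ffunP => g'; rewrite !ffunE !actM.
have mp : measurable_fun setT (fun z => (coloring_prob R
    (pattern (fun g : F => a (val g)) z) s)%:E).
  apply/measurable_EFinP => _ Y mY; rewrite setTI.
  have ml : label (pattern (fun g : F => a (val g))).
    by apply: (label_pattern mU sepU) => g; exact: measurable_act.
  exact: (label_preimage [set pi : {ffun F -> {ffun F -> bool}} |
    Y (coloring_prob R pi s)] ml).
rewrite -[LHS](integral_is_pushforward (f := a h) (P := eta) (Q := eta)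
  (D := setT) (h := fun z => (coloring_prob R
    (pattern (fun g : F => a (val g)) z) s)%:E))//.
- by move=> A mA; rewrite /pushforward inv_eta.
- exact: measurable_act.
- by move=> z; rewrite lee_fin coloring_prob_ge0.
Qed.

Hypothesis aperiodic_a : aperiodic a eta.
Let mstab : measurable_fun setT (stab a) := measurable_stab inj_e a mU sepU.
Let mstabW : measurable_fun setT (stab (shift_action R inj_e)).
Proof.
have [V [mV sepV]] := bern_sep.
exact: (measurable_stab inj_e (shift_action R inj_e) mV sepV).
Qed.

(** Off a null set the colouring has the stabilizer of its base point, so functions of the
    stabilizer can be evaluated on Z. *)
Lemma omega_integral_stab (v : SubGrp G -> \bar R) (D : set W) :
  measurable_fun setT v -> (forall H, (0 <= v H)%E) -> measurable D ->
  (\int[omega]_(w in D) v (stab (shift_action R inj_e) w) =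
   \int[product_probability eta P]_(p in orbit_colouring @^-1` D)
     v (stab a p.1))%E.
Proof.
move=> mv v0 mD.
have mOD : measurable (orbit_colouring @^-1` D).
  by have := measurable_orbit_colouring measurableT mD; rewrite setTI.
have mvW : measurable_fun setT (fun w => v (stab (shift_action R inj_e) w)).
  exact: (measurableT_comp mv mstabW).
rewrite (integral_is_pushforward omegaE)//; last 2 first.
- exact: measurable_orbit_colouring.
- exact: measurable_funTS.
apply: ae_eq_integral => //.
- apply: measurable_funTS.
  exact: (measurableT_comp mvW measurable_orbit_colouring).
- apply: measurable_funTS.
  exact: (measurableT_comp mv (measurableT_comp mstab measurable_fst)).
have [N [mN N0 HN]] := stab_orbit_colouring aperiodic_a.
exists N; split => // p /= Hp; apply: contrapT => /HN E; apply: Hp => _.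
by rewrite E.
Qed.

Lemma omega_stabilizer_type (theta : probability (SubGrp G) R) :
  stabilizer_type a eta theta ->
  stabilizer_type (shift_action R inj_e) omega theta.
Proof.
move=> thetaE A mA; rewrite thetaE// /pushforward.
have mAa : measurable (stab a @^-1` A).
  by have := mstab measurableT mA; rewrite setTI.
have mAW : measurable (stab (shift_action R inj_e) @^-1` A).
  by have := mstabW measurableT mA; rewrite setTI.
have := @omega_integral_stab (fun H => (\1_A H)%:E) setT.
rewrite preimage_setT => H.
transitivity (\int[omega]_w (\1_A (stab (shift_action R inj_e) w))%:E)%E;
  last first.
  rewrite (_ : (fun w => _) =
    (fun w => (\1_(stab (shift_action R inj_e) @^-1` A) w)%:E))//.
  by rewrite integral_indic// setIT.
rewrite H//; last by apply/measurable_EFinP; exact: measurable_indic.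
rewrite (_ : (fun p => _) = (fun p => (\1_((stab a @^-1` A) `*` setT) p)%:E)).
  have mX : measurable ((stab a @^-1` A) `*` [set: Omega]) by exact: measurableX.
  rewrite integral_indic// setIT -[LHS](prE eta mAa).
  rewrite -[RHS](prE (product_probability eta P) mX).
  by rewrite product_probabilityX// prT mulr1.
apply/funext => p; rewrite !indicE; congr (_%:R%:E); congr nat_of_bool.
by apply/idP/idP; rewrite !inE /=; [|case].
Qed.

End generic_colouring.

(** * Weak containment with stabilizers *)

Lemma pr_ldist (R : realType) d d' (T : measurableType d)
    (T' : measurableType d') (P : probability T R) (Q : probability T' R)
    (I : finType) (f : T -> I) (g : T' -> I) (S : pred I) :
  label f -> label g ->
  `|pr P [set x | S (f x)] - pr Q [set x | S (g x)]| <=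
  ldist (law P f) (law Q g).
Proof.
move=> mf mg; rewrite !pr_label// -sumrB.
apply: le_trans (ler_norm_sum _ _ _) _.
by rewrite big_mkcond; apply: ler_sum => i _; case: ifP.
Qed.

Section stabilizer_windows.
Context (R : realType) (G : groupType) (e : G -> nat) (inj_e : injective e).
Context d1 d2 (W : measurableType d1) (Y : measurableType d2)
  (aW : borel_action G W) (aY : borel_action G Y)
  (omega : probability W R) (nu : probability Y R)
  (theta : probability (SubGrp G) R) (U : nat -> set Y) (V : nat -> set W).
Hypotheses (mU : forall n, measurable (U n)) (sepU : separating U)
  (mV : forall n, measurable (V n)) (sepV : separating V)
  (typeW : stabilizer_type aW omega theta)
  (typeY : stabilizer_type aY nu theta)
  (wc : weakly_contains aW omega aY nu).

Definition subgroup_window (F : {fset G}) : SubGrp G -> {ffun F -> bool} :=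
  window (fun (H : SubGrp G) g => subgroup_set H g) F.

Lemma label_subgroup_window F : label (subgroup_window F).
Proof. exact: (label_window (G := G) (subgroup_cylinder inj_e)). Qed.

Let moved d (T : measurableType d) (a : borel_action G T) g : set T :=
  [set x | a g x <> x].

Let mY g : measurable (moved aY g).
Proof.
apply: measurableC; apply: (measurable_equalizer mU sepU (f := aY g) (g := id)).
  exact: measurable_act.
exact: measurable_id.
Qed.

Let mW g : measurable (moved aW g).
Proof.
apply: measurableC; apply: (measurable_equalizer mV sepV (f := aW g) (g := id)).
  exact: measurable_act.
exact: measurable_id.
Qed.

Let pr_moved g : pr omega (moved aW g) = pr nu (moved aY g).
Proof.
pose B : set (SubGrp G) := [set H | ~ subgroup_set H g].
have mB : measurable B.
  by apply: measurableC; exact: (measurable_bit (subgroup_cylinder inj_e)).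
transitivity (pr theta B); first by rewrite /pr typeW.
by rewrite /pr typeY.
Qed.

(* The event [g x = x] is guessed from the equality of the labels of [g x] and
   [x].  The guess can only fail when [g] moves [x]; it rarely does on Y if the
   partition is fine, and as [g] moves points with the same probability in both
   spaces, it rarely does on W either. *)
Let estimate (T F : {fset G}) (Q P : finType)
    (s : {ffun (1%g |` (T `|` F))%fset -> Q * P}) :
    {ffun T -> Q} * {ffun F -> bool} :=
  ([ffun t => (s (fincl (fsubset_trans (fsubsetUl T F)
                           (fsubsetU1 1%g (T `|` F)%fset)) t)).1],
   [ffun g => (s (fincl (fsubset_trans (fsubsetUr T F)
                           (fsubsetU1 1%g (T `|` F)%fset)) g)).2 ==
              (s (FSetSub (fset1U1 1%g (T `|` F)%fset))).2]).

Let estimateE (T F : {fset G}) (Q P : finType) d (X : measurableType d)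
    (a : borel_action G X) (k : X -> Q * P) x :
  estimate (translates a (1%g |` (T `|` F))%fset k x) =
  (translates a T (fst \o k) x,
   [ffun g : F => (k (a (val g) x)).2 == (k x).2]).
Proof.
rewrite /estimate; congr pair; apply/ffunP => t; rewrite !ffunE//=.
by rewrite act1.
Qed.

Lemma weakly_contains_stab (Q : finType) (c : Y -> Q) (T F : {fset G}) eps :
  label c -> 0 < eps ->
  exists2 c' : W -> Q, label c' &
    ldist (law omega (fun w => (translates aW T c' w,
                                subgroup_window F (stab aW w))))
          (law nu (fun y => (translates aY T c y,
                             subgroup_window F (stab aY y)))) < eps.
Proof.
move=> mc e0; set f := #|{: F}|.
(* The budget: [2 f del] for wrong guesses on Y, [4 f del] on W, and [del] for weak containment. *)
pose del := eps / (6 * f%:R + 2).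
have f0 : 0 <= f%:R :> R by [].
have del0 : 0 < del by rewrite divr_gt0// ltr_wpDl// mulr_ge0.
have /choice[N1 HN1] : forall g : F, exists N0, forall N, (N0 <= N)%N ->
    pr nu (moved aY (val g) `&`
      [set y | sep_label U N (aY (val g) y) == sep_label U N y]) < del.
  move=> g; apply: (sep_label_limit mU sepU (v := id)) => //.
  - exact: measurable_act.
  - by rewrite (_ : _ `&` _ = set0) ?measure0//; apply/seteqP; split => // y [].
pose N := \max_g N1 g.
pose p := sep_label U N.
have mp : label p by exact: label_sep_label.
pose T' := (1%g |` (T `|` F))%fset.
pose k y := (c y, p y).
have mk : label k by exact: label_pair.
have [k' mk' Hk'] := weakly_contains_label wc T' mk del0.
pose c' := fst \o k'; have mc' : label c' by exact: label_comp.
exists c' => //.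
pose E d (X : measurableType d) (a : borel_action G X) (k0 : X -> Q * _) x :=
  @estimate T F Q {ffun 'I_N -> bool} (translates a T' k0 x).
have mE d (X : measurableType d) (a : borel_action G X) (k0 : X -> Q * _) :
    label k0 -> label (E _ _ a k0).
  move=> mk0; apply: (label_comp (@estimate T F Q _)).
  exact: label_translates.
have EE : ldist (law omega (E _ _ aW k')) (law nu (E _ _ aY k)) < del.
  apply: le_lt_trans Hk'.
  apply: (ldist_comp omega nu (@estimate T F Q _)); exact: label_translates.
have bad d (X : measurableType d) (a : borel_action G X) (P : probability X R)
    (k0 : X -> Q * {ffun 'I_N -> bool}) (r : R) :
    (forall g, measurable (moved a g)) -> label k0 ->
    measurable_fun setT (stab a) ->
    (forall g : F, pr P (moved a (val g) `&`
      [set x | (k0 (a (val g) x)).2 == (k0 x).2]) <= r) ->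
    ldist (law P (E _ _ a k0))
      (law P (fun x => (translates a T (fst \o k0) x,
                        subgroup_window F (stab a x)))) <= 2 * (f%:R * r).
  move=> mmov mk0 mst Hr.
  have mL : label (fun x => (translates a T (fst \o k0) x,
                        subgroup_window F (stab a x))).
    apply: label_pair; first by apply: label_translates; exact: label_comp.
    exact: (label_measurable mst (@label_subgroup_window F)).
  apply: le_trans (ldist_neq P (mE _ _ a _ mk0) mL) _; rewrite ler_pM2l//.
  pose A (g : F) := moved a (val g) `&`
      [set x | (k0 (a (val g) x)).2 == (k0 x).2].
  have mA g : measurable (A g).
    apply: measurableI => //.
    have mk2 : label (snd \o k0) by exact: label_comp.
    have mk2g : label ((snd \o k0) \o a (val g)).
      exact: (label_measurable (measurable_act a _)).
    rewrite (_ : [set x | _] = ~` [set x | (k0 (a (val g) x)).2 != (k0 x).2]).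
      by apply: measurableC; exact: (label_neq mk2g mk2).
    by apply/seteqP; split => x /=; [move=> ->|move/negP; rewrite negbK].
  apply: (@le_trans _ _ (pr P [set x | exists g, A g x])).
    apply: pr_le.
    - by apply: label_neq => //; exact: mE.
    - rewrite (_ : [set x | _] = \bigcup_(g in [set: F]) A g).
        by apply: fin_bigcup_measurable.
      by apply/seteqP; split => x [g]; [exists g|move=> _; exists g].
    move=> x /= /negP H; apply: contrapT => /forallNP H'; apply: H; apply/eqP.
    rewrite /E estimateE; congr pair; apply/ffunP => g; rewrite !ffunE.
    have [gx|gx] := pselect (a (val g) x = x).
      by rewrite gx eqxx; apply/esym/asboolP.
    rewrite (_ : `[< _ >] = false); last by apply/asboolPn.
    by apply/negbTE/negP => kk; apply: (H' g).
  apply: le_trans (pr_exists_le P mA) _.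
  apply: (@le_trans _ _ (\sum_(g : F) r)); first by apply: ler_sum => g _; exact: Hr.
  by rewrite sumr_const -[leLHS]mulr_natl.
have badY : ldist (law nu (E _ _ aY k))
      (law nu (fun y => (translates aY T c y,
                         subgroup_window F (stab aY y)))) <= 2 * (f%:R * del).
  apply: (bad _ _ aY nu k del mY mk (measurable_stab inj_e aY mU sepU)) => g.
  by apply/ltW/HN1; exact: leq_bigmax.
have badW : ldist (law omega (E _ _ aW k'))
      (law omega (fun w => (translates aW T c' w,
                         subgroup_window F (stab aW w)))) <=
      2 * (f%:R * (2 * del)).
  apply: (bad _ _ aW omega k' (2 * del) mW mk' (measurable_stab inj_e aW mV sepV)) => g.
  (* A point with a label different from that of its image is moved, so the moved set splits into
     missed and detected points. Both actions move equally much and detect equally much up to [del];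
     hence W misses at most [2 del] where Y misses [del]. *)
  have split_moved d (X : measurableType d) (a : borel_action G X)
      (P : probability X R) (k0 : X -> Q * {ffun 'I_N -> bool}) :
      measurable (moved a (val g)) -> label k0 ->
      pr P (moved a (val g)) = pr P (moved a (val g) `&`
          [set x | (k0 (a (val g) x)).2 == (k0 x).2]) +
        pr P [set x | ~~ (E _ _ a k0 x).2 g].
    move=> mmov mk0.
    have mk2 : label (snd \o k0) by exact: label_comp.
    have mk2g : label ((snd \o k0) \o a (val g)).
      exact: (label_measurable (measurable_act a _)).
    have mne : measurable [set x | (k0 (a (val g) x)).2 != (k0 x).2].
      exact: (label_neq mk2g mk2).
    rewrite (_ : [set x | ~~ _] = [set x | (k0 (a (val g) x)).2 != (k0 x).2]);
      last by apply: eq_set => x; rewrite /E estimateE ffunE.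
    rewrite -prU//.
    - congr (pr P _); apply/seteqP; split => x /=.
        move=> gx; have [kk|kk] := eqVneq (k0 (a (val g) x)).2 (k0 x).2.
          by left.
        by right.
      by case => [[]//|/eqP H gx]; apply: H; rewrite gx.
    - apply: measurableI => //.
      rewrite (_ : [set x | _] = ~` [set x | (k0 (a (val g) x)).2 != (k0 x).2]).
        exact: measurableC.
      by apply/seteqP; split => x /=; [move=> ->|move/negP; rewrite negbK].
    - by apply/seteqP; split => // x [[_ /= /eqP ->]]; rewrite eqxx.
  have := split_moved _ _ aW omega k' (mW _) mk'.
  rewrite pr_moved (split_moved _ _ aY nu k (mY _) mk).
  have := pr_ldist omega nu (fun s : {ffun T -> Q} * {ffun F -> bool} => ~~ s.2 g) (mE _ _ aW _ mk') (mE _ _ aY _ mk).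
  have := HN1 g N (leq_bigmax _).
  move: EE; set A1 := pr nu (_ `&` _); set A2 := pr omega (_ `&` _).
  rewrite ler_norml; move=> EE /= A1d /andP[H1 H2].
  lra.
apply: (le_lt_trans (ldist_triangle (law omega (E _ _ aW k')) _ _)).
apply: (le_lt_trans (lerD (lexx _) (ldist_triangle (law nu (E _ _ aY k)) _ _))).
rewrite ldist_sym.
have : del * (6 * f%:R + 2) = eps by rewrite /del mulfVK// gt_eqF// ltr_wpDl// mulr_ge0.
move: badW badY EE; nra.
Qed.

End stabilizer_windows.

Section weighted_mass.
Context (R : realType) d (X : measurableType d) (P : probability X R).
Local Open Scope ereal_scope.

Lemma integral_label (K : finType) (l : X -> K) (v : K -> R) (D : set X) :
  label l -> (forall s, (0 <= v s)%R) -> measurable D ->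
  \int[P]_(x in D) (v (l x))%:E =
  (\sum_s v s * pr P (D `&` l @^-1` [set s]))%:E.
Proof.
move=> ml v0 mD.
transitivity (\int[P]_(x in D) \sum_s (v s)%:E * (\1_(l @^-1` [set s]) x)%:E).
  apply: eq_integral => x _; rewrite (bigD1 (l x))//= big1 ?adde0.
    by rewrite indicE mem_set// mule1.
  by move=> s sl; rewrite indicE memNset ?mule0// => /= E; rewrite E eqxx in sl.
rewrite ge0_integral_sum//; last 2 first.
- move=> s; apply: measurable_funeM; apply/measurable_EFinP.
  exact: measurable_indic.
- by move=> s x _; rewrite mule_ge0// lee_fin.
rewrite -sumEFin; apply: eq_bigr => s _.
rewrite ge0_integralZl ?lee_fin//; last first.
  by apply/measurable_EFinP; exact: measurable_indic.
have mi : measurable (D `&` l @^-1` [set s]) by apply: measurableI => //; exact: ml.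
by rewrite integral_indic// setIC EFinM prE.
Qed.

Lemma integral_le_upto (g h : X -> R) (B D : set X) (r : R) :
  measurable_fun setT g -> measurable_fun setT h ->
  (forall x, (0 <= g x)%R) -> (forall x, (0 <= h x)%R) ->
  measurable B -> measurable D -> (0 <= r)%R ->
  (forall x, (g x <= h x + (r + \1_B x))%R) ->
  \int[P]_(x in D) (g x)%:E <=
  \int[P]_(x in D) (h x)%:E + (r * pr P D + pr P (D `&` B))%:E.
Proof.
move=> mg mh g0 h0 mB mD r0 gh.
have mr : measurable_fun D (fun x => (r + \1_B x)%:E).
  by apply/measurable_EFinP; apply: measurable_funD => //; exact: measurable_indic.
have -> : (r * pr P D + pr P (D `&` B))%:E = \int[P]_(x in D) (r + \1_B x)%:E.
  under [RHS]eq_integral do rewrite EFinD.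
  rewrite ge0_integralD//; last by apply/measurable_EFinP; exact: measurable_indic.
  rewrite integral_cst// integral_indic// EFinD EFinM !prE 1?setIC//.
  exact: measurableI.
rewrite -ge0_integralD//; last 3 first.
- by move=> x _; rewrite lee_fin.
- by apply/measurable_EFinP; exact: measurable_funTS.
- by move=> x _; rewrite lee_fin addr_ge0.
apply: ge0_le_integral => //.
- by move=> x _; rewrite lee_fin.
- by apply/measurable_EFinP; exact: measurable_funTS.
- by apply: emeasurable_funD => //; apply/measurable_EFinP; exact: measurable_funTS.
- by move=> x _; rewrite -EFinD lee_fin.
Qed.

(** The error is additive in [D], so summed over the cells of a partition it is [r + pr P B],
    however many cells there are. *)
Lemma weighted_mass_approx (K : finType) (l : X -> K) (v : K -> R)
    (g : X -> R) (B D : set X) (r : R) :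
  label l -> (forall s, (0 <= v s <= 1)%R) -> measurable_fun setT g ->
  (forall x, (0 <= g x <= 1)%R) -> measurable B -> measurable D -> (0 <= r)%R ->
  (forall x, ~ B x -> (`|g x - v (l x)| <= r)%R) ->
  (`|fine (\int[P]_(x in D) (g x)%:E) -
    \sum_s v s * pr P (D `&` l @^-1` [set s])| <= r * pr P D + pr P (D `&` B))%R.
Proof.
move=> ml v01 mg g01 mB mD r0 H.
have v0 s : (0 <= v s)%R by have /andP[] := v01 s.
have g0 x : (0 <= g x)%R by have /andP[] := g01 x.
have mv : measurable_fun setT (fun x => v (l x)).
  move=> _ Y mY; rewrite setTI; exact: (label_preimage [set s | Y (v s)] ml).
have gfin : \int[P]_(x in D) (g x)%:E \is a fin_num.
  rewrite ge0_fin_numE; last by apply: integral_ge0 => x _; rewrite lee_fin.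
  apply: (@le_lt_trans _ _ (\int[P]_(x in D) (cst 1 x))).
    apply: ge0_le_integral => //.
    - by move=> x _; rewrite lee_fin.
    - by apply/measurable_EFinP; exact: measurable_funTS.
    - by move=> x _; rewrite lee_fin; have /andP[] := g01 x.
  by rewrite integral_cst// mul1e -ge0_fin_numE// fin_num_measure.
have key x : (`|g x - v (l x)| <= r + \1_B x)%R.
  rewrite indicE; case: (boolP (x \in B)); rewrite ?inE ?notin_setE => Bx.
    have /andP[a1 a2] := g01 x; have /andP[b1 b2] := v01 (l x).
    by rewrite ler_norml; apply/andP; split; rewrite /=; lra.
  by rewrite addr0; exact: H.
have E := integral_label ml v0 mD.
have h1 := integral_le_upto mg mv g0 (fun x => v0 (l x)) mB mD r0.
have h2 := integral_le_upto mv mg (fun x => v0 (l x)) g0 mB mD r0.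
rewrite ler_distl; apply/andP; split; rewrite -lee_fin.
  rewrite EFinB fineK// leeBlDr// -E; apply: h2 => x.
  by have := key x; rewrite ler_distl => /andP[+ _]; rewrite lerBlDr.
rewrite EFinD fineK// -E; apply: h1 => x.
by have := key x; rewrite ler_distl => /andP[_].
Qed.

End weighted_mass.

Lemma measurable_truncn_le (R : realType) k :
  measurable [set t : R | (Num.truncn t <= k)%N].
Proof.
rewrite (_ : [set t | _] = `]-oo, k.+1%:R[%classic); first exact: measurable_itv.
by apply/seteqP; split => t; rewrite /= in_itv /= truncn_le_nat.
Qed.

Lemma label_inord_truncn (R : realType) n :
  label (fun t : R => inord (Num.truncn t) : 'I_n.+1).
Proof.
have mE k : measurable [set t : R | Num.truncn t = k].
  rewrite (_ : [set t | _] = [set t | (Num.truncn t <= k)%N] `\`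
      [set t | (Num.truncn t < k)%N]).
    apply: measurableD; first exact: measurable_truncn_le.
    case: k => [|k]; last exact: measurable_truncn_le.
    by rewrite (_ : [set t | _] = set0)//; apply/seteqP; split.
  apply/seteqP; split => t /=; first by move=> ->; rewrite leqnn ltnn.
  by move=> [le /negP]; rewrite -leqNgt => ge; apply/eqP; rewrite eqn_leq le.
move=> i; rewrite (_ : _ @^-1` _ = \bigcup_(k in [set k | inord k = i])
    [set t | Num.truncn t = k]); first by apply: bigcup_measurable.
by apply/seteqP; split => t /=; [exists (Num.truncn t)|move=> [k /= <- ->]].
Qed.

Section weighted_weak_containment.
Context (R : realType) (G : groupType) (e : G -> nat) (inj_e : injective e).
Context d1 d2 (W : measurableType d1) (Y : measurableType d2)
  (aW : borel_action G W) (aY : borel_action G Y)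
  (omega : probability W R) (nu : probability Y R)
  (theta : probability (SubGrp G) R) (U : nat -> set Y) (V : nat -> set W)
  (m : W -> G -> Prop).
Hypotheses (mU : forall n, measurable (U n)) (sepU : separating U)
  (mV : forall n, measurable (V n)) (sepV : separating V)
  (gen_m : cylinder_generated m)
  (inv_omega : Defs.invariant aW omega)
  (typeW : stabilizer_type aW omega theta)
  (typeY : stabilizer_type aY nu theta)
  (wc : weakly_contains aW omega aY nu).

Definition weighted_mass d (X : measurableType d) (a : borel_action G X)
    (P : probability X R) (u : SubGrp G -> R) (Q : finType) (T : {fset G})
    (c : X -> Q) (f : {ffun T -> Q}) : R :=
  fine (\int[P]_(x in translates a T c @^-1` [set f]) (u (stab a x))%:E).

Variables (I Q : finType) (u : I -> SubGrp G -> R) (c : Y -> Q) (T : {fset G}).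
Hypotheses (mu : forall i, measurable_fun setT (u i))
  (u01 : forall i H, 0 <= u i H <= 1) (mc : label c).

(** Rounding down to multiples of [1 / N.+1]; the weight 1 rounds to [N.+1], hence [N.+2] values. *)
Let rounded N (H : SubGrp G) : {ffun I -> 'I_N.+2} :=
  [ffun i => inord (Num.truncn (N.+1%:R * u i H))].

Let label_rounded N : label (rounded N).
Proof.
apply: label_ffun => i.
have mt : measurable_fun setT (fun H => N.+1%:R * u i H).
  exact: measurable_funM.
exact: (label_measurable mt (@label_inord_truncn R N.+1)).
Qed.

Let rounded_le N i H :
  `|u i H - (rounded N H i)%:R / N.+1%:R| <= N.+1%:R^-1.
Proof.
have /andP[u0 u1] := u01 i H; rewrite ffunE.
have n0 : 0 < N.+1%:R :> R by rewrite ltr0n.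
have x0 : 0 <= N.+1%:R * u i H by rewrite mulr_ge0// ltW.
have /andP[t1 t2] := truncn_itv x0.
rewrite inordK; last first.
  rewrite ltnS truncn_le_nat; apply: (@le_lt_trans _ _ N.+1%:R).
    by rewrite ler_piMr// ltW.
  by rewrite ltr_nat.
set t := (Num.truncn _)%:R.
have -> : u i H - t / N.+1%:R = (N.+1%:R * u i H - t) / N.+1%:R.
  by rewrite mulrBl mulrAC mulfV ?mul1r// gt_eqF.
have n0' : 0 <= N.+1%:R^-1 :> R by rewrite invr_ge0 ltW.
rewrite normrM (ger0_norm n0') ler_piMl// ger0_norm ?subr_ge0//.
by rewrite lerBlDr addrC natr1 ltW.
Qed.

(** The weights depend on the stabilizer only, so after rounding they are nearly functions of a
    finite window of it, and [weakly_contains_stab] copies that window together with the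
    partition. *)
Lemma weakly_contains_weighted eps : 0 < eps ->
  exists (F : {fset G}) (psi : {ffun F -> bool} -> Q),
    \sum_i ldist (weighted_mass aW omega (u i) (T := T) (psi \o window m F))
                 (weighted_mass aY nu (u i) (T := T) c) < eps.
Proof.
(* For each [i], [2 del] each for discretizing the weight on W and on Y (rounding, then windowing)
   and for comparing the two laws. *)
move=> e0; pose del := eps / (6 * #|I|%:R + 1).
have dI : 0 < 6 * #|I|%:R + 1 :> R by rewrite ltr_wpDl// mulr_ge0.
have del0 : 0 < del by rewrite divr_gt0.
have [N] := ltr_add_invr del0; rewrite add0r => Ndel.
have [F [phi HF]] := window_approx (subgroup_cylinder inj_e) theta
  (@label_rounded N) del0.
have [c' mc' Hc'] := weakly_contains_stab inj_e mU sepU mV sepV typeW typeY wc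
  T F mc del0.
(* Replacing [c'] by a label reading finitely many bits disturbs its translates with probability at
   most [#|T|] times [del2], which costs at most [del] in law. *)
pose del2 := del / (2 * #|{: T}|%:R + 1).
have dT : 0 < 2 * #|{: T}|%:R + 1 :> R by rewrite ltr_wpDl// mulr_ge0.
have del20 : 0 < del2 by rewrite divr_gt0.
have [F' [psi Hpsi]] := window_approx gen_m omega mc' del20.
exists F', psi; set c2 := psi \o window m F'.
have mc2 : label c2 by apply: label_comp; exact: (label_window gen_m).
have mstW := measurable_stab inj_e aW mV sepV.
have mstY := measurable_stab inj_e aY mU sepU.
pose L d (X : measurableType d) (a : borel_action G X) (k : X -> Q) x :=
  (translates a T k x, subgroup_window F (stab a x)).
have mL d (X : measurableType d) (a : borel_action G X) (k : X -> Q) :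
    measurable_fun setT (stab a) -> label k -> label (L _ _ a k).
  move=> mst mk; apply: label_pair; first exact: label_translates.
  exact: (label_measurable mst (@label_subgroup_window _ _ inj_e F)).
have LL : ldist (law omega (L _ _ aW c2)) (law nu (L _ _ aY c)) <= 2 * del.
  apply: (le_trans (ldist_triangle (law omega (L _ _ aW c')) _ _)).
  rewrite mulr2n mulrDl mul1r lerD ?(ltW Hc')//.
  apply: le_trans (ldist_neq omega (mL _ _ aW _ mstW mc2) (mL _ _ aW _ mstW mc')) _.
  have : pr omega [set x | L _ _ aW c2 x != L _ _ aW c' x] <=
      #|{: T}|%:R * pr omega [set x | c2 x != c' x].
    apply: le_trans (translates_neq T inv_omega mc2 mc'); apply: pr_le.
    - by apply: label_neq; exact: mL.
    - by apply: label_neq; exact: label_translates.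
    by move=> x /=; apply: contra => /eqP; rewrite /L => ->.
  have : pr omega [set x | c2 x != c' x] <= del2.
    by under eq_set do rewrite eq_sym; exact: ltW.
  have : del2 * (2 * #|{: T}|%:R + 1) = del by rewrite mulfVK// gt_eqF.
  have : 0 <= #|{: T}|%:R :> R by [].
  nra.
pose v i (s : {ffun F -> bool}) : R := (phi s i)%:R / N.+1%:R.
have v01 i s : 0 <= v i s <= 1.
  by rewrite divr_ge0//= ler_pdivrMr ?ltr0n// mul1r ler_nat -ltnS.
pose A d (X : measurableType d) (P : probability X R) (a : borel_action G X)
    (k : X -> Q) i f := \sum_s v i s * law P (L _ _ a k) (f, s).
have approx d (X : measurableType d) (P : probability X R) (a : borel_action G X)
    (k : X -> Q) i : measurable_fun setT (stab a) -> label k ->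
    stabilizer_type a P theta ->
    ldist (weighted_mass a P (u i) (T := T) k) (A _ _ P a k i) <= 2 * del.
  move=> mst mk tP.
  pose B := [set x | rounded N (stab a x) != phi (subgroup_window F (stab a x))].
  have mB0 : measurable [set H | rounded N H != phi (subgroup_window F H)].
    apply: label_neq; first exact: label_rounded.
    by apply: (label_comp phi); exact: (label_subgroup_window inj_e).
  have mB : measurable B by have := mst measurableT _ mB0; rewrite setTI.
  have prB : pr P B <= del.
    by apply: ltW; apply: le_lt_trans HF; rewrite /pr tP.
  apply: (@le_trans _ _ (\sum_f (N.+1%:R^-1 * law P (translates a T k) f +
      pr P (B `&` translates a T k @^-1` [set f])))).
    apply: ler_sum => f _.
    have mD : measurable (translates a T k @^-1` [set f]) by exact: label_translates.
    rewrite [B `&` _]setIC.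
    have -> : A _ _ P a k i f = \sum_s v i s * pr P ((translates a T k @^-1` [set f])
        `&` (subgroup_window F \o stab a) @^-1` [set s]).
      apply: eq_bigr => s _; congr (_ * pr P _).
      by apply/seteqP; split => x /=; rewrite /L => -[-> ->].
    apply: weighted_mass_approx => //.
    - exact: (label_measurable mst (@label_subgroup_window _ _ inj_e F)).
    - exact: (measurableT_comp (mu i) mst).
    move=> x /negP; rewrite negbK => /eqP E; rewrite /v /= -E; exact: rounded_le.
  rewrite big_split /= -mulr_sumr law_sum; last exact: label_translates.
  rewrite mulr1 -(pr_sum P mB (label_translates a mk)).
  by rewrite mulr2n mulrDl mul1r lerD// ltW.
have main i : ldist (weighted_mass aW omega (u i) (T := T) c2)
                 (weighted_mass aY nu (u i) (T := T) c) <= 6 * del.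
  apply: (le_trans (ldist_triangle (A _ _ omega aW c2 i) _ _)).
  have := approx _ _ omega aW c2 i mstW mc2 typeW.
  have := ldist_triangle (A _ _ nu aY c i) (A _ _ omega aW c2 i)
    (weighted_mass aY nu (u i) (T := T) c).
  have := approx _ _ nu aY c i mstY mc typeY; rewrite ldist_sym.
  have : ldist (A _ _ omega aW c2 i) (A _ _ nu aY c i) <= 2 * del.
    apply: le_trans LL; rewrite /ldist [leRHS](eq_bigr (fun fs =>
      `|law omega (L _ _ aW c2) (fs.1, fs.2) - law nu (L _ _ aY c) (fs.1, fs.2)|));
      last by move=> -[].
    rewrite -(pair_big predT predT (fun f s =>
      `|law omega (L _ _ aW c2) (f, s) - law nu (L _ _ aY c) (f, s)|)) /=.
    apply: ler_sum => f _; rewrite /A -sumrB; apply: le_trans (ler_norm_sum _ _ _) _.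
    apply: ler_sum => s _; rewrite -mulrBr normrM.
    have /andP[v0 v1] := v01 i s.
    by rewrite ger0_norm// ler_piMl.
  lra.
apply: (@le_lt_trans _ _ (\sum_(i : I) 6 * del)); first by apply: ler_sum => i _.
rewrite sumr_const -[ltLHS]mulr_natl.
have : del * (6 * #|I|%:R + 1) = eps by rewrite mulfVK// gt_eqF.
nra.
Qed.

End weighted_weak_containment.

(** * Transfer to the relatively independent joining *)

Section transfer.
Context (R : realType) (G : groupType) (e : G -> nat) (inj_e : injective e).
Context dX dZ dY (X : measurableType dX) (Z : measurableType dZ)
  (Y : measurableType dY).
Variables (aX : borel_action G X) (aZ : borel_action G Z)
  (aY : borel_action G Y).
Variables (lambda : probability (X * Z)%type R) (eta : probability Z R)
  (nu : probability Y R) (theta : probability (SubGrp G) R)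
  (UZ : nat -> set Z) (UY : nat -> set Y)
  (k : R.-pker (SubGrp G) ~> (X * Z)%type) (l : R.-pker (SubGrp G) ~> Y).
Hypotheses (mUZ : forall n, measurable (UZ n)) (sepUZ : separating UZ)
  (mUY : forall n, measurable (UY n)) (sepUY : separating UY)
  (inv_eta : Defs.invariant aZ eta)
  (snd_lambda : is_pushforward snd lambda eta)
  (ap : aperiodic aZ eta)
  (typeZ : stabilizer_type aZ eta theta)
  (typeY : stabilizer_type aY nu theta)
  (minimalY : forall (dW : measure_display) (W : measurableType dW)
     (aW : borel_action G W) (omega : probability W R),
     pmp_action aW omega -> stabilizer_type aW omega theta ->
     weakly_contains aW omega aY nu)
  (dis_k : disintegration (stab aZ \o snd) lambda theta k)
  (dis_l : disintegration (stab aY) nu theta l).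
Local Notation xi := (rel_indep_joining theta k l).

Let mstabZ := measurable_stab inj_e aZ mUZ sepUZ.
Let mstabY := measurable_stab inj_e aY mUY sepUY.
Let mstab2 : measurable_fun setT (stab aZ \o snd : X * Z -> SubGrp G) :=
  measurableT_comp mstabZ measurable_snd.
Let m1 := measurable_subgroup1 inj_e.

Variables (I Q : finType) (alpha : X * Z -> I) (c : Y -> Q) (T : {fset G}).
Hypotheses (malpha : label alpha) (mc : label c).

Let u (i : I) (H : SubGrp G) : R := fine (k H (alpha @^-1` [set i])).

Let uE i H : (u i H)%:E = k H (alpha @^-1` [set i]).
Proof. by rewrite /u fineK// pker_fin_num//; exact: malpha. Qed.

Let mu i : measurable_fun setT (u i).
Proof.
apply/measurable_EFinP.
rewrite (_ : _ \o _ = fun H => k H (alpha @^-1` [set i])).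
  exact: (measurable_kernel k _ (malpha i)).
by apply/funext => H /=; rewrite uE.
Qed.

Let u01 i H : 0 <= u i H <= 1.
Proof.
rewrite -!lee_fin uE; apply/andP; split; first exact: (measure_ge0 (k H)).
by apply: pker_le1; exact: malpha.
Qed.

Let law_xi i f :
  law xi (fun p => (alpha (p.1, p.2.1), translates aY T c p.2.2)) (i, f) =
  weighted_mass aY nu (u i) (T := T) c f.
Proof.
have mC : measurable (translates aY T c @^-1` [set f]) by exact: label_translates.
rewrite /law /pr /weighted_mass; congr fine.
transitivity (\int[nu]_(y in translates aY T c @^-1` [set f])
    k (stab aY y) (alpha @^-1` [set i]))%E; last first.
  by apply: eq_integral => y _; rewrite uE.
rewrite -(rel_indep_joining_integral_right inj_e k mstabY dis_l (malpha i) mC); congr (xi _).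
by apply/seteqP; split => p /= [-> ->].
Qed.

Section windows.
Variables (F : {fset G}).
Local Notation J := (T * F)%type.
(** The order matters: the bit at [g] of the translate of [w] by [t] is the bit of [w] at [g t]. *)
Let r (j : J) : G := (val j.2 * val j.1)%g.

Let regroup (psi : {ffun F -> bool} -> Q) (s : {ffun J -> bool}) : {ffun T -> Q} :=
  [ffun t => psi [ffun g => s (t, g)]].

(** Two translates of [z] coincide when the quotient of the group elements fixes [z]: the pattern is
    a function of Stab(z). This is the source of the conditional independence of [alpha] and the
    colours. *)
Let stab_pattern (H : SubGrp G) : {ffun J -> {ffun J -> bool}} :=
  [ffun j => [ffun j' => `[< subgroup_set H ((r j')^-1 * r j)%g >]]].

Let stab_patternE z : stab_pattern (stab aZ z) = pattern (fun j => aZ (r j)) z.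
Proof.
apply/ffunP => j; apply/ffunP => j'; rewrite !ffunE; apply: asbool_equiv_eq.
rewrite /stab /= actM; split => [H|->]; last exact: actK.
by rewrite -[LHS](actVK aZ (r j')) H.
Qed.

Let label_stab_pattern : label stab_pattern.
Proof.
apply: label_ffun => j; apply: label_ffun => j'; apply: label_bool.
exact: (measurable_bit (subgroup_cylinder inj_e)).
Qed.

Let mean i s : R := \sum_pi
  law lambda (fun p => (alpha p, pattern (fun j => aZ (r j) \o snd) p)) (i, pi) *
  coloring_prob R pi s.

(** As the colouring probability is a function of the stabilizer, the disintegration of [lambda]
    replaces the conditional weight [u i] by the actual event [alpha = i], which is the form that
    [random_labels] aims at. *)
Let meanE i s :
  (\int[eta]_z ((u i (stab aZ z))%:E *
     (coloring_prob R (pattern (fun j => aZ (r j)) z) s)%:E) = (mean i s)%:E)%E.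
Proof.
pose h (H : SubGrp G) : \bar R := (coloring_prob R (stab_pattern H) s)%:E.
have mh : measurable_fun setT h.
  apply/measurable_EFinP => _ B mB; rewrite setTI.
  exact: (label_preimage [set pi : {ffun J -> {ffun J -> bool}} |
    B (coloring_prob R pi s)] label_stab_pattern).
have h0 H : (0 <= h H)%E by rewrite lee_fin coloring_prob_ge0.
have ma : measurable (alpha @^-1` [set i]) by exact: malpha.
transitivity (\int[theta]_H (h H * k H (alpha @^-1` [set i])))%E.
  rewrite (integral_is_pushforward typeZ mstabZ)//; last 2 first.
  - by apply: emeasurable_funM => //; exact: (measurable_kernel k _ ma).
  - by move=> H; rewrite mule_ge0.
  rewrite preimage_setT; apply: eq_integral => z _.
  by rewrite /h stab_patternE -uE muleC.
rewrite (disintegration_integral mstab2 m1 dis_k ma mh h0).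
transitivity (\int[lambda]_(p in alpha @^-1` [set i])
  (coloring_prob R (pattern (fun j => aZ (r j) \o snd) p) s)%:E)%E.
  apply: eq_integral => p _; rewrite /h /= stab_patternE.
  by congr (coloring_prob R (_ : {ffun _ -> _}) s)%:E; apply/ffunP => j; apply/ffunP => j'; rewrite !ffunE.
have mp : label (pattern (fun j => aZ (r j) \o @snd X Z)).
  apply: (label_pattern mUZ sepUZ) => j.
  exact: (measurableT_comp (measurable_act aZ _) measurable_snd).
rewrite (integral_label lambda mp (v := fun pi : {ffun J -> {ffun J -> bool}} =>
  coloring_prob R pi s))//; last by move=> pi; exact: coloring_prob_ge0.
congr EFin; apply: eq_bigr => pi _; rewrite mulrC; congr (pr _ _ * _).
by apply/seteqP; split => p /= [-> ->].
Qed.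

Section bernoulli.
Context d (Omega : measurableType d) (P : probability Omega R)
  (b : nat -> Omega -> bool).
Hypotheses (mb : forall n, label (b n))
  (Pb : forall n (s : {ffun 'I_n -> bool}),
     law P (fun v => [ffun i : 'I_n => b i v]) s = 2 ^- n).
Local Notation W := (bern_measurable R inj_e).
Variable omega : probability W R.
Hypothesis omegaE : is_pushforward (orbit_colouring R inj_e aZ b)
  (product_probability eta P) omega.
Variable psi : {ffun F -> bool} -> Q.

Let bits_at (w : W) : {ffun J -> bool} := [ffun j => w (r j)].

Let label_bits_at : label bits_at.
Proof.
apply: label_ffun => j.
have := label_bool (measurable_bit (G := G) (bern_cylinder R inj_e) (r j)).
by congr label; apply/funext => w; rewrite asboolb.
Qed.

Let translates_window : translates (shift_action R inj_e) T
    (psi \o window (fun (w : W) g => w g) F) = regroup psi \o bits_at.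
Proof.
apply/funext => w; apply/ffunP => t; rewrite !ffunE /=; congr psi.
by apply/ffunP => g; rewrite !ffunE asboolb.
Qed.

Lemma weighted_mass_window i f :
  weighted_mass (shift_action R inj_e) omega (u i) (T := T)
    (psi \o window (fun (w : W) g => w g) F) f =
  \sum_(s | regroup psi s == f) mean i s.
Proof.
rewrite /weighted_mass translates_window.
have mD : measurable ((regroup psi \o bits_at) @^-1` [set f]).
  exact: (label_comp (regroup psi) label_bits_at).
have mui : measurable_fun setT (fun H => (u i H)%:E) by exact/measurable_EFinP.
have ui0 H : (0 <= (u i H)%:E)%E by rewrite lee_fin; have /andP[] := u01 i H.
rewrite (omega_integral_stab mUZ sepUZ mb Pb omegaE ap mui ui0 mD).
pose bc (p : Z * Omega) : {ffun J -> bool} :=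
  [ffun j => orbit_colouring R inj_e aZ b p (r j)].
have mbc : label bc.
  have mo : measurable_fun setT (orbit_colouring R inj_e aZ b).
    exact: measurable_orbit_colouring.
  exact: (label_measurable mo label_bits_at).
have mus : measurable_fun setT (fun p : Z * Omega => (u i (stab aZ p.1))%:E).
  exact: (measurableT_comp mui (measurableT_comp mstabZ measurable_fst)).
have -> : orbit_colouring R inj_e aZ b @^-1` ((regroup psi \o bits_at) @^-1` [set f]) =
    \big[setU/set0]_(s | regroup psi s == f) (bc @^-1` [set s]).
  apply/seteqP; split => p /=.
    move=> E; rewrite (bigD1 (bits_at (orbit_colouring R inj_e aZ b p))) /=.
      by left.
    exact/eqP.
  rewrite -bigcup_pred => -[s rs bs]; have {}rs : regroup psi s == f := rs.
  by rewrite -(eqP rs) -[in RHS]bs.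
pose ss := enum [pred s | regroup psi s == f].
rewrite (_ : \big[setU/set0]_(s | _) _ = \big[setU/set0]_(s <- ss) (bc @^-1` [set s]));
  last by rewrite /ss big_enum; apply: eq_bigl => s; rewrite inE.
have tr : trivIset [set` ss] (fun s => bc @^-1` [set s]).
  by move=> s s' _ _ [p [/= <- <-]].
rewrite (ge0_integral_bigsetU _ mbc (enum_uniq _) tr)//; last exact: measurable_funTS.
rewrite (eq_bigr (fun s => (mean i s)%:E)) => [|s _].
  by rewrite sumEFin /ss big_enum [LHS]/=; apply: eq_bigl => s; rewrite inE.
rewrite -meanE.
exact: (orbit_colouring_integral inj_e aZ eta mUZ sepUZ mb Pb r s
  (measurableT_comp mui mstabZ) (fun z => ui0 (stab aZ z))).
Qed.

End bernoulli.

(** [c'] reads through [psi] a random colouring [c0] of Z in place of the bits. Its translates are a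
    coarsening, by [regroup psi], of the colours of the points [r j z], so the estimate for [c0]
    passes on. *)
Lemma transfer_window (psi : {ffun F -> bool} -> Q) eps : 0 < eps ->
  exists2 c' : Z -> Q, label c' &
    \sum_i \sum_f `|law lambda (fun p => (alpha p, translates aZ T c' p.2)) (i, f) -
      \sum_(s | regroup psi s == f) mean i s| < eps.
Proof.
move=> e0.
have mp (j : J) : measurable_fun setT (aZ (r j) \o @snd X Z).
  exact: (measurableT_comp (measurable_act aZ _) measurable_snd).
have pushp (j : J) : is_pushforward (aZ (r j) \o @snd X Z) lambda eta.
  move=> A mA; rewrite -(inv_eta (r j) mA) snd_lambda//.
  exact: measurable_act_preimage.
have diag0 := aperiodic_diagonal mUZ sepUZ inv_eta ap.
have [c0 mc0 Hc0] := random_labels mUZ sepUZ mp pushp diag0 malpha e0.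
exists (fun z => psi [ffun g : F => c0 (aZ (val g) z)]).
  apply: (label_comp psi); apply: label_ffun => g.
  exact: (label_measurable (measurable_act aZ _) mc0).
apply: le_lt_trans Hc0.
set L := fun p : X * Z => (alpha p, [ffun j => c0 ((aZ (r j) \o @snd X Z) p)]).
have mL : label L.
  apply: label_pair => //; apply: label_ffun => j.
  exact: (label_measurable (mp j) mc0).
rewrite /ldist [leRHS](eq_bigr (fun is_ => `|law lambda L (is_.1, is_.2) -
  mean is_.1 is_.2|)); last by move=> -[].
rewrite -(pair_big predT predT (fun i s => `|law lambda L (i, s) - mean i s|)) /=.
apply: ler_sum => i _.
rewrite [leRHS](partition_big (regroup psi) predT)//=.
apply: ler_sum => f _.
have -> : law lambda (fun p => (alpha p, translates aZ T
    (fun z => psi [ffun g : F => c0 (aZ (val g) z)]) p.2)) (i, f) =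
    \sum_(s | regroup psi s == f) law lambda L (i, s).
  rewrite (_ : (fun p => _) = (fun is_ : I * {ffun J -> bool} =>
      (is_.1, regroup psi is_.2)) \o L); last first.
    apply/funext => p; rewrite /L /=; congr pair; apply/ffunP => t.
    rewrite !ffunE; congr psi; apply/ffunP => g; rewrite !ffunE /=.
    by rewrite /r /= actM.
  rewrite law_comp//.
  transitivity (\sum_(i' | i' == i) \sum_(s | regroup psi s == f)
    law lambda L (i', s)); last by rewrite big_pred1_eq.
  by rewrite pair_big /=; apply: eq_big => -[i' s] //=; rewrite xpair_eqE.
rewrite -sumrB; exact: ler_norm_sum.
Qed.

End windows.

(** The law under [xi] is a weighted mass on Y, which minimality compares with a weighted mass on
    {0,1}^G; the latter is an explicit sum of [mean], which the random colouring realizes in Z. Each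
    of the two comparisons costs [eps / 2]. *)
Lemma transfer eps : 0 < eps ->
  exists2 c' : Z -> Q, label c' &
    ldist (law lambda (fun p => (alpha p, translates aZ T c' p.2)))
          (law xi (fun p => (alpha (p.1, p.2.1), translates aY T c p.2.2))) < eps.
Proof.
move=> e0; have e2 : 0 < eps / 2 by rewrite divr_gt0.
have [d0 [Om [P [b [mb Pb]]]]] := fair_bits R.
have [omega omegaE] := exists_pushforward (product_probability eta P)
  (measurable_orbit_colouring (R := R) (inj_e := inj_e) aZ mUZ sepUZ mb).
have inv_omega := omega_invariant mUZ sepUZ inv_eta mb Pb omegaE.
have typeW := omega_stabilizer_type mUZ sepUZ mb Pb omegaE ap typeZ.
have pmpW : pmp_action (shift_action R inj_e) omega.
  by split => //; exact: bern_standard_borel.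
have wc := minimalY pmpW typeW.
have [V [mV sepV]] := standard_borel_separating (bern_standard_borel R inj_e).
have [F [psi Hpsi]] := weakly_contains_weighted inj_e mUY sepUY mV sepV
  (bern_cylinder R inj_e) inv_omega typeW typeY wc T mu u01 mc e2.
have [c' mc' Hc'] := transfer_window psi e2.
exists c' => //; rewrite [ltRHS]splitr.
apply: le_lt_trans (ltrD Hc' Hpsi).
rewrite /ldist -big_split /=.
rewrite (eq_bigr (fun t => `|law lambda (fun p => (alpha p, translates aZ T c' p.2)) (t.1, t.2) -
  weighted_mass aY nu (u t.1) (T := T) c t.2|)); last by move=> -[i f] _; rewrite law_xi.
rewrite -(pair_big predT predT (fun i f =>
  `|law lambda (fun p => (alpha p, translates aZ T c' p.2)) (i, f) -
    weighted_mass aY nu (u i) (T := T) c f|)) /=.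
apply: ler_sum => i _; rewrite -big_split /=; apply: ler_sum => f _.
rewrite (weighted_mass_window mb Pb omegaE).
by apply: le_trans (ler_normD _ _); rewrite addrA subrK.
Qed.

End transfer.

(** * Approximation by rectangles, and the two containments *)

Lemma rectangle_approx (R : realType) d1 d2 (Z : measurableType d1)
    (Y : measurableType d2) (P : probability (Z * Y)%type R) (I : finType)
    (c : Z * Y -> I) eps : label c -> 0 < eps ->
  exists (B Q : finType) (b : Z -> B) (q : Y -> Q) (phi : B * Q -> I),
    [/\ label b, label q & pr P [set p | c p != phi (b p.1, q p.2)] < eps].
Proof.
move=> mc e0.
pose L (J : finType) (f : Z * Y -> J) := exists (B Q : finType) (b : Z -> B)
  (q : Y -> Q) (phi : B * Q -> J),
  [/\ label b, label q & f = fun p => phi (b p.1, q p.2)].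
have Llab J f : L J f -> label f.
  move=> [B [Q [b [q [phi [mb mq ->]]]]]]; apply: (label_comp phi).
  apply: label_pair.
    exact: (label_measurable measurable_fst mb).
  exact: (label_measurable measurable_snd mq).
have [||||J [f [phi [[B [Q [b [q [psi [mb mq ->]]]]]] H]]]] :=
    @approx_label _ _ _ P L _ _ _ _ I c eps mc e0.
- exists unit, (fun=> tt), unit, unit, (fun=> tt), (fun=> tt), (fun=> tt).
  by split => // -[]; rewrite (_ : _ @^-1` _ = setT)//; apply/seteqP; split.
- by move=> J f /Llab.
- move=> J K f g [B [Q [b [q [phi [mb mq ->]]]]]] [B' [Q' [b' [q' [phi' [mb' mq' ->]]]]]].
  exists (B * B')%type, (Q * Q')%type, (fun z => (b z, b' z)), (fun y => (q y, q' y)),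
    (fun s => (phi (s.1.1, s.2.1), phi' (s.1.2, s.2.2))).
  by split => //; exact: label_pair.
- apply/seteqP; split.
    rewrite measurable_prod_measurableType.
    apply: smallest_sub; first exact: smallest_sigma_algebra.
    move=> _ [A mA [C mC <-]]; apply: sub_sigma_algebra.
    exists bool, (fun p => `[< A p.1 >] && `[< C p.2 >]), id; split.
      exists bool, bool, (fun z => `[< A z >]), (fun y => `[< C y >]),
        (fun s => s.1 && s.2).
      by split => //; exact: label_bool.
    apply/seteqP; split => -[z y] /=.
      by move=> [Az Cy]; apply/andP; split; exact/asboolP.
    by move=> /andP[/asboolP Az /asboolP Cy].
  apply: smallest_sub; first exact: sigma_algebra_measurable.
  by move=> _ [J [f [S [Lf ->]]]]; apply: label_preimage; exact: Llab Lf.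
by exists B, Q, b, q, (phi \o psi).
Qed.

Theorem lemma5p1 (R : realType) (G : groupType)
  (countableG : countable [set: G])
  (dX dZ dY : measure_display)
  (X : measurableType dX) (Z : measurableType dZ) (Y : measurableType dY)
  (aX : borel_action G X) (mu : probability X R) (pmpX : pmp_action aX mu)
  (aZ : borel_action G Z) (eta : probability Z R) (pmpZ : pmp_action aZ eta)
  (aperiodicZ : aperiodic aZ eta)
  (lambda : probability (X * Z)%type R)
  (joining_lambda : joining aX mu aZ eta lambda)
  (theta : probability (SubGrp G) R)
  (thetaE : is_pushforward (stab aZ \o snd) lambda theta)
  (aY : borel_action G Y) (nu : probability Y R) (pmpY : pmp_action aY nu)
  (typeY : stabilizer_type aY nu theta)
  (minimalY : forall (dW : measure_display) (W : measurableType dW)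
     (aW : borel_action G W) (omega : probability W R),
     pmp_action aW omega -> stabilizer_type aW omega theta ->
     weakly_contains aW omega aY nu)
  (lambda_ : R.-pker (SubGrp G) ~> (X * Z)%type)
  (disint_lambda : disintegration (stab aZ \o snd) lambda theta lambda_)
  (nu_ : R.-pker (SubGrp G) ~> Y)
  (disint_nu : disintegration (stab aY) nu theta nu_) :
  joining_weakly_equivalent aX mu
    aZ lambda
    (diag_action aZ aY) (rel_indep_joining theta lambda_ nu_).
Proof.
have /countable_injP[e inj_e0] := countableG.
have inj_e : injective e by move=> x y; apply: inj_e0; rewrite inE.
have [UZ [mUZ sepUZ]] := standard_borel_separating pmpZ.1.
have [UY [mUY sepUY]] := standard_borel_separating pmpY.1.
have inv_eta := pmpZ.2; have inv_nu := pmpY.2.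
have [inv_lambda fst_lambda snd_lambda] := joining_lambda.
have mstabZ := measurable_stab inj_e aZ mUZ sepUZ.
have mstabY := measurable_stab inj_e aY mUY sepUY.
have typeZ : stabilizer_type aZ eta theta.
  move=> A mA; rewrite thetaE// /pushforward snd_lambda//.
  by have := mstabZ measurableT _ mA; rewrite setTI.
set xi := rel_indep_joining theta lambda_ nu_.
pose aZY := diag_action aZ aY.
have inv_xi : Defs.invariant (diag_action aX aZY) xi.
  exact: (rel_indep_joining_invariant inj_e mstabZ mstabY inv_lambda inv_nu
    typeY disint_lambda disint_nu).
(* The marginal on Z times Y: it witnesses that [xi] is a joining, and measures how well rectangles
   approximate [c]. *)
have [zeta zetaE] := exists_pushforward xi (@measurable_snd _ _ X (Z * Y)%type).
have inv_zeta : Defs.invariant aZY zeta.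
  move=> g A mA.
  have mA' : measurable (snd @^-1` A : set (X * (Z * Y))).
    by rewrite -[X in measurable X]setTI; exact: measurable_snd.
  rewrite (zetaE _ (measurable_act_preimage aZY g mA)) (zetaE _ mA).
  exact: (inv_xi g _ mA').
have jlambda : joining_over aX mu aZ lambda by exists eta.
have jxi : joining_over aX mu aZY xi.
  exists zeta; split => // A mA; rewrite fst_lambda// /pushforward.
  have mA' : measurable (fst @^-1` A : set (X * Z)).
    by rewrite -[X in measurable X]setTI; exact: measurable_fst.
  by rewrite -(rel_indep_joining_fst nu_ disint_lambda mA').
have labX d (W : measurableType d) k (A : X -> 'I_k) (J : finType) (h : W -> J) :
    label A -> label h -> label (fun p : X * W => (A p.1, h p.2)).
  move=> mA mh; apply: label_pair.
    exact: (label_measurable measurable_fst mA).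
  exact: (label_measurable measurable_snd mh).
split; apply: joining_weakly_contains_label => // m n A c T eps mA mc e0.
  pose N := #|{: T}|%:R : R; have N0 : 0 <= N by rewrite ler0n.
  (* With a union bound over [T] and the factor 2 of [ldist_neq], replacing [c] by [c2] costs at
     most [eps / 2]; [N + 1] keeps the quotient meaningful for empty [T]. *)
  have e4 : 0 < eps / (4 * (N + 1)) by rewrite divr_gt0// mulr_gt0// ltr_wpDl.
  have [B [Q [b [q [phi [mb mq Hphi]]]]]] := rectangle_approx zeta mc e4.
  pose c2 p := phi (b p.1, q p.2).
  have mc2 : label c2.
    apply: (label_comp phi); apply: label_pair.
      exact: (label_measurable measurable_fst mb).
    exact: (label_measurable measurable_snd mq).
  (* The translates of [b] are included in [alpha], so that all translates of [phi (b, q)] are a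
     function of [alpha] and the translates of [q]; [Gamma] is this function. *)
  pose alpha (p : X * Z) := (A p.1, translates aZ T b p.2).
  have malpha : label alpha by exact: labX mA (label_translates aZ mb).
  have e2 : 0 < eps / 2 by rewrite divr_gt0.
  have [e' me' He'] := transfer inj_e mUZ sepUZ mUY sepUY inv_eta snd_lambda
    aperiodicZ typeZ typeY minimalY disint_lambda disint_nu T malpha mq e2.
  pose Gamma (s : 'I_m * {ffun T -> B} * {ffun T -> Q}) :=
    (s.1.1, [ffun t => phi (s.1.2 t, s.2 t)]).
  exists (fun z => phi (b z, e' z)).
    by apply: (label_comp phi); exact: label_pair.
  have l1 : label (fun p => (alpha p, translates aZ T e' p.2)).
    apply: label_pair => //.
    exact: (label_measurable measurable_snd (label_translates aZ me')).
  have mW : measurable_fun setT (fun p : X * (Z * Y) => (p.1, p.2.1)).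
    apply: measurable_fun_pair; first exact: measurable_fst.
    exact: (measurableT_comp measurable_fst measurable_snd).
  have mW' : measurable_fun setT (fun p : X * (Z * Y) => p.2.2).
    exact: (measurableT_comp measurable_snd measurable_snd).
  have l2 : label (fun p : X * (Z * Y) =>
      (alpha (p.1, p.2.1), translates aY T q p.2.2)).
    apply: label_pair; first exact: (label_measurable mW malpha).
    exact: (label_measurable mW' (label_translates aY mq)).
  have E1 : (fun p => (A p.1, translates aZ T (fun z => phi (b z, e' z)) p.2)) =
      Gamma \o (fun p => (alpha p, translates aZ T e' p.2)).
    by apply/funext => p; congr pair; apply/ffunP => t; rewrite !ffunE.
  have E2 : (fun p : X * (Z * Y) => (A p.1, translates aZY T c2 p.2)) =
      Gamma \o (fun p => (alpha (p.1, p.2.1), translates aY T q p.2.2)).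
    by apply/funext => p; congr pair; apply/ffunP => t; rewrite !ffunE.
  have Hd := ldist_comp lambda xi Gamma l1 l2.
  rewrite -E1 -E2 in Hd.
  have mt := label_translates (T := T) aZY mc.
  have mt2 := label_translates (T := T) aZY mc2.
  have Hn := ldist_neq xi (labX _ _ _ _ _ _ mA mt2) (labX _ _ _ _ _ _ mA mt).
  have Hz : pr xi [set p | (A p.1, translates aZY T c2 p.2) !=
      (A p.1, translates aZY T c p.2)] <= N * pr zeta [set p | c p != c2 p].
    have mneq := label_neq mt2 mt.
    have H := translates_neq T inv_zeta mc2 mc.
    rewrite (_ : [set p | c p != c2 p] = [set p | c2 p != c p]); last first.
      by apply/seteqP; split => p /=; rewrite eq_sym.
    apply: le_trans H; rewrite /pr (zetaE _ mneq).
    rewrite (_ : [set p : X * (Z * Y) | _] =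
      snd @^-1` [set p | translates aZY T c2 p != translates aZY T c p])//.
    by apply/seteqP; split => p /=; rewrite xpair_eqE eqxx.
  apply: le_lt_trans (ldist_triangle
    (law xi (fun p => (A p.1, translates aZY T c2 p.2))) _ _) _.
  have Hb : N * pr zeta [set p | c p != c2 p] <= eps / 4.
    have : N * pr zeta [set p | c p != c2 p] <= N * (eps / (4 * (N + 1))).
      by apply: ler_wpM2l => //; exact: ltW.
    move=> /le_trans; apply.
    have N1 : 0 < N + 1 by rewrite ltr_wpDl.
    rewrite (_ : N * _ = eps / 4 * (N / (N + 1))); last by field; rewrite gt_eqF.
    rewrite ler_piMr ?divr_ge0 ?(ltW e0)//.
    by rewrite ler_pdivrMr// mul1r lerDl.
  rewrite (_ : eps = eps / 2 + 2 * (eps / 4)); last by field.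
  apply: ltr_leD (le_lt_trans Hd He') (le_trans Hn _).
  by rewrite ler_pM2l//; exact: le_trans Hz Hb.
(* The converse direction: a partition of Z pulled back to Z times Y has exactly the same law,
   because [xi] projects to [lambda]. *)
pose c' (p : Z * Y) := c p.1.
have mc' : label c' by exact: (label_measurable measurable_fst mc).
exists c' => //.
rewrite (_ : ldist _ _ = 0)//; apply: big1 => i _.
suff -> : law xi (fun p => (A p.1, translates aZY T c' p.2)) i =
  law lambda (fun p => (A p.1, translates aZ T c p.2)) i by rewrite subrr normr0.
rewrite /law /pr -(rel_indep_joining_fst nu_ disint_lambda (labX _ _ _ _ _ _ mA (label_translates aZ mc) i)).
congr (fine (xi _)); apply/seteqP; split => p /= <-; congr pair; apply/ffunP => t;
  by rewrite !ffunE.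
Qed.
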